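(* Let $p$ be a polynomial on $\mathbb{R}^m$ and put $K(iy,z):=e^{-\Delta_{(y)}/2}E_\kappa(iy,z)$. Then for every $z\in\mathbb{R}^m$, $$V_\kappa(p)(z)=\frac{1}{(2\pi)^{m/2}}\int_{\mathbb{R}^m}K(iy,z)\,\mathcal F\big(p(\cdot)e^{-|\cdot|^2/2}\big)(y)\,dy =\frac{1}{(2\pi)^{m/2}}\int_{\mathbb{R}^m}\mathcal F\big(e^{-|\cdot|^2/2}E_\kappa(\cdot,-z)\big)(y)\,\mathcal F\big(e^{-|\cdot|^2/2}p(\cdot)\big)(y)\,e^{|y|^2/2}\,dy,$$ the integrals being absolutely convergent.
   Context: Let $G\subset O(m)$ be a finite reflection group with root system $R$, fixed positive subsystem $R_+$, and let $\kappa:R\to[0,\infty)$ be a $G$-invariant multiplicity function. For $\alpha\in R$, $\sigma_\alpha x=x-2\langle x,\alpha\rangle\alpha/\|\alpha\|^2$. The Dunkl operators are $T_jf(x)=\partial_jf(x)+\sum_{\alpha\in R_+}\kappa(\alpha)\alpha_j\frac{f(x)-f(\sigma_\alpha x)}{\langle \alpha,x\rangle}$, $j=1,\dots,m$. The intertwining operator $V_\kappa$ is the unique linear isomorphism of the space $\mathcal P$ of polynomials on $\mathbb{R}^m$ that maps homogeneous polynomials of degree $n$ to homogeneous polynomials of degree $n$, satisfies $V_\kappa1=1$ and $T_jV_\kappa=V_\kappa\partial_j$ for all $j$. The Dunkl kernel $E_\kappa(x,y)$ (extended holomorphically to $\mathbb{C}^m\times\mathbb{C}^m$) is the unique function with $T^{(x)}_jE_\kappa(x,y)=y_jE_\kappa(x,y)$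 for all $j$ and $E_\kappa(0,y)=1$; equivalently $E_\kappa(x,y)=V_\kappa(e^{\langle\cdot,y\rangle})(x)$. $\Delta_{(y)}$ is the ordinary Laplacian in $y$ and $e^{-\Delta_{(y)}/2}F(y)=\sum_{n\ge0}\frac{(-1)^n}{2^nn!}\Delta_{(y)}^nF(y)$; for $F(y)=E_\kappa(iy,z)$ this converges and equals $V_\kappa$ applied in $z$ to $x\mapsto e^{|x|^2/2}e^{i\langle y,x\rangle}$. The Fourier transform is $\mathcal Ff(y)=(2\pi)^{-m/2}\int_{\mathbb{R}^m}e^{-i\langle x,y\rangle}f(x)\,dx$. *)

(* Defs.v *)
From HB Require Import structures.
From mathcomp Require Import all_boot all_order all_algebra.
(* mpoly must be imported BEFORE mathcomp-analysis (notation-level clash otherwise) *)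
From mathcomp Require Import mpoly.
From mathcomp Require Import all_classical all_reals all_analysis.
From mathcomp Require Import complex.

Set Implicit Arguments.
Unset Strict Implicit.
Unset Printing Implicit Defensive.

Import Order.TTheory GRing.Theory Num.Theory.
Import numFieldNormedType.Exports.
Local Open Scope ring_scope.
Local Open Scope complex_scope.

Section Dunkl.
Variable R : realType.
Variable m : nat.

Notation C := (R[i]).
Notation vecR := ('rV[R]_m).
Notation vecC := ('rV[(R[i])^o]_m).

Definition dotR (u v : vecR) : R := \sum_(j < m) u 0 j * v 0 j.
Definition dotC (u v : vecC) : C := \sum_(j < m) u 0 j * v 0 j.
Definition toC (x : vecR) : vecC := map_mx (fun a : R => (a%:C : C^o)) x.
Definition itoC (y : vecR) : vecC := map_mx (fun a : R => ((0 +i* a) : C^o)) y.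
Definition eR (j : 'I_m) : vecR := \row_(k < m) (if k == j then 1 else 0).
Definition eC (j : 'I_m) : vecC := \row_(k < m) (if k == j then 1 else 0).

Definition refl (a x : vecR) : vecR := x - (2 * dotR x a / dotR a a) *: a.
Definition reflC (a : vecR) (x : vecC) : vecC :=
  x - ((2 * dotC x (toC a) / (dotR a a)%:C) : C^o) *: toC a.

Definition root_system (Rs : seq vecR) : Prop :=
  [/\ uniq Rs, 0 \notin Rs,
      (forall a b, a \in Rs -> b \in Rs -> refl a b \in Rs),
      (forall a, a \in Rs -> -a \in Rs) &
      (forall a (c : R), a \in Rs -> c *: a \in Rs -> c = 1 \/ c = -1)].

Definition positive_subsystem (Rs Rp : seq vecR) : Prop :=
  uniq Rp /\
  exists b : vecR, (forall a, a \in Rs -> dotR a b != 0) /\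
                   (forall a, a \in Rp <-> (a \in Rs /\ 0 < dotR a b)).

(* kappa : R -> [0,oo), invariant under the reflection group G generated by
   the sigma_beta, beta in R (invariance under the generators). *)
Definition multiplicity (Rs : seq vecR) (kappa : vecR -> R) : Prop :=
  (forall a, a \in Rs -> 0 <= kappa a) /\
  (forall a b, a \in Rs -> b \in Rs -> kappa (refl b a) = kappa a).

Definition regular (Rp : seq vecR) (x : vecR) : Prop :=
  forall a, a \in Rp -> dotR a x != 0.
Definition regularC (Rp : seq vecR) (x : vecC) : Prop :=
  forall a, a \in Rp -> dotC (toC a) x != 0.

(* T_j f (x), for f : R^m -> R (valid at regular x) *)
Definition dunkl (Rp : seq vecR) (kappa : vecR -> R) (j : 'I_m)
    (f : vecR -> R) (x : vecR) : R :=
  'D_(eR j) f x +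
  \sum_(a <- Rp) kappa a * a 0 j * (f x - f (refl a x)) / dotR a x.

(* T_j f (x), for f : C^m -> C holomorphic (complex partial derivatives) *)
Definition dunklC (Rp : seq vecR) (kappa : vecR -> R) (j : 'I_m)
    (f : vecC -> C^o) (x : vecC) : C :=
  'D_(eC j) f x +
  \sum_(a <- Rp) ((kappa a * a 0 j)%:C * (f x - f (reflC a x)) / dotC (toC a) x).

Definition peval (p : mpoly.mpoly m R) (x : vecR) : R :=
  mpoly.meval (fun i => x 0 i) p.

Definition intertwiner (Rp : seq vecR) (kappa : vecR -> R)
    (V : mpoly.mpoly m R -> mpoly.mpoly m R) : Prop :=
  [/\ (forall (c : R) (p q : mpoly.mpoly m R), V (c *: p + q) = c *: V p + V q),
      bijective V,
      (forall (n : nat) p, p \is mpoly.ishomog1 n mpoly.mdeg ->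
                          V p \is mpoly.ishomog1 n mpoly.mdeg),
      V 1 = 1 &
      (forall j p x, regular Rp x ->
         dunkl Rp kappa j (peval (V p)) x = peval (V (mpoly.mderiv j p)) x)].

Definition dunkl_kernel (Rp : seq vecR) (kappa : vecR -> R)
    (E : vecC -> vecC -> C) : Prop :=
  [/\ (forall w x j, derivable (fun x : vecC => (E x w : C^o)) x (eC j)),
      (forall w x j, regularC Rp x ->
         dunklC Rp kappa j (fun x => E x w) x = w 0 j * E x w) &
      (forall w, E 0 w = 1)].

Definition partialRC (j : 'I_m) (F : vecR -> C) (y : vecR) : C :=
  ('D_(eR j) (fun y => complex.Re (F y)) y) +i* ('D_(eR j) (fun y => complex.Im (F y)) y).
Definition laplaceRC (F : vecR -> C) (y : vecR) : C :=
  \sum_(j < m) partialRC j (partialRC j F) y.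

Definition heat_half (F : vecR -> C) (y : vecR) : C :=
  limn (fun N => \sum_(0 <= n < N)
          ((((-1) ^+ n / (2 ^+ n * n`!%:R) : R)%:C * iter n laplaceRC F y) : C^o)).

Definition Kker (E : vecC -> vecC -> C) (y z : vecR) : C :=
  heat_half (fun y' => E (itoC y') (toC z)) y.

(* ---------- Lebesgue integration on R^m (iterated, Fubini/Tonelli) -------- *)
Definition rowT (t : m.-tuple R) : vecR := \row_(j < m) tnth t j.
Definition set_coord (x : vecR) (k : nat) (t : R) : vecR :=
  \row_(j < m) (if (j : nat) == k then t else x 0 j).

Fixpoint iint_e (k : nat) (g : vecR -> \bar R) (x : vecR) : \bar R :=
  match k with
  | 0 => g x
  | k'.+1 => (\int[lebesgue_measure]_(t in setT) iint_e k' g (set_coord x k' t))%E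
  end.
Fixpoint iint_r (k : nat) (f : vecR -> R) (x : vecR) : R :=
  match k with
  | 0 => f x
  | k'.+1 => Rintegral lebesgue_measure setT (fun t => iint_r k' f (set_coord x k' t))
  end.

Definition cabs (z : C) : R := Num.sqrt (complex.Re z ^+ 2 + complex.Im z ^+ 2).

Definition abs_integrable (f : vecR -> C) : Prop :=
  [/\ measurable_fun setT (fun t : m.-tuple R => complex.Re (f (rowT t))),
      measurable_fun setT (fun t : m.-tuple R => complex.Im (f (rowT t))) &
      (iint_e m (fun x => (cabs (f x))%:E) 0 < +oo)%E].

Definition integralRm (f : vecR -> C) : C :=
  (iint_r m (fun x => complex.Re (f x)) 0) +i* (iint_r m (fun x => complex.Im (f x)) 0).

Definition normsq (x : vecR) : R := dotR x x.

Definition cst2pi : R := (Num.sqrt (2 * pi)) ^- m.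

Definition expi (t : R) : C := cos t +i* sin t.

Definition fourier (f : vecR -> C) (y : vecR) : C :=
  cst2pi%:C * integralRm (fun x => expi (- dotR x y) * f x).

End Dunkl.

(* Main.v *)
(* For homogeneous p of degree n, Euler's identity gives
     n V p + sum_a kappa(a) (V p - V p o sigma_a) = sum_j x_j V (d_j p),
   and a maximum principle for the left-hand side on balls bounds V(X^nu)(x) by |x|^|nu|.
   Only complex partial derivatives of E are given, so Hartogs' theorem is needed to make
   E(., w) jointly entire; on a line s |-> s x its Taylor coefficients then satisfy the same
   recursion, whence E(s x, w) = sum_n s^n V(<., w>^n)(x) / n!.
   Fix z and write L p = V p (z). Expanding e^{-Delta/2} termwise,
     K(iy, z) = sum_{k,n} (-1)^k i^n L(|X|^(2k) <y, X>^n) / (2^k k! n!)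
              = sum_nu i^|nu| He_nu(y) L(X^nu) / nu!,
   with partial sums (over 2k + n < N, resp. |nu| < N) dominated by C e^(c |y|_1).
   Since F(x^nu e^(-|x|^2/2))(y) = (-i)^|nu| He_nu(y) e^(-|y|^2/2), the second integrand equals
   the first, and orthogonality of the Hermite polynomials evaluates the integral by dominated
   convergence. *)

From HB Require Import structures.
From mathcomp Require Import all_boot all_order all_algebra.
From mathcomp Require Import mpoly.
From mathcomp Require Import all_classical all_reals all_analysis.
From mathcomp Require Import measurable_realfun.
From mathcomp Require Import complex ring lra zify.
Require Import Defs.
Set Implicit Arguments.
Unset Strict Implicit.
Unset Printing Implicit Defensive.
Import Order.TTheory GRing.Theory Num.Theory.
Import numFieldNormedType.Exports.
Local Open Scope ring_scope.
Local Open Scope complex_scope.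

(** * Entire functions of one complex variable *)

(** The hypotheses on [E] give complex partial derivatives one at a time, without joint continuity
    or local boundedness, so Hartogs' theorem has to come first. The one-variable theory behind it
    rests on circle means, read through the exponential as integrals over vertical segments. The
    kernel series for E(iy, z) applies [V] to powers of <., z> and evaluates at y, whereas [L]
    evaluates at z. The exchange is the symmetry of the homogeneous parts, obtained from their
    invariance under reflections. Invariance, symmetry and the identification of the Taylor
    coefficients all rest on one uniqueness statement: the maximum principle with zero right-hand
    side. [V] acts on real polynomials, so each complex series is carried as two real ones, told
    apart by a phase. Integrals over R^m are iterated; the approximants are therefore finite sums of
    products of one-variable functions, whose partial integrals are explicit, and dominated
    convergence is applied one variable at a time under a product of factors exp(-t^2/4). *)

Section RealIntegral.
Variable R : realType.
Implicit Types (u v : R -> R) (a b c : R).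

Definition itg u a b : R := \int[lebesgue_measure]_(x in `[a, b]) u x.

Lemma itg_integrable u a b : continuous u ->
  (@lebesgue_measure R).-integrable `[a, b]%classic (EFin \o u).
Proof.
move=> uc; apply: continuous_compact_integrable.
  exact: segment_compact.
by apply: continuous_subspaceT.
Qed.

Lemma itgB u v a b : continuous u -> continuous v ->
  itg (fun x => u x - v x) a b = itg u a b - itg v a b.
Proof. by move=> uc vc; rewrite /itg RintegralB//; exact: itg_integrable. Qed.

Lemma itgD u v a b : continuous u -> continuous v ->
  itg (fun x => u x + v x) a b = itg u a b + itg v a b.
Proof. by move=> uc vc; rewrite /itg RintegralD//; exact: itg_integrable. Qed.

Lemma itgZ k u a b : continuous u ->
  itg (fun x => k * u x) a b = k * itg u a b.
Proof. by move=> uc; rewrite /itg RintegralZl//; exact: itg_integrable. Qed.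

Lemma itg_cst k a b : a <= b -> itg (fun=> k) a b = k * (b - a).
Proof.
move=> ab; rewrite /itg Rintegral_cst//= lebesgue_measure_itv/= lte_fin.
by move: ab; rewrite le_eqVlt => /predU1P[->|->//]; rewrite ltxx subrr mulr0.
Qed.

Lemma itg_split u a b c : continuous u -> a <= b -> b <= c ->
  itg u a c = itg u a b + itg u b c.
Proof.
move=> uc ab bc; rewrite /itg -(@Rintegral_itv_obnd_cbnd _ b); last first.
  apply: integrableS (itg_integrable a c uc) => //.
  by apply: subset_itv; rewrite bnd_simp.
rewrite -(Rintegral_itvB (itg_integrable a c uc)) ?bnd_simp//.
by rewrite addrC subrK.
Qed.

Lemma le_itg u v a b : continuous u -> continuous v ->
  (forall x, a <= x <= b -> u x <= v x) -> itg u a b <= itg v a b.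
Proof.
by move=> uc vc uv; apply: le_Rintegral => //; exact: itg_integrable.
Qed.

Lemma itg_near u a b k e : continuous u -> a <= b ->
  (forall x, a <= x <= b -> `|u x - k| <= e) ->
  `|itg u a b - k * (b - a)| <= e * (b - a).
Proof.
move=> uc ab H; rewrite -itg_cst// -itgB//; last exact: cst_continuous.
have cc : continuous (fun x => u x - k).
  by move=> x; apply: continuousB; [exact: uc|exact: cst_continuous].
rewrite ler_norml -mulNr -!itg_cst//; apply/andP; split; apply: le_itg => //;
  try exact: cst_continuous; by move=> x /H; rewrite ler_norml => /andP[].
Qed.

Lemma itg_bound u a b e : continuous u -> a <= b ->
  (forall x, a <= x <= b -> `|u x| <= e) -> `|itg u a b| <= e * (b - a).
Proof.
move=> uc ab H; have := @itg_near u a b 0 e uc ab.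
by rewrite mul0r subr0; apply => x /H; rewrite subr0.
Qed.

End RealIntegral.

(** * Nested rectangles, dependent choice and bisection *)

Section Squares.
Variable R : realType.

Lemma nested_point (a c : nat -> R) :
  (forall n, a n <= a n.+1) -> (forall n, c n.+1 <= c n) ->
  (forall n, a n <= c n) -> exists x : R, forall n, a n <= x <= c n.
Proof.
move=> ia ic ac.
have ha i n : (a i <= a (i + n)%N).
  by elim: n => [|n IH]; rewrite ?addn0// addnS (le_trans IH).
have hc i n : (c (i + n)%N <= c i).
  by elim: n => [|n IH]; rewrite ?addn0// addnS (le_trans _ IH).
have acc i j : a i <= c j.
  by rewrite (le_trans (ha i j))// (le_trans (ac _))// addnC hc.
have hs : has_sup (range a).
  by split; [exists (a 0%N), 0%N|exists (c 0%N) => _ [i _ <-]].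
exists (sup (range a)) => n; apply/andP; split.
  by apply: sup_upper_bound => //; exists n.
apply: ge_sup; first by exists (a 0%N), 0%N.
by move=> _ [i _ <-].
Qed.

(** A triple [(a, b, h)] stands for the rectangle [a, a + p h] x [b, b + q h]: the aspect is fixed,
    only corner and scale vary. *)
Definition sub_rect (p q : R) (s t : R * R * R) : Prop :=
  [/\ t.1.1 <= s.1.1, s.1.1 + p * s.2 <= t.1.1 + p * t.2,
      t.1.2 <= s.1.2 & s.1.2 + q * s.2 <= t.1.2 + q * t.2].

Lemma nested_rect (p q : R) (s : nat -> R * R * R) :
  0 <= p -> 0 <= q -> (forall n, 0 < (s n).2) ->
  (forall n, sub_rect p q (s n.+1) (s n)) ->
  exists x y : R, forall n, ((s n).1.1 <= x <= (s n).1.1 + p * (s n).2) /\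
     ((s n).1.2 <= y <= (s n).1.2 + q * (s n).2).
Proof.
move=> p0 q0 h0 sub.
have [x Hx] := @nested_point (fun n => (s n).1.1) (fun n => (s n).1.1 + p * (s n).2)
  (fun n => let: And4 a _ _ _ := sub n in a)
  (fun n => let: And4 _ a _ _ := sub n in a)
  (fun n => ltac:(by rewrite lerDl mulr_ge0// ltW)).
have [y Hy] := @nested_point (fun n => (s n).1.2) (fun n => (s n).1.2 + q * (s n).2)
  (fun n => let: And4 _ _ a _ := sub n in a)
  (fun n => let: And4 _ _ _ a := sub n in a)
  (fun n => ltac:(by rewrite lerDl mulr_ge0// ltW)).
by exists x, y.
Qed.

(** The relation may depend on the step, so that the n-th choice can avoid the n-th set of a
    covering, as Baire's argument requires. *)
Lemma dep_choice (T : Type) (P : T -> Prop) (S : nat -> T -> T -> Prop) t0 :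
  P t0 -> (forall n t, P t -> exists2 t', P t' & S n t' t) ->
  exists s : nat -> T, [/\ s 0%N = t0, forall n, P (s n) & forall n, S n (s n.+1) (s n)].
Proof.
move=> P0 H.
have /choice[f Hf] : forall nt : nat * T, exists t', P nt.2 -> P t' /\ S nt.1 t' nt.2.
  case=> n t; have [Pt|nPt] := pselect (P t); last by exists t.
  by have [t' ? ?] := H n t Pt; exists t'.
pose s := fix s n := if n is n'.+1 then f (n', s n') else t0.
have Ps n : P (s n) by elim: n => [|n IH] //=; exact: (Hf (n, s n) IH).1.
by exists s; split=> // n; exact: (Hf (n, s n) (Ps n)).2.
Qed.

(** Common core of the bisection arguments: a property inherited by one of the four quarters
    accumulates, at arbitrarily small scales, at the common point of the nested quarters. *)
Lemma bisect2 (p q : R) (Bad : R -> R -> R -> Prop) (a b h : R) :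
  0 <= p -> 0 <= q -> 0 < h -> Bad a b h ->
  (forall a b h : R, 0 < h -> Bad a b h ->
    let k : R := h / 2 in
    [\/ Bad a b k, Bad (a + p * k) b k, Bad a (b + q * k) k
      | Bad (a + p * k) (b + q * k) k]) ->
  exists x y : R, forall d : R, 0 < d -> exists a' b' h' : R, [/\ 0 < h' < d,
     a' <= x <= a' + p * h', b' <= y <= b' + q * h' & Bad a' b' h'].
Proof.
move=> p0 q0 h0 B0 H.
pose P (t : R * R * R) := 0 < t.2 /\ Bad t.1.1 t.1.2 t.2.
pose S (n : nat) (t' t : R * R * R) := t'.2 = t.2 / 2 /\ sub_rect p q t' t.
have [//||s [s0 sP sS]] := @dep_choice _ P S (a, b, h).
  move=> n [[a1 b1] h1] [/= h10 B1].
  have k0 : 0 < h1 / 2 by rewrite divr_gt0.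
  have e : h1 = h1 / 2 + h1 / 2 by rewrite -splitr.
  have pk : 0 <= p * (h1 / 2) by rewrite mulr_ge0// ltW.
  have qk : 0 <= q * (h1 / 2) by rewrite mulr_ge0// ltW.
  have pe : p * h1 = p * (h1 / 2) + p * (h1 / 2) by rewrite -mulrDr -e.
  have qe : q * h1 = q * (h1 / 2) + q * (h1 / 2) by rewrite -mulrDr -e.
  case: (H a1 b1 h1 h10 B1) => B.
  - by exists (a1, b1, h1 / 2); split=> //; split=> /=; lra.
  - by exists (a1 + p * (h1 / 2), b1, h1 / 2); split=> //; split=> /=; lra.
  - by exists (a1, b1 + q * (h1 / 2), h1 / 2); split=> //; split=> /=; lra.
  - by exists (a1 + p * (h1 / 2), b1 + q * (h1 / 2), h1 / 2);
      split=> //; split=> /=; lra.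
have [x [y xy]] := nested_rect p0 q0 (fun n => (sP n).1) (fun n => (sS n).2).
exists x, y => d d0.
have hn n : (s n).2 = h / 2 ^+ n.
  elim: n => [|n IH]; first by rewrite s0 expr0 divr1.
  by rewrite (sS n).1 IH exprS; field; rewrite expf_neq0//.
have [n nd] : exists n, h / 2 ^+ n < d.
  have /cvgrPdist_lt/(_ (d / h)) := @cvg_expr R 2^-1 ltac:(rewrite ger0_norm; lra).
  rewrite divr_gt0// => /(_ isT)[n _ /(_ n (leqnn n))] /=.
  rewrite sub0r normrN ger0_norm ?exprn_ge0// => Hn; exists n.
  by rewrite -exprVn mulrC -ltr_pdivlMr.
exists (s n).1.1, (s n).1.2, (s n).2; split; first by rewrite (sP n).1 hn nd.
- exact: (xy n).1.
- exact: (xy n).2.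
- exact: (sP n).2.
Qed.

End Squares.

(** * Goursat's theorem on rectangles *)

Section Goursat.
Variable R : realType.
Variables P Q : R -> R -> R.

(* al + i be is the complex derivative of P + iQ at s + i t. *)
Definition cr_diff (s t : R) := exists al be : R, forall e : R, 0 < e -> exists2 d : R, 0 < d &
  forall s' t', `|s' - s| <= d -> `|t' - t| <= d ->
  `|P s' t' - P s t - (al * (s' - s) - be * (t' - t))| <= e * (`|s' - s| + `|t' - t|) /\
  `|Q s' t' - Q s t - (be * (s' - s) + al * (t' - t))| <= e * (`|s' - s| + `|t' - t|).

Hypothesis Pc : forall t, continuous (P^~ t).
Hypothesis Qc : forall s, continuous (Q s).

(** The real part of the integral of (P + iQ)(ds + i dt) counterclockwise around the rectangle. It
    reads [P] on horizontal and [Q] on vertical sides only, whence the two continuity hypotheses. *)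
Definition circulation (p q a b h : R) : R :=
  itg (P^~ b) a (a + p * h) - itg (P^~ (b + q * h)) a (a + p * h) -
  (itg (Q (a + p * h)) b (b + q * h) - itg (Q a) b (b + q * h)).

Lemma circulation_split (p q a b h : R) : 0 < p -> 0 < q -> 0 < h ->
  let k := h / 2 in
  circulation p q a b h = circulation p q a b k + circulation p q (a + p * k) b k
   + circulation p q a (b + q * k) k + circulation p q (a + p * k) (b + q * k) k.
Proof.
move=> p0 q0 h0 k; have k0 : 0 < k by rewrite divr_gt0.
have pk : 0 < p * k by rewrite mulr_gt0.
have qk : 0 < q * k by rewrite mulr_gt0.
have -> : h = k + k by rewrite /k -splitr.
rewrite /circulation !mulrDr !addrA.
have sP t : itg (P^~ t) a (a + p * k + p * k) =
    itg (P^~ t) a (a + p * k) + itg (P^~ t) (a + p * k) (a + p * k + p * k).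
  by apply: itg_split; [exact: Pc | rewrite lerDl ltW..].
have sQ t : itg (Q t) b (b + q * k + q * k) =
    itg (Q t) b (b + q * k) + itg (Q t) (b + q * k) (b + q * k + q * k).
  by apply: itg_split; [exact: Qc | rewrite lerDl ltW..].
rewrite !sP !sQ; ring.
Qed.

(** The affine approximation of P + iQ at (x, y) has zero circulation: its two contributions be p q
    h^2 cancel. What remains is an error of order e h on sides of order h. *)
Lemma circulation_small (p q x y e : R) :
  0 < p -> 0 < q -> cr_diff x y -> 0 < e -> exists2 d : R, 0 < d &
  forall a b h : R, 0 < h < d -> a <= x <= a + p * h -> b <= y <= b + q * h ->
  `|circulation p q a b h| <= e * h ^+ 2.
Proof.
move=> p0 q0 [al [be H]] e0.
(* The sides together contribute 2 (p + q)^2 h^2 times the error rate e / C, that is e h^2 / 2. *)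
pose C : R := 4 * (p + q) ^+ 2.
have C0 : 0 < C by rewrite mulr_gt0// exprn_gt0 ?addr_gt0.
have [d d0 Hd] := H (e / C) (divr_gt0 e0 C0).
exists (d / (p + q)); first by rewrite divr_gt0 ?addr_gt0.
move=> a b h /andP[h0]; rewrite ltr_pdivlMr ?addr_gt0// => hd.
move=> /andP[xa xb] /andP[ya yb].
have hp : 0 < p * h by rewrite mulr_gt0.
have hq : 0 < q * h by rewrite mulr_gt0.
have hpq : h * (p + q) = p * h + q * h by ring.
have H' s t : a <= s <= a + p * h -> b <= t <= b + q * h ->
   `|P s t - P x y - (al * (s - x) - be * (t - y))| <= e / C * (p * h + q * h) /\
   `|Q s t - Q x y - (be * (s - x) + al * (t - y))| <= e / C * (p * h + q * h).
  move=> /andP[s1 s2] /andP[t1 t2].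
  have sx : `|s - x| <= p * h by rewrite ler_norml; apply/andP; split; lra.
  have ty : `|t - y| <= q * h by rewrite ler_norml; apply/andP; split; lra.
  have [||h1 h2] := Hd s t; [lra..|].
  by split; [apply: le_trans h1 _|apply: le_trans h2 _];
    rewrite ler_wpM2l ?lerD// ltW// divr_gt0.
have HP : `|itg (fun s => P s b - P s (b + q * h)) a (a + p * h) -
     be * (q * h) * (a + p * h - a)| <= 2 * (e / C * (p * h + q * h)) * (a + p * h - a).
  apply: itg_near; last 1 first.
  - move=> s hs.
    have [h1 _] := H' s b hs ltac:(lra).
    have [h2 _] := H' s (b + q * h) hs ltac:(lra).
    move: h1 h2; rewrite !ler_norml => /andP[h1 h2] /andP[h3 h4].
    apply/andP; split; lra.
  - move=> s; apply: continuousB; exact: Pc.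
  - lra.
have HQ : `|itg (fun t => Q (a + p * h) t - Q a t) b (b + q * h) -
     be * (p * h) * (b + q * h - b)| <= 2 * (e / C * (p * h + q * h)) * (b + q * h - b).
  apply: itg_near; last 1 first.
  - move=> t ht.
    have [_ h1] := H' a t ltac:(lra) ht.
    have [_ h2] := H' (a + p * h) t ltac:(lra) ht.
    move: h1 h2; rewrite !ler_norml => /andP[h1 h2] /andP[h3 h4].
    apply/andP; split; lra.
  - move=> s; apply: continuousB; exact: Qc.
  - lra.
move: HP HQ; rewrite !itgB; try exact: Pc; try exact: Qc.
rewrite /circulation.
set A := (itg _ _ _ - _); set B := (itg _ _ _ - itg (Q a) _ _).
have -> : a + p * h - a = p * h by ring.
have -> : b + q * h - b = q * h by ring.
move=> HA HB.
have -> : A - B = (A - be * (q * h) * (p * h)) - (B - be * (p * h) * (q * h)) by ring.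
apply: le_trans (ler_normB _ _) _; apply: le_trans (lerD HA HB) _.
have CE : e / C * (2 * (p + q) ^+ 2) = e / 2.
  by rewrite /C; field; rewrite gt_eqF// addr_gt0.
move: (e / C) CE => K CE.
have -> : 2 * (K * (p * h + q * h)) * (p * h) + 2 * (K * (p * h + q * h)) * (q * h)
  = K * (2 * (p + q) ^+ 2) * h ^+ 2 by ring.
by rewrite CE ler_wpM2r ?sqr_ge0// ler_pdivrMr// ler_peMr ?ltW// ltr1n.
Qed.

(** If every quarter, of scale k = h / 2, had circulation at most eta k^2, the whole would have at
    most eta h^2. So circulations above eta h^2 persist at all scales, against [circulation_small]
    at the limit point. *)
Lemma goursat_rect (p q a b h : R) : 0 < p -> 0 < q -> 0 < h ->
  (forall s t : R, a <= s <= a + p * h -> b <= t <= b + q * h -> cr_diff s t) ->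
  circulation p q a b h = 0.
Proof.
move=> p0 q0 h0 H; apply/eqP/negP => /negP F0.
(* The last division by 2 makes the strict inequality in [Bad] true for the initial rectangle. *)
pose eta : R := `|circulation p q a b h| / h ^+ 2 / 2.
have h20 : 0 < h ^+ 2 by rewrite exprn_gt0.
have eta0 : 0 < eta by rewrite !divr_gt0 ?normr_gt0.
pose Bad (a' b' h' : R) := [/\ a <= a', a' + p * h' <= a + p * h, b <= b',
   b' + q * h' <= b + q * h & `|circulation p q a' b' h'| > eta * h' ^+ 2].
have [||x [y xy]] := @bisect2 _ p q Bad a b h (ltW p0) (ltW q0) h0.
- split=> //; rewrite /eta mulrAC divfK ?gt_eqF//.
  by rewrite ltr_pdivrMr// ltr_pMr ?normr_gt0// ltr1n.
- move=> a1 b1 h1 h10 [B1 B2 B3 B4 B5] k.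
  have k0 : 0 < k by rewrite divr_gt0.
  have e : h1 = k + k by rewrite /k -splitr.
  have pk : 0 < p * k by rewrite mulr_gt0.
  have qk : 0 < q * k by rewrite mulr_gt0.
  have pe : p * h1 = p * k + p * k by rewrite -mulrDr -e.
  have qe : q * h1 = q * k + q * k by rewrite -mulrDr -e.
  have [[L1 L2 L3] [L4 L5 L6]] : [/\ a <= a1 + p * k, a1 + p * k <= a + p * h &
      a1 + p * k + p * k <= a + p * h] /\ [/\ b <= b1 + q * k,
      b1 + q * k <= b + q * h & b1 + q * k + q * k <= b + q * h].
    by clear -B1 B2 B3 B4 pk qk pe qe; split; split; lra.
  have [C1|C1] := ltP (eta * k ^+ 2) `|circulation p q a1 b1 k|.
    exact: Or41.
  have [C2|C2] := ltP (eta * k ^+ 2) `|circulation p q (a1 + p * k) b1 k|.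
    exact: Or42.
  have [C3|C3] := ltP (eta * k ^+ 2) `|circulation p q a1 (b1 + q * k) k|.
    exact: Or43.
  have [C4|C4] := ltP (eta * k ^+ 2) `|circulation p q (a1 + p * k) (b1 + q * k) k|.
    exact: Or44.
  exfalso; move: B5; apply/negP; rewrite -leNgt circulation_split// -/k.
  rewrite (_ : eta * h1 ^+ 2 = eta * k ^+ 2 + eta * k ^+ 2 + eta * k ^+ 2 + eta * k ^+ 2);
    last by rewrite e; ring.
  by do 3!(apply: le_trans (ler_normD _ _) _; apply: lerD => //).
(* Any scale would do here: this only locates (x, y) inside the initial rectangle. *)
have [a1 [b1 [h1 [h10 ha hb [B1 B2 B3 B4 B5]]]]] := xy 1 ltr01.
have [|d d0 Hd] := @circulation_small p q x y eta p0 q0 _ eta0.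
  move: ha hb => /andP[ha1 ha2] /andP[hb1 hb2].
  by apply: H; rewrite ?(le_trans B1)// ?(le_trans B3)// ?(le_trans ha2)// (le_trans hb2).
have {xy}[a2 [b2 [h2 [h20' ha2 hb2 [_ _ _ _ B5']]]]] := xy d d0.
by have := Hd a2 b2 h2 h20' ha2 hb2; rewrite leNgt B5'.
Qed.

End Goursat.

(** * Complex derivatives, circle means and Taylor coefficients *)

Section ComplexBasics.
Variable R : realType.
Local Notation C := R[i].
Implicit Types (z w : C).

Lemma normCabs z : `|z| = (cabs z)%:C.
Proof. exact: normc_def. Qed.

Lemma cabs_ge0 z : 0 <= cabs z.
Proof. exact: sqrtr_ge0. Qed.

Lemma cabsM z w : cabs (z * w) = cabs z * cabs w.
Proof. by apply: (@complexI R); rewrite [RHS]rmorphM -normCabs normrM !normCabs. Qed.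

Lemma ler_cabsD z w : cabs (z + w) <= cabs z + cabs w.
Proof. by rewrite -lecR [leRHS]rmorphD -!normCabs (le_trans (ler_normD _ _))// !normCabs. Qed.

Lemma cabsN z : cabs (- z) = cabs z.
Proof. by apply: (@complexI R); rewrite -!normCabs normrN. Qed.

Lemma ler_cabsB z w : cabs (z - w) <= cabs z + cabs w.
Proof. by rewrite -(cabsN w) ler_cabsD. Qed.

Lemma cabs0 : cabs (0 : C) = 0.
Proof. by apply: (@complexI R); rewrite -normCabs normr0. Qed.

Lemma cabs1 : cabs (1 : C) = 1.
Proof. by apply: (@complexI R); rewrite -normCabs normr1. Qed.

Lemma cabs_eq0 z : (cabs z == 0) = (z == 0).
Proof. by rewrite -(inj_eq (@complexI _)) -normCabs normr_eq0. Qed.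

Lemma cabs_gt0 z : (0 < cabs z) = (z != 0).
Proof. by rewrite lt_neqAle cabs_ge0 andbT eq_sym cabs_eq0. Qed.

Lemma cabsX z n : cabs (z ^+ n) = cabs z ^+ n.
Proof. by elim: n => [|n IH]; rewrite ?expr0 ?cabs1// !exprS cabsM IH. Qed.

Lemma cabsV z : cabs z^-1 = (cabs z)^-1.
Proof.
have [->|z0] := eqVneq z 0; first by rewrite invr0 cabs0 invr0.
apply: (mulfI (x := cabs z)); first by rewrite cabs_eq0.
by rewrite -cabsM !divff ?cabs1// cabs_eq0.
Qed.

Lemma cabs_real (x : R) : cabs x%:C = `|x|.
Proof. by rewrite /cabs /= expr0n addr0 sqrtr_sqr. Qed.

Lemma cabs_imag (x : R) : cabs (0 +i* x) = `|x|.
Proof. by rewrite /cabs /= expr0n add0r sqrtr_sqr. Qed.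

Lemma ler_Re_cabs z : `|complex.Re z| <= cabs z.
Proof. by rewrite /cabs -sqrtr_sqr ler_sqrt ?lerDl ?sqr_ge0// addr_ge0 ?sqr_ge0. Qed.

Lemma ler_Im_cabs z : `|complex.Im z| <= cabs z.
Proof. by rewrite /cabs -sqrtr_sqr ler_sqrt ?lerDr ?sqr_ge0// addr_ge0 ?sqr_ge0. Qed.

Lemma cabs_le_ReIm z : cabs z <= `|complex.Re z| + `|complex.Im z|.
Proof.
rewrite {1}(complexE z) (le_trans (ler_cabsD _ _))// cabsM !cabs_real.
by rewrite cabs_imag normr1 mul1r.
Qed.

Lemma ReD z w : complex.Re (z + w) = complex.Re z + complex.Re w.
Proof. by case: z; case: w. Qed.
Lemma ImD z w : complex.Im (z + w) = complex.Im z + complex.Im w.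
Proof. by case: z; case: w. Qed.
Lemma ReN z : complex.Re (- z) = - complex.Re z.
Proof. by case: z. Qed.
Lemma ImN z : complex.Im (- z) = - complex.Im z.
Proof. by case: z. Qed.
Lemma ReM z w : complex.Re (z * w) =
  complex.Re z * complex.Re w - complex.Im z * complex.Im w.
Proof. by case: z; case: w. Qed.
Lemma ImM z w : complex.Im (z * w) =
  complex.Re z * complex.Im w + complex.Im z * complex.Re w.
Proof. by case: z => a b; case: w => c d /=; rewrite addrC; congr (_ + _); rewrite mulrC. Qed.

Lemma complex_eqP z w : complex.Re z = complex.Re w ->
  complex.Im z = complex.Im w -> z = w.
Proof. by case: z w => a b [c d] /= -> ->. Qed.

Definition ccont (f : C -> C) z := forall e : R, 0 < e -> exists2 d : R, 0 < d &
  forall h, cabs h <= d -> cabs (f (z + h) - f z) <= e.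

(** All bounds are real, through [cabs], and nothing is divided by h, so that h = 0 needs no
    exclusion. *)
Definition cderiv (f : C -> C) z l := forall e : R, 0 < e -> exists2 d : R, 0 < d &
  forall h, cabs h <= d -> cabs (f (z + h) - f z - l * h) <= e * cabs h.

Definition cdiff (f : C -> C) z := exists l, cderiv f z l.

Lemma gt0_complex z : 0 < z -> exists2 d : R, 0 < d & z = d%:C.
Proof. by case: z => a b; rewrite ltcE /= => /andP[/eqP-> a0]; exists a. Qed.

Lemma derivable_cderiv (U : normedModType C) (f : U -> C^o) x v :
  derivable f x v -> cderiv (fun t => f (t *: v + x)) 0 ('D_v f x).
Proof.
move=> /cvgrPdist_le H e e0.
have /H : 0 < e%:C :> C by rewrite ltcR.
move=> /nbhs_ballP[d /gt0_complex[d' d0 ->]] Hd.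
exists (d' / 2); first by rewrite divr_gt0.
move=> h hd; rewrite add0r scale0r add0r.
have [->|h0] := eqVneq h 0; first by rewrite scale0r add0r mulr0 subr0 subrr cabs0 mulr0.
have := Hd h; rewrite /ball/= sub0r normrN normCabs ltcR.
have -> : cabs h < d' by rewrite (le_lt_trans hd)// ltr_pdivrMr// ltr_pMr// ltr1n.
move=> /(_ isT h0); rewrite normCabs lecR => He.
rewrite -(ler_pM2l (x := cabs h^-1)) ?cabs_gt0 ?invr_eq0// -cabsM.
rewrite [leRHS](_ : _ = e); last by rewrite mulrCA -cabsM mulVf// cabs1 mulr1.
have E (L A : C) : - (h^-1 * (A - L * h)) = L - h^-1 * A by field.
by rewrite -cabsN E.
Qed.

Lemma cderiv_derivable (f : C^o -> C^o) z l : cderiv f z l -> derivable f z 1.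
Proof.
move=> H; apply/cvg_ex; exists l; apply/cvgrPdist_le => e /gt0_complex[e' e0 ->].
have [d d0 Hd] := H e' e0.
near=> h.
have h0 : h != 0 by near: h; exact: nbhs_dnbhs_neq.
have hd : cabs h <= d.
  rewrite -lecR -normCabs; near: h; apply: dnbhs0_le; by rewrite ltcR.
have := Hd h hd; rewrite normCabs lecR -ler_pdivrMr ?cabs_gt0// -cabsV -cabsM.
have E (L A : C) : - ((A - L * h) * h^-1) = L - h^-1 * A by field.
by rewrite -cabsN E /GRing.scale/= mulr1 [h + z]addrC.
Unshelve. all: by end_near. Qed.

Lemma cdiffP (f : C^o -> C^o) z : cdiff f z <-> derivable f z 1.
Proof.
split=> [[l /cderiv_derivable]//|/derivable_cderiv H].
exists ('D_1 f z) => e /H[d d0 Hd]; exists d => // h /Hd.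
by rewrite !add0r scale0r add0r /GRing.scale/= mulr1 [h + z]addrC.
Qed.

Lemma cderiv_ccont f z l : cderiv f z l -> ccont f z.
Proof.
move=> /(_ 1 ltr01)[d d0 Hd] e e0.
have c0 : 0 < cabs l + 1 by rewrite ltr_wpDl ?cabs_ge0.
exists (Num.min d (e / (cabs l + 1))); first by rewrite lt_min d0 divr_gt0.
move=> h; rewrite le_min => /andP[/Hd h1 h2].
rewrite -(subrK (l * h) (_ - _)) (le_trans (ler_cabsD _ _))//.
by move: h2; rewrite ler_pdivlMr// cabsM; lra.
Qed.

Lemma is_derive_eps (f : R -> R) (x l : R) : is_derive x 1 f l ->
  forall e : R, 0 < e -> exists2 d : R, 0 < d &
  forall h, `|h| <= d -> `|f (x + h) - f x - l * h| <= e * `|h|.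
Proof.
move=> [/cvgrPdist_le df lE] e /df /nbhs_ballP[d /= d0 Hd].
exists (d / 2); first by rewrite divr_gt0.
move=> h hd; have [->|h0] := eqVneq h 0.
  by rewrite addr0 subrr mulr0 subr0 normr0 mulr0.
have := Hd h; rewrite /ball/= sub0r normrN.
have -> : `|h| < d by rewrite (le_lt_trans hd)// ltr_pdivrMr// ltr_pMr// ltr1n.
move=> /(_ isT h0).
have -> : lim (h^-1 *: ((f \o shift x) (h *: 1) - f x) @[h --> 0^'])%classic = l by [].
have -> : h%:A = h :> R by rewrite /GRing.scale/= mulr1.
rewrite -[h^-1 *: _]/(h^-1 * _) => H.
have h0' : 0 < `|h| by rewrite normr_gt0.
rewrite -ler_pdivrMr// -normfV -normrM -normrN.
have E (L A : R) : - ((A - L * h) * h^-1) = L - h^-1 * A by field.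
by rewrite E [x + h]addrC.
Qed.

Definition cexp (u : C) : C :=
  (expR (complex.Re u) * cos (complex.Im u)) +i* (expR (complex.Re u) * sin (complex.Im u)).

Lemma cexpD u v : cexp (u + v) = cexp u * cexp v.
Proof.
by apply: complex_eqP; rewrite ?ReM ?ImM /= ?ReD ?ImD expRD ?cosD ?sinD; ring.
Qed.

Lemma cabs_cexp u : cabs (cexp u) = expR (complex.Re u).
Proof.
rewrite /cabs /= !exprMn -mulrDr cos2Dsin2 mulr1 sqrtr_sqr ger0_norm//.
Qed.

Lemma cexp_neq0 u : cexp u != 0.
Proof. by rewrite -cabs_gt0 cabs_cexp expR_gt0. Qed.

Lemma cexp0 : cexp 0 = 1.
Proof. by rewrite /cexp /= expR0 cos0 sin0 mulr1 mulr0. Qed.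

Lemma cexp_2pi u : cexp (u + (0 +i* (2 * pi))) = cexp u.
Proof.
apply: complex_eqP; rewrite /= ReD ImD /= addr0.
  by rewrite mulr_natl cosD2pi.
by rewrite mulr_natl sinD2pi.
Qed.

(** The functional equation reduces the claim to u = 0, where the two parts are estimated from the
    real derivatives of exp, cos and sin. *)
Lemma cderiv_cexp u : cderiv cexp u (cexp u).
Proof.
suff H0 : cderiv cexp 0 1.
  move=> e e0; have E0 : 0 < cabs (cexp u) by rewrite cabs_gt0 cexp_neq0.
  have [d d0 Hd] := H0 (e / cabs (cexp u)) (divr_gt0 e0 E0).
  exists d => // h /Hd; rewrite add0r cexp0 mul1r => H.
  rewrite cexpD -[X in _ - X - _]mulr1 -!mulrBr cabsM -ler_pdivlMl//.
  by rewrite mulrA mulrC [_^-1 * e]mulrC mulrC.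
(* The four error terms below add up to 9 e' |h|; the bound e' <= 1 keeps exp (Re h) below 3. *)
move=> e e0; pose e' : R := Num.min (e / 10) 1.
have e'0 : 0 < e' by rewrite lt_min ltr01 andbT divr_gt0.
have e'1 : e' <= 1 by rewrite ge_min lexx orbT.
have e'e : 10 * e' <= e by rewrite -ler_pdivlMl// mulrC ge_min lexx.
move: e' e'0 e'1 e'e => e' e'0 e'1 e'e.
have [d1 d10 H1] := is_derive_eps (is_derive_expR (0 : R)) e'0.
have [d2 d20 H2] := is_derive_eps (is_derive_cos (0 : R)) e'0.
have [d3 d30 H3] := is_derive_eps (is_derive_sin (0 : R)) e'0.
exists (Num.min (Num.min d1 d2) (Num.min d3 e')).
  by rewrite !lt_min d10 d20 d30.
move=> h; rewrite !le_min => /andP[/andP[h1 h2] /andP[h3 h4]].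
have ha := ler_Re_cabs h; have hb := ler_Im_cabs h.
have hE := cabs_le_ReIm h.
have {H1} := H1 (complex.Re h) (le_trans ha h1).
have {H2} := H2 (complex.Im h) (le_trans hb h2).
have {H3} := H3 (complex.Im h) (le_trans hb h3).
rewrite !add0r cexp0 cos0 sin0 expR0 oppr0 !mul1r mul0r !subr0.
rewrite ?addr0 => HS HC HE; apply: le_trans (cabs_le_ReIm _) _.
rewrite !ReD !ImD !ReN !ImN /= oppr0 addr0.
move: HS HC HE; move: (complex.Re h) (complex.Im h) ha hb => a b ha hb.
move: (sin b) (cos b) (expR a) (cabs h) ha hb h4 => S Co E n ha hb h4 HS HC HE.
have n0 : 0 <= n by rewrite (le_trans _ ha).
have HE' : `|E - 1 - a| <= e' * n by rewrite (le_trans HE)// ler_wpM2l// ltW.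
have HC' : `|Co - 1| <= e' * n by rewrite (le_trans HC)// ler_wpM2l// ltW.
have HS' : `|S - b| <= e' * n by rewrite (le_trans HS)// ler_wpM2l// ltW.
have en1 : e' * n <= n by rewrite ler_piMl.
have E1 : `|E - 1| <= 2 * n.
  rewrite -(subrK a (E - 1)) (le_trans (ler_normD _ _))//; lra.
have E3 : `|E| <= 3.
  rewrite -(subrK 1 E) (le_trans (ler_normD _ _))// normr1; lra.
have -> : E * Co - 1 - a = (E - 1 - a) + E * (Co - 1) by ring.
have -> : E * S - b = E * (S - b) + (E - 1) * b by ring.
have T1 : `|E * (Co - 1)| <= 3 * (e' * n) by rewrite normrM ler_pM.
have T2 : `|E * (S - b)| <= 3 * (e' * n) by rewrite normrM ler_pM.
have T3 : `|(E - 1) * b| <= 2 * n * e'.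
  by rewrite normrM ler_pM// (le_trans hb).
have := ler_normD (E - 1 - a) (E * (Co - 1)).
have := ler_normD (E * (S - b)) ((E - 1) * b).
have : 10 * e' * n <= e * n by rewrite ler_wpM2r.
have : 0 <= e' * n by rewrite mulr_ge0// ltW.
move: T1 T2 T3 HE'; clear; lra.
Qed.

Lemma ccont_comp f g z : ccont g z -> ccont f (g z) -> ccont (f \o g) z.
Proof.
move=> gc fc e /fc[d d0 Hd]; have [d' d'0 Hd'] := gc d d0.
by exists d' => // h /Hd' /Hd /=; rewrite [g z + _]addrC subrK.
Qed.

Lemma ccont_continuous (f : C -> C) (g : R -> C) :
  (forall z, ccont f z) ->
  (forall x h, cabs (g (x + h) - g x) <= `|h|) ->
  continuous (fun x => complex.Re (f (g x))) /\ continuous (fun x => complex.Im (f (g x))).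
Proof.
move=> fc gL; split=> x; apply/cvgrPdist_le => e e0.
  have [d d0 Hd] := fc (g x) e e0; near=> y.
  have yx : `|y - x| <= d by near: y; apply: cvgr_distC_le.
  have := Hd (g y - g x); rewrite (addrC (g x)) subrK.
  have := gL x (y - x); rewrite (addrC x) subrK => /le_trans/(_ yx) h /(_ h).
  by apply: le_trans; rewrite distrC -ReN -ReD ler_Re_cabs.
have [d d0 Hd] := fc (g x) e e0; near=> y.
have yx : `|y - x| <= d by near: y; apply: cvgr_distC_le.
have := Hd (g y - g x); rewrite (addrC (g x)) subrK.
have := gL x (y - x); rewrite (addrC x) subrK => /le_trans/(_ yx) h /(_ h).
by apply: le_trans; rewrite distrC -ImN -ImD ler_Im_cabs.
Unshelve. all: by end_near. Qed.

Lemma cdiff_cr_diff (f : C -> C) (s t : R) : cdiff f (s +i* t) ->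
  cr_diff (fun s t => complex.Re (f (s +i* t))) (fun s t => complex.Im (f (s +i* t))) s t.
Proof.
move=> [[al be] H]; exists al, be => e e0; have [d d0 Hd] := H e e0.
exists (d / 2); first by rewrite divr_gt0.
move=> s' t' hs ht.
pose h : C := (s' - s) +i* (t' - t).
have hE : cabs h <= `|s' - s| + `|t' - t| by exact: cabs_le_ReIm.
have hd : cabs h <= d by rewrite (le_trans hE)// (le_trans (lerD hs ht))// -splitr.
have := Hd h hd.
have -> : s +i* t + h = s' +i* t' by apply: complex_eqP => /=; ring.
move=> /le_trans/(_ (ler_wpM2l (ltW e0) hE)) Hh.
split; [have := le_trans (ler_Re_cabs _) Hh|have := le_trans (ler_Im_cabs _) Hh].
  by rewrite !ReD !ReN ReM.
by rewrite !ImD !ImN ImM /= [be * _ + _]addrC.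
Qed.

(** For f of the form g o [cexp] this is 2 pi times the mean of g over the circle of radius e^s. The
    exponential turns annuli into rectangles, where Goursat's theorem applies. *)
Definition cmean (f : C -> C) (s : R) : C :=
  itg (fun t => complex.Re (f (s +i* t))) 0 (2 * pi) +i*
  itg (fun t => complex.Im (f (s +i* t))) 0 (2 * pi).

Lemma ccont_Rec f : (forall z, ccont f z) ->
  (forall s, continuous (fun t => complex.Re (f (s +i* t)))) /\
  (forall t, continuous (fun s => complex.Re (f (s +i* t)))).
Proof.
move=> fc; split=> s; apply: (ccont_continuous (g := fun t => _) fc _).1 => x h.
  by rewrite (_ : _ - _ = 0 +i* h) ?cabs_imag//; apply: complex_eqP => /=; ring.
by rewrite (_ : _ - _ = h%:C) ?cabs_real//; apply: complex_eqP => /=; ring.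
Qed.

Lemma ccont_Imc f : (forall z, ccont f z) ->
  (forall s, continuous (fun t => complex.Im (f (s +i* t)))) /\
  (forall t, continuous (fun s => complex.Im (f (s +i* t)))).
Proof.
move=> fc; split=> s; apply: (ccont_continuous (g := fun t => _) fc _).2 => x h.
  by rewrite (_ : _ - _ = 0 +i* h) ?cabs_imag//; apply: complex_eqP => /=; ring.
by rewrite (_ : _ - _ = h%:C) ?cabs_real//; apply: complex_eqP => /=; ring.
Qed.

Lemma cderivZ k f z l : cderiv f z l -> cderiv (fun u => k * f u) z (k * l).
Proof.
move=> H e e0; have c0 : 0 < cabs k + 1 by rewrite ltr_wpDl ?cabs_ge0.
have [d d0 Hd] := H (e / (cabs k + 1)) (divr_gt0 e0 c0).
exists d => // h /Hd Hh; rewrite -mulrA -!mulrBr cabsM.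
apply: (@le_trans _ _ ((cabs k + 1) * cabs (f (z + h) - f z - l * h))).
  by rewrite ler_wpM2r ?cabs_ge0// lerDl.
by rewrite -ler_pdivlMl// mulrA [_^-1 * e]mulrC.
Qed.

(** Goursat on [s0, s1] x [0, 2 pi]: the horizontal sides cancel by periodicity, and the vertical
    ones carry the imaginary part. *)
Lemma cmean_Im_const f (s0 s1 : R) : (forall z, ccont f z) -> s0 < s1 ->
  (forall s t : R, s0 <= s <= s1 -> cdiff f (s +i* t)) ->
  (forall u, f (u + (0 +i* (2 * pi))) = f u) ->
  itg (fun t => complex.Im (f (s0 +i* t))) 0 (2 * pi) =
  itg (fun t => complex.Im (f (s1 +i* t))) 0 (2 * pi).
Proof.
move=> fc s01 fd fp.
have ds : 0 < s1 - s0 by rewrite subr_gt0.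
have p2 : 0 < 2 * pi :> R by rewrite mulr_gt0// pi_gt0.
have := @goursat_rect R (fun s t => complex.Re (f (s +i* t)))
  (fun s t => complex.Im (f (s +i* t))) (ccont_Rec fc).2 (ccont_Imc fc).1
  (s1 - s0) (2 * pi) s0 0 1 ds p2 ltr01.
rewrite !mulr1 addrC subrK add0r => /(_ _) H.
have {}H := H (fun s t hs _ => cdiff_cr_diff (fd s t hs)).
move: H; rewrite /circulation !mulr1 add0r [s0 + _]addrC subrK.
rewrite [X in X - _ - _](_ : _ = itg (fun s => complex.Re (f (s +i* (2 * pi)))) s0 s1).
  by rewrite subrr add0r => /eqP; rewrite oppr_eq0 subr_eq0 => /eqP ->.
congr itg; apply/funext => s; rewrite -[in LHS]fp; congr (complex.Re (f _)).
by apply: complex_eqP => /=; rewrite ?addr0 ?add0r.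
Qed.

Lemma cmean_const f (s0 s1 : R) : (forall z, ccont f z) -> s0 < s1 ->
  (forall s t : R, s0 <= s <= s1 -> cdiff f (s +i* t)) ->
  (forall u, f (u + (0 +i* (2 * pi))) = f u) -> cmean f s0 = cmean f s1.
Proof.
move=> fc s01 fd fp; apply: complex_eqP; last exact: cmean_Im_const.
(* The real part of f is the imaginary part of i f. *)
rewrite /=; have := @cmean_Im_const (fun u => (0 +i* 1) * f u) s0 s1 _ s01 _ _.
have E z : complex.Im ((0 +i* 1) * z) = complex.Re z.
  by rewrite ImM /= mul0r mul1r add0r.
have EF s : (fun t : R => complex.Im ((0 +i* 1) * f (s +i* t))) =
   (fun t => complex.Re (f (s +i* t))) by apply/funext => t; rewrite E.
rewrite !EF; apply.
- move=> z e e0; have [d d0 Hd] := fc z e e0; exists d => // h /Hd.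
  by rewrite -mulrBr cabsM cabs_imag normr1 mul1r.
- by move=> s t /fd-/(_ t) [l /cderivZ H]; exists ((0 +i* 1) * l); exact: H.
- by move=> u; rewrite fp.
Qed.

(* The factor 2 comes from bounding the real and the imaginary part separately. *)
Lemma cmean_le f s (M : R) : (forall z, ccont f z) ->
  (forall t : R, cabs (f (s +i* t)) <= M) -> cabs (cmean f s) <= 2 * M * (2 * pi).
Proof.
move=> fc H; rewrite (le_trans (cabs_le_ReIm _))//=.
have p2 : 0 <= 2 * pi :> R by rewrite mulr_ge0// pi_ge0.
have := @itg_bound _ _ 0 (2 * pi) M ((ccont_Rec fc).1 s) p2
   (fun t _ => le_trans (ler_Re_cabs _) (H t)).
have := @itg_bound _ _ 0 (2 * pi) M ((ccont_Imc fc).1 s) p2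
   (fun t _ => le_trans (ler_Im_cabs _) (H t)).
rewrite subr0; lra.
Qed.

Lemma cmeanB f g s : (forall z, ccont f z) -> (forall z, ccont g z) ->
  cmean (fun u => f u - g u) s = cmean f s - cmean g s.
Proof.
move=> fc gc; apply: complex_eqP; rewrite ?ReD ?ImD ?ReN ?ImN /=.
  rewrite -itgB; [|exact: (ccont_Rec fc).1|exact: (ccont_Rec gc).1].
  by congr itg; apply/funext => t; rewrite ReD ReN.
rewrite -itgB; [|exact: (ccont_Imc fc).1|exact: (ccont_Imc gc).1].
by congr itg; apply/funext => t; rewrite ImD ImN.
Qed.

Lemma cmeanZ k f s : (forall z, ccont f z) ->
  cmean (fun u => k * f u) s = k * cmean f s.
Proof.
move=> fc; have cR := (ccont_Rec fc).1 s; have cI := (ccont_Imc fc).1 s.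
have cZ (c : R) (u : R -> R) : continuous u -> continuous (fun x => c * u x).
  by move=> uc x; apply: continuousM; [exact: cst_continuous|exact: uc].
apply: complex_eqP; rewrite ?ReM ?ImM /=.
  rewrite -!itgZ// -itgB; [|exact: cZ..].
  by congr itg; apply/funext => t; rewrite ReM.
rewrite -!itgZ// -itgD; [|exact: cZ..].
by congr itg; apply/funext => t; rewrite ImM.
Qed.

Lemma cmean_cst k s : cmean (fun=> k) s = k * (2 * pi)%:C.
Proof.
have p2 : 0 <= 2 * pi :> R by rewrite mulr_ge0// pi_ge0.
by apply: complex_eqP; rewrite ?ReM ?ImM /= itg_cst// subr0; ring.
Qed.

Lemma eq_cmean f g s : (forall t : R, f (s +i* t) = g (s +i* t)) -> cmean f s = cmean g s.
Proof. by move=> fg; apply: complex_eqP => /=; congr itg; apply/funext => t; rewrite fg. Qed.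

(** Compactness of [0, 2 pi] makes f uniformly close to its values on the line Re u = s0. *)
Lemma cmean_cont f (s0 : R) : (forall z, ccont f z) -> forall e : R, 0 < e ->
  exists2 d : R, 0 < d & forall s, `|s - s0| <= d -> cabs (cmean f s - cmean f s0) <= e.
Proof.
move=> fc e e0.
have p2 : 0 < 2 * pi :> R by rewrite mulr_gt0// pi_gt0.
pose e' : R := e / (2 * (2 * pi)).
have e'0 : 0 < e' by rewrite divr_gt0// mulr_gt0.
have := @segment_compact R 0 (2 * pi).
move=> /compact_near_coveringP/(_ R (nbhs s0)
  (fun s t => cabs (f (s +i* t) - f (s0 +i* t)) <= e')) [].
  move=> t _; have [d d0 Hd] := fc (s0 +i* t) (e' / 2) ltac:(by rewrite divr_gt0).
  have H x y : `|x - s0| <= d / 2 -> `|y - t| <= d / 2 ->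
      cabs (f (x +i* y) - f (s0 +i* t)) <= e' / 2.
    move=> hx hy; have := Hd ((x - s0) +i* (y - t)).
    rewrite (le_trans (cabs_le_ReIm _))/=; last by rewrite (splitr d) lerD.
    move=> /(_ isT); congr (cabs (f _ - _) <= _).
    by apply: complex_eqP => /=; ring.
  near=> y x.
  have hx : `|x - s0| <= d / 2.
    by near: x; apply: cvgr_distC_le => //; rewrite divr_gt0.
  have hy : `|y - t| <= d / 2.
    by near: y; apply: cvgr_distC_le => //; rewrite divr_gt0.
  rewrite -(subrK (f (s0 +i* t)) (f (x +i* y))) -addrA (le_trans (ler_cabsD _ _))//.
  rewrite (splitr e') lerD ?H//.
  by rewrite -opprB cabsN H// subrr normr0 divr_ge0// ltW.
move=> r r0 Hr; exists (r / 2); first by rewrite divr_gt0.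
move=> s sr.
have {}Hr t : 0 <= t <= 2 * pi -> cabs (f (s +i* t) - f (s0 +i* t)) <= e'.
  move=> ht; apply: Hr; rewrite /= ?in_itv//= distrC (le_lt_trans sr)//.
  by rewrite ltr_pdivrMr// ltr_pMr// ltr1n.
rewrite (le_trans (cabs_le_ReIm _))// ReD ImD ReN ImN /=.
have cR := (ccont_Rec fc).1; have cI := (ccont_Imc fc).1.
have cB (u v : R -> R) : continuous u -> continuous v -> continuous (fun x => u x - v x).
  by move=> uc vc x; apply: continuousB; [exact: uc|exact: vc].
rewrite -!itgB//.
have -> : e = e' * (2 * pi - 0) + e' * (2 * pi - 0).
  by rewrite subr0 /e'; move: (2 * pi) p2 => P P0; field; rewrite gt_eqF.
apply: lerD; (apply: itg_bound; [exact: cB|exact: ltW|]) => t /Hr;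
  apply: le_trans; rewrite -?ReN -?ImN -?ReD -?ImD; [exact: ler_Re_cabs|exact: ler_Im_cabs].
Unshelve. all: by end_near. Qed.

Lemma cabs_le_all z : (forall e : R, 0 < e -> cabs z <= e) -> z = 0.
Proof.
move=> H; apply/eqP; rewrite -cabs_eq0; apply/negP => /negP n0.
have c0 : 0 < cabs z by rewrite lt_neqAle cabs_ge0 eq_sym n0.
have := H (cabs z / 2) ltac:(by rewrite divr_gt0); rewrite leNgt ltr_pdivrMr//.
by rewrite ltr_pMr// ltr1n.
Qed.

(** Differentiability may fail on the line Re u = s0. On either side of it the mean is constant, and
    its continuity in s joins the two sides. *)
Lemma cmean_const_exc f (s0 : R) : (forall z, ccont f z) ->
  (forall s t : R, s != s0 -> cdiff f (s +i* t)) ->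
  (forall u, f (u + (0 +i* (2 * pi))) = f u) -> forall s, cmean f s = cmean f s0.
Proof.
move=> fc fd fp s; apply/eqP; rewrite -subr_eq0; apply/eqP/cabs_le_all => e e0.
have [->|ss0] := eqVneq s s0; first by rewrite subrr cabs0 ltW.
have [d d0 Hd] := cmean_cont s0 fc e0.
have [lt|gt|/eqP] := ltgtP s s0; last by rewrite (negPf ss0).
  pose s1 := Num.max s (s0 - d).
  have s1s0 : s1 < s0 by rewrite gt_max lt ltrBlDr ltrDl.
  have -> : cmean f s = cmean f s1.
    have [->//|s1s] := eqVneq s1 s; apply: cmean_const => //.
      by rewrite lt_neqAle eq_sym s1s le_max lexx.
    by move=> x t /andP[_ hx]; apply: fd; rewrite lt_eqF// (le_lt_trans hx).
  apply: Hd; rewrite ltr0_norm ?subr_lt0// opprB lerBlDl -lerBlDr.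
  by rewrite le_max lexx orbT.
pose s1 := Num.min s (s0 + d).
have s1s0 : s0 < s1 by rewrite lt_min gt ltrDl.
have -> : cmean f s = cmean f s1.
  have [->//|s1s] := eqVneq s1 s; apply/esym/cmean_const => //.
    by rewrite lt_neqAle s1s ge_min lexx.
  by move=> x t /andP[hx _]; apply: fd; rewrite gt_eqF// (lt_le_trans _ hx).
apply: Hd; rewrite gtr0_norm ?subr_gt0// lerBlDl.
by rewrite ge_min lexx orbT.
Qed.

Lemma cderiv_comp f g z k l : cderiv g z l -> cderiv f (g z) k -> cderiv (f \o g) z (k * l).
Proof.
move=> gd fd e e0.
have c0 : 0 < cabs l + 1 by rewrite ltr_wpDl ?cabs_ge0.
have k0 : 0 < cabs k + 1 by rewrite ltr_wpDl ?cabs_ge0.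
have [d1 d10 H1] := fd (e / 2 / (cabs l + 1)) ltac:(by rewrite !divr_gt0).
have [d2 d20 H2] := gd (Num.min 1 (e / 2 / (cabs k + 1)))
   ltac:(by rewrite lt_min ltr01 !divr_gt0).
exists (Num.min d2 (d1 / (cabs l + 1))); first by rewrite lt_min d20 divr_gt0.
move=> h; rewrite le_min ler_pdivlMr// => /andP[/H2 hg hd].
set eta := g (z + h) - g z in hg.
have hg1 : cabs (eta - l * h) <= cabs h.
  by rewrite (le_trans hg)// ler_piMl ?cabs_ge0// ge_min lexx.
have hg2 : cabs (eta - l * h) <= e / 2 / (cabs k + 1) * cabs h.
  by rewrite (le_trans hg)// ler_wpM2r ?cabs_ge0// ge_min lexx orbT.
have he : cabs eta <= cabs h * (cabs l + 1).
  rewrite -(subrK (l * h) eta) (le_trans (ler_cabsD _ _))// cabsM; lra.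
have := H1 eta (le_trans he hd).
rewrite {1}/eta [g z + _]addrC subrK => Hf /=.
have -> : f (g (z + h)) - f (g z) - k * l * h =
  (f (g (z + h)) - f (g z) - k * eta) + k * (eta - l * h) by ring.
apply: le_trans (ler_cabsD _ _) _; rewrite (splitr e) mulrDl; apply: lerD.
  apply: (le_trans Hf); apply: le_trans (ler_wpM2l _ he) _.
    by rewrite ltW// !divr_gt0.
  by rewrite [cabs h * _]mulrC mulrA divfK// gt_eqF.
rewrite cabsM; apply: (@le_trans _ _ ((cabs k + 1) * (e / 2 / (cabs k + 1) * cabs h))).
  by rewrite ler_pM ?cabs_ge0// lerDl.
by rewrite mulrA [_ * (_ / _)]mulrC divfK// gt_eqF.
Qed.

Lemma cdiff_ccont f z : cdiff f z -> ccont f z.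
Proof. by move=> [l /cderiv_ccont]. Qed.

Lemma cdiff_comp_cexp f u : cdiff f (cexp u) -> cdiff (f \o cexp) u.
Proof. by move=> [k fk]; exists (k * cexp u); exact: cderiv_comp (cderiv_cexp u) fk. Qed.

Lemma cdiffM f g z : cdiff f z -> cdiff g z -> cdiff (fun u => f u * g u) z.
Proof.
have H (f1 g1 : C^o -> C^o) : derivable f1 z 1 -> derivable g1 z 1 ->
  derivable (f1 * g1 : C^o -> C^o) z 1 by move=> fd gd; apply: derivableM fd gd.
move=> /(cdiffP (f : C^o -> C^o)) fd /(cdiffP (g : C^o -> C^o)) gd.
exact: (cdiffP _ _).2 (H _ _ fd gd).
Qed.

Lemma cdiffB f g z : cdiff f z -> cdiff g z -> cdiff (fun u => f u - g u) z.
Proof.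
have H (f1 g1 : C^o -> C^o) : derivable f1 z 1 -> derivable g1 z 1 ->
  derivable (f1 - g1 : C^o -> C^o) z 1 by move=> fd gd; apply: derivableB fd gd.
move=> /(cdiffP (f : C^o -> C^o)) fd /(cdiffP (g : C^o -> C^o)) gd.
exact: (cdiffP _ _).2 (H _ _ fd gd).
Qed.

Lemma cdiffV f z : f z != 0 -> cdiff f z -> cdiff (fun u => (f u)^-1) z.
Proof.
have H (f1 : C^o -> C^o) : f1 z != 0 -> derivable f1 z 1 ->
  derivable ((fun u => (f1 u)^-1) : C^o -> C^o) z 1.
  by move=> f0 fd; apply: (@derivableV C C^o f1 z 1) => //.
move=> f0 /(cdiffP (f : C^o -> C^o)) fd.
exact: (cdiffP _ _).2 (H _ f0 fd).
Qed.

Lemma cdiff_cst k z : cdiff (fun=> k) z.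
Proof.
by exists 0 => e e0; exists 1 => // h _; rewrite subrr mul0r subr0 cabs0 mulr_ge0 ?cabs_ge0// ltW.
Qed.

Lemma cdiff_id z : cdiff id z.
Proof.
exists 1 => e e0; exists 1 => // h _.
by rewrite mul1r [z + h]addrC addrK subrr cabs0 mulr_ge0 ?cabs_ge0// ltW.
Qed.

Lemma cdiffX f n z : cdiff f z -> cdiff (fun u => f u ^+ n) z.
Proof.
move=> fd; elim: n => [|n IH]; first exact: (cdiff_cst 1).
rewrite (_ : (fun u => f u ^+ n.+1) = fun u => f u * f u ^+ n); first exact: cdiffM.
by apply/funext => u; rewrite exprS.
Qed.

Lemma ln_cabs (s t : R) w : cexp (s +i* t) = w -> s = ln (cabs w).
Proof. by move=> <-; rewrite cabs_cexp expRK. Qed.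

(** The mean does not depend on the radius, and over small circles it approaches f 0. Only the
    circle of radius |w| can meet the exceptional point w; this latitude is what a difference
    quotient at w needs. *)
Lemma cmean_value f w : (forall z, ccont f z) -> (forall z, z != w -> cdiff f z) ->
  forall s, cmean (f \o cexp) s = f 0 * (2 * pi)%:C.
Proof.
move=> fc fd s; pose s0 := ln (cabs w).
have cc z : ccont (f \o cexp) z.
  by apply: ccont_comp; [exact: cderiv_ccont (cderiv_cexp z)|exact: fc].
have H x : cmean (f \o cexp) x = cmean (f \o cexp) s0.
  apply: cmean_const_exc => //.
    move=> x' t xs; apply: cdiff_comp_cexp; apply: fd.
    by apply: contra_neq xs => /ln_cabs.
  by move=> u; rewrite /comp cexp_2pi.
apply/eqP; rewrite -subr_eq0; apply/eqP/cabs_le_all => e e0.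
have P0 : 0 < 2 * pi :> R by rewrite mulr_gt0// pi_gt0.
pose e' : R := e / (2 * (2 * pi)).
have e'0 : 0 < e' by rewrite divr_gt0// mulr_gt0.
have [d d0 Hd] := fc 0 e' e'0.
rewrite H -(H (ln d)) -[f 0 * _](cmean_cst _ (ln d)) -cmeanB//; last first.
  by move=> z; exact/cdiff_ccont/cdiff_cst.
rewrite [leRHS](_ : e = 2 * e' * (2 * pi)); last first.
  by rewrite /e'; move: (2 * pi) P0 => P P0; field; rewrite gt_eqF.
apply: cmean_le.
  move=> z e1 /(cc z)[d1 d10 Hd1]; exists d1 => // h /Hd1.
  by rewrite opprB addrA subrK.
move=> t /=; rewrite -[cexp _]add0r; apply: Hd.
by rewrite cabs_cexp /= lnK.
Qed.

(** The integrand of Cauchy's formula with respect to dz / z. Its factor z makes it vanish at 0, so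
    that its circle means vanish by [cmean_value]; at w it is merely continuous. *)
Lemma cdiff_quotient f w : (forall z, cdiff f z) -> exists g : C -> C,
  [/\ forall z, ccont g z, forall z, z != w -> cdiff g z, g 0 = 0 &
      forall z, z != w -> g z = (f z - f w) * z / (z - w)].
Proof.
move=> fd; have [d dw] := fd w.
pose g z := if z == w then d * w else (f z - f w) * z / (z - w).
have gd z : z != w -> cdiff g z.
  move=> zw; have [l] : cdiff (fun z => (f z - f w) * z * (z - w)^-1) z.
    apply: cdiffM; first by apply: cdiffM; [apply: cdiffB => //; exact: cdiff_cst|exact: cdiff_id].
    by apply: (@cdiffV (fun z => z - w)); [rewrite subr_eq0|apply: cdiffB; [exact: cdiff_id|exact: cdiff_cst]].
  move=> H; exists l => e /H[r r0 Hr].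
  have c0 : 0 < cabs (z - w) by rewrite cabs_gt0 subr_eq0.
  exists (Num.min r (cabs (z - w) / 2)); first by rewrite lt_min r0 divr_gt0.
  move=> h; rewrite le_min => /andP[/Hr hr h2].
  rewrite /g (negPf zw) ifN//; apply: contraTneq h2 => zhw.
  have -> : h = - (z - w) by rewrite -zhw; ring.
  by rewrite cabsN -ltNge ltr_pdivrMr// ltr_pMr ?ltr1n.
exists g; split=> //.
- move=> z; have [->|zw] := eqVneq z w; last exact/cdiff_ccont/gd.
  move=> e e0.
  pose K := cabs d + cabs w + 2.
  have K0 : 0 < K by rewrite ltr_wpDl ?addr_ge0 ?cabs_ge0.
  have K1 : 0 < cabs w + 1 by rewrite ltr_wpDl ?cabs_ge0.
  have [r r0 Hr] := dw (e / 2 / (cabs w + 1)) ltac:(by rewrite !divr_gt0).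
  exists (Num.min r (Num.min 1 (e / 2 / K))).
    by rewrite !lt_min r0 ltr01 !divr_gt0.
  move=> h; rewrite !le_min => /andP[/Hr hr /andP[h1 h2]].
  rewrite /g eqxx; have [->|h0] := eqVneq h 0.
    by rewrite addr0 eqxx subrr cabs0 ltW.
  rewrite ifN; last by rewrite -subr_eq0 addrAC subrr add0r.
  set rho := f (w + h) - f w - d * h in hr.
  have -> : (f (w + h) - f w) * (w + h) / (w + h - w) - d * w =
    d * h + rho / h * (w + h).
    by rewrite /rho [w + h - w](_ : _ = h); [field|ring].
  have hc : 0 < cabs h by rewrite cabs_gt0.
  have rh : cabs (rho / h) <= e / 2 / (cabs w + 1).
    by rewrite cabsM cabsV ler_pdivrMr.
  apply: le_trans (ler_cabsD _ _) _; rewrite (splitr e) lerD// cabsM.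
    apply: (@le_trans _ _ (K * (e / 2 / K))); last by rewrite mulrC divfK// gt_eqF.
    rewrite ler_pM ?cabs_ge0// /K -addrA lerDl.
    by rewrite addr_ge0 ?cabs_ge0.
  rewrite -[leRHS](divfK (lt0r_neq0 K1)) ler_pM ?cabs_ge0//.
  by rewrite (le_trans (ler_cabsD _ _))// lerD2l.
- rewrite /g; case: eqP => [<-|]; first by rewrite mulr0.
  by rewrite mulr0 mul0r.
- by move=> z zw; rewrite /g (negPf zw).
Qed.

(** The n-th Taylor coefficient at 0, as a Fourier coefficient on the unit circle; [mcoef_any] moves
    it to any other radius. *)
Definition mcoef (f : C -> C) n : C :=
  ((2 * pi)^-1)%:C * cmean (fun u => f (cexp u) * (cexp u) ^- n) 0.

Lemma mcoef_cdiff f n u : (forall z, cdiff f z) -> cdiff (fun u => f (cexp u) * (cexp u) ^- n) u.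
Proof.
move=> fd; apply: (@cdiff_comp_cexp (fun z => f z * z ^- n)); apply: cdiffM => //.
apply: (@cdiffV (fun z => z ^+ n)); first by rewrite expf_neq0// cexp_neq0.
exact/cdiffX/cdiff_id.
Qed.

Lemma mcoef_any f n s : (forall z, cdiff f z) ->
  mcoef f n = ((2 * pi)^-1)%:C * cmean (fun u => f (cexp u) * (cexp u) ^- n) s.
Proof.
move=> fd; have cd := mcoef_cdiff n ^~ fd.
pose F u := f (cexp u) * (cexp u) ^- n.
have Fc z : ccont F z by exact/cdiff_ccont/cd.
have Fp u : F (u + (0 +i* (2 * pi))) = F u by rewrite /F cexp_2pi.
by rewrite /mcoef -(@cmean_const_exc F 0 Fc (fun s t _ => cd (s +i* t)) Fp s).
Qed.

Lemma pi2_gt0 : 0 < 2 * pi :> R. Proof. by rewrite mulr_gt0// pi_gt0. Qed.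

Lemma mcoef_le f n (r M : R) : (forall z, cdiff f z) -> 0 < r ->
  (forall z, cabs z = r -> cabs (f z) <= M) -> cabs (mcoef f n) <= 2 * M / r ^+ n.
Proof.
move=> fd r0 H; rewrite (mcoef_any _ (ln r))// cabsM cabs_real.
have P0 := pi2_gt0; have Pi : 0 <= (2 * pi)^-1 :> R by rewrite invr_ge0 ltW.
rewrite ger0_norm// ler_pdivrMl// mulrC -[2 * M / _]mulrA.
apply: cmean_le; first by move=> z; exact/cdiff_ccont/mcoef_cdiff.
move=> t; have E : cabs (cexp (ln r +i* t)) = r by rewrite cabs_cexp /= lnK.
by rewrite cabsM cabsV cabsX E ler_wpM2r ?invr_ge0 ?exprn_ge0 ?(ltW r0)// H.
Qed.

Lemma mcoefB f g n : (forall z, cdiff f z) -> (forall z, cdiff g z) ->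
  mcoef (fun z => f z - g z) n = mcoef f n - mcoef g n.
Proof.
move=> fd gd; rewrite /mcoef -mulrBr -cmeanB; last 2 first.
- by move=> z; exact/cdiff_ccont/mcoef_cdiff.
- by move=> z; exact/cdiff_ccont/mcoef_cdiff.
by congr (_ * _); apply: eq_cmean => t; rewrite mulrBl.
Qed.

Lemma mcoefZ k f n : (forall z, cdiff f z) ->
  mcoef (fun z => k * f z) n = k * mcoef f n.
Proof.
move=> fd; rewrite /mcoef [RHS]mulrCA; congr (_ * _).
rewrite -cmeanZ; last by move=> z; exact/cdiff_ccont/mcoef_cdiff.
by apply: eq_cmean => t; rewrite mulrA.
Qed.

(** For n > 0 this is Cauchy's estimate over ever larger circles. *)
Lemma mcoef_cst k n : mcoef (fun=> k) n = k * (n == 0)%:R.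
Proof.
case: n => [|n].
  rewrite mulr1 /mcoef (@eq_cmean _ (fun=> k)); last by move=> t; rewrite expr0 invr1 mulr1.
  rewrite cmean_cst mulrCA -rmorphM mulVf ?mulr1//.
  by rewrite gt_eqF// pi2_gt0.
rewrite mulr0; apply: cabs_le_all => e e0.
have kd z : cdiff (fun=> k) z by exact: cdiff_cst.
pose r : R := 2 * cabs k / e + 1.
have r1 : 1 <= r by rewrite lerDr divr_ge0 ?mulr_ge0 ?cabs_ge0// ltW.
have r0 : 0 < r by rewrite (lt_le_trans ltr01).
apply: le_trans (mcoef_le n.+1 kd r0 (fun z _ => lexx (cabs k))) _.
rewrite ler_pdivrMr ?exprn_gt0// (@le_trans _ _ (e * r))//.
  by rewrite -ler_pdivrMl// mulrC /r lerDl.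
by rewrite ler_wpM2l ?(ltW e0)// exprS ler_peMr ?(ltW r0)// exprn_ege1.
Qed.

Lemma geom_kernel (z w : C) N : z != 0 -> z != w ->
  z / (z - w) = \sum_(n < N) w ^+ n * z ^- n + (w / z) ^+ N * (z / (z - w)).
Proof.
move=> z0 zw; have zw' : z - w != 0 by rewrite subr_eq0.
elim: N => [|N IH]; first by rewrite big_ord0 add0r expr0 mul1r.
rewrite big_ord_recr /= {1}IH -addrA; congr (_ + _).
rewrite exprS -exprVn -exprMn -[w / z * _]mulrC -mulrA.
have E : z / (z - w) = 1 + w / z * (z / (z - w)) by field; rewrite zw' z0.
by rewrite {1}E mulrDr mulr1.
Qed.

Lemma cmean_sum (F : nat -> C -> C) N s : (forall n z, ccont (F n) z) ->
  (forall z, ccont (fun u => \sum_(n < N) F n u) z) /\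
  cmean (fun u => \sum_(n < N) F n u) s = \sum_(n < N) cmean (F n) s.
Proof.
move=> Fc; elim: N => [|N [IH1 IH2]].
  have -> : (fun u => \sum_(n < 0) F n u) = fun=> 0 by apply/funext => u; rewrite big_ord0.
  by split=> [z|]; [exact/cdiff_ccont/cdiff_cst|rewrite big_ord0 cmean_cst mul0r].
have FE : (fun u => \sum_(n < N.+1) F n u) =
  fun u => \sum_(n < N) F n u - (-1) * F N u.
  by apply/funext => u; rewrite big_ord_recr /= mulN1r opprK.
have cN z : ccont (fun u => -1 * F N u) z.
  move=> e /(Fc N z)[d d0 Hd]; exists d => // h /Hd.
  by rewrite -mulrBr cabsM cabsN cabs1 mul1r.
split=> [z|]; last first.
  rewrite FE cmeanB// cmeanZ// IH2 mulN1r opprK big_ord_recr//.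
rewrite FE => e e0.
have [d1 d10 H1] := IH1 z (e / 2) ltac:(by rewrite divr_gt0).
have [d2 d20 H2] := cN z (e / 2) ltac:(by rewrite divr_gt0).
exists (Num.min d1 d2); first by rewrite lt_min d10.
move=> h; rewrite le_min => /andP[/H1 h1 /H2 h2].
have E (a b c d : C) : a - b - (c - d) = (a - c) - (b - d) by ring.
by rewrite E (le_trans (ler_cabsB _ _))// (splitr e) lerD.
Qed.

(** The mean of (f z - f w) z / (z - w) over |z| = r vanishes; expand z / (z - w) geometrically in
    it. The term n = 0 supplies f w, so the empty sum N = 0 is treated apart. The constant 4 M is |f
    z - f w| <= 2 M, doubled by [cmean_le]. *)
Lemma taylor_rem f (r M : R) w N : (forall z, cdiff f z) -> 0 < r ->
  (forall z, cabs z <= r -> cabs (f z) <= M) -> cabs w < r ->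
  cabs (f w - \sum_(n < N) mcoef f n * w ^+ n) <=
    4 * M * (cabs w / r) ^+ N * (r / (r - cabs w)) + 2 * M * (N == 0%N)%:R.
Proof.
move=> fd r0 fM wr.
have M0 : 0 <= M by apply: le_trans (fM 0 _); rewrite ?cabs_ge0// cabs0 ltW.
case: N => [|N].
  rewrite big_ord0 subr0 expr0 mulr1 /= mulr1 (le_trans (fM _ (ltW wr)))//.
  have : 0 <= r / (r - cabs w) by rewrite divr_ge0 ?subr_ge0 ?(ltW r0) ?(ltW wr).
  move: (r / _) => q q0; have := mulr_ge0 M0 q0; clear -M0; lra.
rewrite mulr0 addr0.
have [g [gc gd g0 gE]] := cdiff_quotient w fd.
pose F n u := w ^+ n * ((f (cexp u) - f w) * (cexp u) ^- n).
have fwd z : cdiff (fun z => f z - f w) z by apply: cdiffB => //; exact: cdiff_cst.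
have Fd n z : cdiff (F n) z.
  apply: cdiffM; [exact: cdiff_cst|exact: (mcoef_cdiff n z fwd)].
pose s := ln r.
have [Sc SE] := cmean_sum N.+1 s (fun n z => cdiff_ccont (Fd n z)).
have gcc z : ccont (g \o cexp) z.
  by apply: ccont_comp; [exact: cderiv_ccont (cderiv_cexp z)|exact: gc].
have P0 := pi2_gt0.
have mF n : cmean (F n) s = (2 * pi)%:C * (w ^+ n * (mcoef f n - f w * (n == 0%N)%:R)).
  rewrite -mcoef_cst -mcoefB//; last by move=> z; exact: cdiff_cst.
  rewrite (mcoef_any _ s)// /F cmeanZ; last first.
    by move=> z; exact: cdiff_ccont (mcoef_cdiff n z fwd).
  rewrite [w ^+ n * _ in RHS]mulrCA [RHS]mulrA -rmorphM divff ?mul1r//.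
  by rewrite gt_eqF.
have Sum : \sum_(n < N.+1) cmean (F n) s =
    (2 * pi)%:C * (\sum_(n < N.+1) mcoef f n * w ^+ n - f w).
  under eq_bigr do rewrite mF.
  rewrite -mulr_sumr; congr (_ * _).
  under eq_bigr do rewrite mulrBr.
  rewrite sumrB; congr (_ - _).
    by apply: eq_bigr => n _; rewrite mulrC.
  rewrite big_ord_recl /= expr0 mul1r mulr1 big1 ?addr0// => i _.
  by rewrite mulr0 mulr0.
have := @cmean_le (fun u => (g \o cexp) u - \sum_(n < N.+1) F n u) s
   (2 * M * (cabs w / r) ^+ N.+1 * (r / (r - cabs w))).
rewrite cmeanB// (cmean_value gc gd) g0 mul0r sub0r SE Sum cabsN cabsM cabs_real.
rewrite ger0_norm ?(ltW P0)// => H; rewrite -cabsN opprB -(ler_pM2l P0).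
rewrite [leRHS](_ : _ = 2 * (2 * M * (cabs w / r) ^+ N.+1 * (r / (r - cabs w))) * (2 * pi));
  last by ring.
apply: H.
  move=> z e e0.
  have [d1 d10 H1] := gcc z (e / 2) ltac:(by rewrite divr_gt0).
  have [d2 d20 H2] := Sc z (e / 2) ltac:(by rewrite divr_gt0).
  exists (Num.min d1 d2); first by rewrite lt_min d10.
  move=> h; rewrite le_min => /andP[/H1 h1 /H2 h2].
  have E (a b c d : C) : a - b - (c - d) = (a - c) - (b - d) by ring.
  by rewrite E (le_trans (ler_cabsB _ _))// (splitr e) lerD.
move=> t; set z := cexp (s +i* t).
have zr : cabs z = r by rewrite cabs_cexp /= /s lnK.
have zw : z != w by apply: contraTneq wr => <-; rewrite zr ltxx.
have z0 : z != 0 by exact: cexp_neq0.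
have -> : (g \o cexp) (s +i* t) - \sum_(n < N.+1) F n (s +i* t) =
    (f z - f w) * ((w / z) ^+ N.+1 * (z / (z - w))).
  rewrite /comp -/z gE// -mulrA [in LHS](geom_kernel N.+1 z0 zw) mulrDr addrAC.
  rewrite mulr_sumr (eq_bigr (fun n : 'I_N.+1 => F n (s +i* t))) ?subrr ?add0r//.
  by move=> n _; rewrite /F -/z mulrCA.
rewrite !cabsM cabsX cabsM !cabsV zr -!mulrA [leRHS]mulrA ler_pM ?cabs_ge0//.
- by rewrite mulr_ge0 ?exprn_ge0 ?mulr_ge0 ?divr_ge0 ?invr_ge0 ?cabs_ge0// ltW.
- rewrite (le_trans (ler_cabsB _ _))//.
  have := fM z; have := fM w; rewrite zr => /(_ (ltW wr)) h1 /(_ (lexx _)) h2; lra.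
rewrite ler_wpM2l ?exprn_ge0 ?divr_ge0 ?cabs_ge0 ?(ltW r0)//.
rewrite ler_wpM2l ?(ltW r0)// lef_pV2 ?posrE ?subr_gt0 ?cabs_gt0 ?subr_eq0//.
by rewrite -zr lerBlDr (le_trans _ (ler_cabsD _ _))// subrK.
Qed.

End ComplexBasics.

(** * Separately entire functions *)

Section Baire.
Variable R : realType.
Local Notation C := R[i].

Lemma baire_disc (P : nat -> C -> Prop) :
  (forall z, exists k, P k z) ->
  (forall k z, ~ P k z -> exists2 d : R, 0 < d & forall h, cabs h <= d -> ~ P k (z + h)) ->
  exists k z0, exists2 r : R, 0 < r & forall h, cabs h <= r -> P k (z0 + h).
Proof.
move=> cov op; apply: contrapT => no.
have {}no k z0 (r : R) : 0 < r -> exists2 h, cabs h <= r & ~ P k (z0 + h).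
  move=> r0; apply: contrapT => H; apply: no; exists k, z0, r => // h hr.
  by apply: contrapT => nP; apply: H; exists h.
pose S n (t' t : R * R * R) := sub_rect 1 1 t' t /\
  forall x y, t'.1.1 <= x <= t'.1.1 + t'.2 -> t'.1.2 <= y <= t'.1.2 + t'.2 ->
  ~ P n (x +i* y).
have [//||s [_ s0 sS]] := @dep_choice _ (fun t : R * R * R => 0 < t.2) S (0, 0, 1).
- move=> n [[a b] h] /= h0.
  (* A failing point within h / 4 of the centre leaves room for a square of side at most h / 4
     around it, inside the current one. *)
  have [[u v] hu] := no n ((a + h / 2) +i* (b + h / 2)) (h / 4) ltac:(by rewrite divr_gt0).
  have := le_trans (ler_Re_cabs _) hu; have := le_trans (ler_Im_cabs _) hu => /=.
  move=> v4 u4 /op[d d0 Hd].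
  pose k : R := Num.min (h / 4) d.
  have k0 : 0 < k by rewrite lt_min d0 divr_gt0.
  have kh : k <= h / 4 by rewrite ge_min lexx.
  have kd : k <= d by rewrite ge_min lexx orbT.
  exists (a + h / 2 + u - k / 2, b + h / 2 + v - k / 2, k) => //; split.
    move: u4 v4; rewrite !ler_norml => /andP[u1 u2] /andP[v1 v2].
    by split=> /=; clear -u1 u2 v1 v2 kh k0 h0; lra.
  move=> x y /= /andP[x1 x2] /andP[y1 y2].
  have := Hd ((x - (a + h / 2 + u)) +i* (y - (b + h / 2 + v))).
  rewrite (_ : _ + _ = x +i* y); last by apply: complex_eqP => /=; ring.
  apply; rewrite (le_trans (cabs_le_ReIm _))//= (le_trans _ kd)//.
  have Hx : `|x - (a + h / 2 + u)| <= k / 2.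
    by rewrite ler_norml; apply/andP; split; clear -x1 x2; lra.
  have Hy : `|y - (b + h / 2 + v)| <= k / 2.
    by rewrite ler_norml; apply/andP; split; clear -y1 y2; lra.
  by rewrite (splitr k) lerD.
have [x [y xy]] := nested_rect ler01 ler01 s0 (fun n => (sS n).1).
have [k Pk] := cov (x +i* y).
(* Square number k + 1 is the one chosen to avoid [P k]. *)
have [h1 h2] := xy k.+1; rewrite !mul1r in h1 h2.
exact: (sS k).2 x y h1 h2 Pk.
Qed.

End Baire.

(** * Well spaced points in a set of large measure *)

Section Nodes.
Variable R : realType.

(** The cells of length d / M that meet E cover it, so their total length exceeds d / 2. *)
Lemma closed_hits (E : set R) (d : R) (M : nat) :
  measurable E -> 0 < d -> (0 < M)%N -> (E `<=` `[0, d])%classic ->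
  (lebesgue_measure E > (d / 2)%:E)%E ->
  exists2 h : seq nat, (forall k, k \in h ->
     exists2 x, E x & k%:R * (d / M%:R) <= x <= k.+1%:R * (d / M%:R)) &
   sorted ltn h /\ (M < 2 * size h)%N.
Proof.
move=> mE d0 M0 Ed muE; pose l : R := d / M%:R.
have MR : 0 < M%:R :> R by rewrite ltr0n.
have l0 : 0 < l by rewrite divr_gt0.
pose P k := `[< exists2 x, E x & k%:R * l <= x <= k.+1%:R * l >].
pose hits := [seq k <- iota 0 M | P k].
exists hits.
  by move=> k; rewrite mem_filter => /andP[/asboolP].
split.
  by apply: sorted_filter; [exact: ltn_trans|exact: iota_ltn_sorted].
pose I k : set R := `[(k%:R * l), (k.+1%:R * l)]%classic.
have sub : (E `<=` \big[setU/set0]_(k < size hits)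
    I (nth 0%N hits k))%classic.
  move=> x Ex; have /= := Ed x Ex; rewrite in_itv/= => /andP[x0 xd].
  rewrite -(bigcup_mkord _ (fun k => I (nth 0%N hits k))).
  (* The minimum with M - 1 puts the right endpoint x = d into the last cell. *)
  pose k := minn (Num.trunc (x / l)) M.-1.
  have xl0 : 0 <= x / l by rewrite divr_ge0// ltW.
  have kM : (k < M)%N by rewrite gtn_min/= ltn_predL M0 orbT.
  have /andP[t1 t2] := truncn_itv xl0.
  have xk : k%:R * l <= x <= k.+1%:R * l.
    rewrite -(ler_pdivlMr _ _ l0) -(ler_pdivrMr _ _ l0); apply/andP; split.
      by rewrite (le_trans _ t1)// ler_nat geq_minl.
    rewrite /k /minn; case: ifPn => _; first exact: ltW.
    by rewrite prednK// ler_pdivrMr// /l mulrC divfK// gt_eqF.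
  have kin : k \in hits.
    by rewrite mem_filter mem_iota /= kM andbT; apply/asboolP; exists x.
  by exists (index k hits); rewrite /= ?index_mem// /I nth_index//= in_itv.
have mI0 k : (k < size hits)%N -> measurable (I (nth 0%N hits k)).
  by move=> _; exact: measurable_itv.
have := lt_le_trans muE (@content_subadditive _ _ _ (@lebesgue_measure R) E
  (fun k => I (nth 0%N hits k)) (size hits)
  mI0 mE sub).
have mI k : lebesgue_measure (I k) = l%:E.
  rewrite /I lebesgue_measure_itv /= lte_fin ltr_pM2r// ltr_nat ltnSn.
  by rewrite -EFinD -mulrBl -natr1 [_ + 1]addrC addrK mul1r.
rewrite (eq_bigr (fun=> l%:E)); last by move=> k _; exact: mI.
rewrite sumEFin lte_fin sumr_const card_ord -[l *+ _]mulr_natr => H.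
rewrite -(ltr_nat R) natrM; set S : R := (size hits)%:R in H *.
have c0 : 0 < 2 * M%:R / d by rewrite divr_gt0// mulr_gt0.
have -> : M%:R = d / 2 * (2 * M%:R / d) :> R by field; rewrite gt_eqF.
have -> : 2 * S = l * S * (2 * M%:R / d) by rewrite /l; field; rewrite !gt_eqF.
by rewrite ltr_pM2r.
Qed.

(** By continuity of the measure some [E n] fills more than half of [0, d]. Of 4 (N + 1) cells it
    then meets more than 2 (N + 1), and every second one of these supplies a node. The same n serves
    all N. *)
Lemma spaced_nodes (E : nat -> set R) (d : R) : 0 < d ->
  (forall n, measurable (E n)) -> (forall n, (E n `<=` E n.+1)%classic) ->
  (forall x, 0 <= x <= d -> exists n, E n x) ->
  exists n, forall N, exists x : nat -> R,
   [/\ forall i, (i <= N)%N -> E n (x i) /\ 0 <= x i <= d,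
    forall i j, (i < j <= N)%N -> (j - i)%:R * (d / (4 * N.+1)%:R) <= x j - x i &
    injective x].
Proof.
move=> d0 mE sE cov.
pose F n : set R := (E n `&` `[0, d])%classic.
have mF n : measurable (F n) by exact: measurableI.
have FU : (\bigcup_n F n)%classic = `[0, d]%classic.
  apply/seteqP; split=> [x [n _ []]//|x /= xd].
  by move: (xd); rewrite in_itv/= => /cov[n En]; exists n.
have ndF : nondecreasing_seq F.
  apply/nondecreasing_seqP => n; apply/subsetPset => x [Ex xd]; split=> //; exact: sE.
have := @nondecreasing_cvg_mu _ _ _ (@lebesgue_measure R) F mF.
rewrite FU => /(_ (measurable_itv _) ndF).
have muI : lebesgue_measure (`[0, d]%classic : set R) = d%:E.
  by rewrite lebesgue_measure_itv /= lte_fin d0 sube0.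
move=> cv; have {}cv : ((lebesgue_measure \o F) x @[x --> \oo] --> d%:E)%classic.
  by rewrite -muI; exact: cv.
have [n Hn] : exists n, (lebesgue_measure (F n) > (d / 2)%:E)%E.
  apply: contrapT => no; have := @cvge_to_le _ _ _ _ _ (d / 2)%:E _ cv.
  rewrite lee_fin leNgt ltr_pdivrMr// ltr_pMr ?ltr1n//; move=> H.
  suff : is_true false by []. apply: H; apply: nearW => n /=.
  by rewrite leNgt; apply/negP => Fn; apply: no; exists n.
exists n => N; pose M := (4 * N.+1)%N; pose l : R := d / M%:R.
have M0 : (0 < M)%N by [].
have l0 : 0 < l by rewrite divr_gt0// ltr0n.
have [h hE [hs hM]] := closed_hits (mF n) d0 M0 (@subIsetr _ _ _) Hn.
have /choice[g Hg] : forall k, exists x, k \in h ->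
    F n x /\ k%:R * l <= x <= k.+1%:R * l.
  move=> k; have [/hE[x Fx kx]|nk] := boolP (k \in h); first by exists x.
  by exists 0.
have hsz i : (i <= N)%N -> (2 * i < size h)%N by move=> iN; rewrite /M in hM; lia.
have hst a b : (a + b < size h)%N -> (nth 0%N h a + b <= nth 0%N h (a + b))%N.
  elim: b => [|b IH]; first by rewrite !addn0.
  rewrite !addnS => ab; rewrite (leq_ltn_trans (IH (ltnW ab)))//.
  by apply: (sorted_ltn_nth ltn_trans 0%N hs); rewrite ?inE// ltnW.
(* Beyond N the values d + i make the sequence injective on all indices, the form in which
   interpolation takes its nodes. *)
pose x i := if (i <= N)%N then g (nth 0%N h (2 * i)) else d + i%:R.
have xP i : (i <= N)%N -> E n (x i) /\ 0 <= x i <= d.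
  move=> iN; rewrite /x iN; have [[Ex]] := Hg _ (mem_nth 0%N (hsz i iN)).
  by rewrite /= in_itv.
have xS i j : (i < j <= N)%N -> (j - i)%:R * l <= x j - x i.
  move=> /andP[ij jN]; have iN : (i <= N)%N by rewrite (leq_trans (ltnW ij)).
  rewrite /x iN jN.
  have [_ /andP[_ xi]] := Hg _ (mem_nth 0%N (hsz i iN)).
  have [_ /andP[xj _]] := Hg _ (mem_nth 0%N (hsz j jN)).
  (* At least 2 (j - i) - 1 >= j - i full cells lie between the two chosen ones. *)
  have := @hst (2 * i)%N (2 * (j - i))%N.
  rewrite -mulnDr subnKC ?(ltnW ij)// => /(_ (hsz j jN)) hij.
  have : ((nth 0%N h (2 * i)).+1 + (j - i))%:R * l <= (nth 0%N h (2 * j))%:R * l.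
    by rewrite ler_pM2r// ler_nat; lia.
  by rewrite natrD mulrDl; clear -xi xj; lra.
have xlt i j : (i < j)%N -> x i < x j.
  move=> ij; have [jN|jN] := leqP j N.
    rewrite -subr_gt0 (lt_le_trans _ (xS i j _)) ?ij//.
    by rewrite mulr_gt0// ltr0n subn_gt0.
  rewrite {2}/x leqNgt jN /=; have [iN|iN] := leqP i N.
    have [_ /andP[_ xd]] := xP i iN; rewrite (le_lt_trans xd)// ltrDl ltr0n.
    exact: leq_trans jN.
  by rewrite /x leqNgt iN /= ltrD2l ltr_nat.
exists x; split=> // i j xij.
by case: (ltngtP i j) => // /xlt; rewrite xij ltxx.
Qed.

(** By induction; the step is (1 + 1/(n+1))^(n+1) <= e. *)
Lemma expn_fact_exp n : n.+1%:R ^+ n <= (n`!)%:R * expR 1 ^+ n :> R.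
Proof.
elim: n => [|n IH]; first by rewrite !expr0 mulr1.
have n1 : 0 < n.+1%:R :> R by rewrite ltr0n.
have step : n.+2%:R ^+ n.+1 <= n.+1%:R ^+ n.+1 * expR 1 :> R.
  rewrite -ler_pdivrMl ?exprn_gt0// -exprVn -exprMn.
  have -> : expR (1 : R) = expR n.+1%:R^-1 ^+ n.+1.
    by rewrite -expRM_natl mulfV ?gt_eqF.
  rewrite lerXn2r ?nnegrE ?mulr_ge0 ?invr_ge0 ?expR_ge0//.
  by rewrite -[n.+2%:R]natr1 mulrDr mulVf ?gt_eqF// mulr1 expR_ge1Dx.
apply: (le_trans step); rewrite exprS factS natrM exprS -!mulrA ler_pM2l//.
by rewrite [expR 1 * _]mulrC mulrA ler_wpM2r// expR_ge0.
Qed.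

(** In units of e, the indices to the left of i contribute i! and those to the right (N - i)!. *)
Lemma prod_dist_ge (F : nat -> R) (e : R) N i : (i <= N)%N -> 0 <= e ->
  (forall j, (j < i)%N -> (i - j)%:R * e <= F j) ->
  (forall j, (i < j <= N)%N -> (j - i)%:R * e <= F j) ->
  e ^+ N * (i`! * (N - i)`!)%:R <= \prod_(j < N.+1 | (j : nat) != i) F j.
Proof.
move=> iN e0 H1 H2.
rewrite -(big_mkord (fun j => j != i) F) (big_cat_nat _ (n := i))//= ?leqW//.
have -> : \prod_(0 <= j < i | j != i) F j = \prod_(j < i) F j.
  rewrite -(big_mkord predT F) big_nat_cond [RHS]big_nat_cond.
  by apply: eq_bigl => j /=; rewrite andbT; case: ltngtP.
have -> : \prod_(i <= j < N.+1 | j != i) F j = \prod_(j < N - i) F (j + i.+1)%N.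
  rewrite big_ltn_cond ?ltnS// eqxx /= -(big_mkord predT (fun j => F (j + i.+1)%N)).
  rewrite -(subSS i N) -(big_addn 0 _ _ predT) add0n.
  rewrite big_nat_cond [RHS]big_nat_cond.
  by apply: eq_bigl => j /=; case: (ltngtP i j); rewrite ?andbT ?andbF.
have E1 : e ^+ i * (i`!)%:R <= \prod_(j < i) F j.
  rewrite fact_prod big_add1 big_mkord natr_prod (reindex_inj rev_ord_inj)/=.
  rewrite -[X in e ^+ X]card_ord -prodr_const -big_split/=.
  apply: ler_prod => j _; rewrite mulr_ge0//= mulrC (le_trans _ (H1 j _))//.
  by rewrite ler_wpM2r// ler_nat subnSK.
have E2 : e ^+ (N - i) * ((N - i)`!)%:R <= \prod_(j < N - i) F (j + i.+1)%N.
  rewrite fact_prod big_add1 big_mkord natr_prod.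
  rewrite -[X in e ^+ X]card_ord -prodr_const -big_split/=.
  apply: ler_prod => j _; rewrite mulr_ge0//= mulrC (le_trans _ (H2 _ _))//.
    by rewrite ler_wpM2r// ler_nat addnS subSn ?leq_addl// addnK.
  by have := ltn_ord j; lia.
rewrite -{1}(subnKC iN) exprD natrM mulrACA.
by apply: ler_pM => //; rewrite mulr_ge0 ?exprn_ge0.
Qed.

End Nodes.

(** * Lagrange interpolation of entire functions *)

Section Lagrange.
Variable R : realType.
Local Notation C := R[i].
Variables (N : nat) (d : R) (x : nat -> R).
Hypotheses (d0 : 0 < d) (xd : forall i, (i <= N)%N -> 0 <= x i <= d)
  (xs : forall i j, (i < j <= N)%N -> (j - i)%:R * (d / (4 * N.+1)%:R) <= x j - x i)
  (xi : injective x).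

Definition lagr (i : 'I_N.+1) (s : C) : C :=
  (tnth (lagrange N.+1 (fun k => (x k)%:C)) i : {poly C}).[s].

Lemma xC_inj : injective (fun k => (x k)%:C).
Proof. by move=> i j /complexI/xi. Qed.

Lemma lagr_interp (p : {poly C}) s : (size p <= N.+1)%N ->
  p.[s] = \sum_(i < N.+1) lagr i s * p.[(x i)%:C].
Proof.
move=> sp; rewrite {1}(lagrange_gen (ltn0Sn N) xC_inj sp) horner_sum.
by apply: eq_bigr => i _; rewrite hornerM hornerC mulrC.
Qed.

(** Each factor of the numerator is at most 2 d, and [prod_dist_ge] with unit e = d / (4 (N + 1))
    bounds the denominator; the ratio 2 d / e is 8 (N + 1). *)
Lemma lagr_le i s : cabs s <= d ->
  cabs (lagr i s) <= (8 * N.+1%:R) ^+ N / (i`! * (N - i)`!)%:R.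
Proof.
move=> sd; rewrite /lagr lagrangeE//; last exact: xC_inj.
pose e : R := d / (4 * N.+1)%:R.
have e0 : 0 < e by rewrite divr_gt0// ltr0n.
have cprod t : cabs (\prod_(j < N.+1 | j != i) ('X - ((x j)%:C)%:P)).[t] =
   \prod_(j < N.+1 | (j : nat) != i) cabs (t - (x j)%:C).
  rewrite horner_prod (big_morph (@cabs R) (@cabsM R) (@cabs1 R)).
  by apply: eq_bigr => j _; rewrite hornerXsubC.
rewrite hornerM hornerC cabsM cabsV !cprod.
have up : \prod_(j < N.+1 | (j : nat) != i) cabs (s - (x j)%:C) <= (2 * d) ^+ N.
  have -> : (2 * d) ^+ N = \prod_(j < N.+1 | (j : nat) != i) (2 * d).
    by rewrite prodr_const; congr (_ ^+ _); rewrite (cardC1 i) card_ord.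
  apply: ler_prod => j _; rewrite cabs_ge0 (le_trans (ler_cabsB _ _))//.
  have /andP[xj0 xjd] := xd (ltn_ord j : (j <= N)%N).
  by rewrite cabs_real ger0_norm// mulr_natl mulr2n lerD.
have lo : e ^+ N * (i`! * (N - i)`!)%:R <=
    \prod_(j < N.+1 | (j : nat) != i) cabs ((x i)%:C - (x j)%:C).
  apply: (@prod_dist_ge _ (fun j => cabs ((x i)%:C - (x j)%:C))).
  - by rewrite -ltnS ltn_ord.
  - exact: ltW.
  - move=> j ji; rewrite -rmorphB cabs_real (le_trans _ (ler_norm _))//.
    by apply: xs; rewrite ji -ltnS ltn_ord.
  - move=> j ji; rewrite -cabsN opprB -rmorphB cabs_real (le_trans _ (ler_norm _))//.
    exact: xs.
have f0 : 0 < (i`! * (N - i)`!)%:R :> R by rewrite ltr0n muln_gt0 !fact_gt0.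
have lo0 : 0 < e ^+ N * (i`! * (N - i)`!)%:R by rewrite mulr_gt0 ?exprn_gt0.
have -> : (8 * N.+1%:R) ^+ N / (i`! * (N - i)`!)%:R =
   (e ^+ N * (i`! * (N - i)`!)%:R)^-1 * (2 * d) ^+ N.
  have -> : 8 * N.+1%:R = (2 * d) / e :> R.
    by rewrite /e natrM; field; rewrite !gt_eqF ?ltr0n.
  by rewrite expr_div_n invfM [RHS]mulrC mulrA.
have p0 t : 0 <= \prod_(j < N.+1 | (j : nat) != i) cabs (t - (x j)%:C).
  by apply: prodr_ge0 => j _; exact: cabs_ge0.
apply: ler_pM => //; first by rewrite invr_ge0.
by rewrite lef_pV2 ?posrE// (lt_le_trans lo0).
Qed.

(** The spacing keeps the Lebesgue constant exponential in N: the numbers 1 / (i! (N - i)!) sum to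
    2^N / N!, and (16 (N + 1))^N / N! is at most (16 e)^N. *)
Lemma lagr_sum_le s : cabs s <= d ->
  \sum_(i < N.+1) cabs (lagr i s) <= (16 * expR 1) ^+ N.
Proof.
move=> sd; apply: (@le_trans _ _ ((8 * N.+1%:R) ^+ N / (N`!)%:R * 2 ^+ N)).
  have -> : 2 ^+ N = \sum_(i < N.+1) ('C(N, i))%:R :> R.
    have := @exprDn R 1 1 N; rewrite -[1 + 1]/(2) => ->.
    by apply: eq_bigr => i _; rewrite !expr1n mulr1.
  rewrite mulr_sumr; apply: ler_sum => i _.
  apply: (le_trans (lagr_le _ sd)); rewrite -mulrA ler_wpM2l//.
  have f0 k : 0 < (k`!)%:R :> R by rewrite ltr0n fact_gt0.
  rewrite -(bin_fact (ltn_ord i : (i <= N)%N)) [in leRHS]natrM [in leRHS]invfM.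
  rewrite [leRHS]mulrAC mulVf ?mul1r// pnatr_eq0 -lt0n bin_gt0.
  by rewrite -ltnS ltn_ord.
have f0 : 0 < (N`!)%:R :> R by rewrite ltr0n fact_gt0.
rewrite mulrAC -exprMn ler_pdivrMr//.
have -> : 8 * N.+1%:R * 2 = 16 * N.+1%:R :> R by ring.
by rewrite !exprMn -mulrA ler_wpM2l ?exprn_ge0// mulrC expn_fact_exp.
Qed.

(** Interpolation reproduces the Taylor polynomial of degree N. With C0 = 16 e, the radius 2 C0 d
    makes the Taylor error on |z| <= d of order (2 C0)^-(N+1), which beats the Lebesgue constant
    C0^N and leaves 2^-N. *)
Lemma interp_error (f : C -> C) (M : R) s : (forall z, cdiff f z) ->
  (forall z, cabs z <= 32 * expR 1 * d -> cabs (f z) <= M) -> cabs s <= d ->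
  cabs (f s - \sum_(i < N.+1) lagr i s * f (x i)%:C) <= M / 2 ^+ N.
Proof.
move=> fd fM sd; pose C0 : R := 16 * expR 1.
have e1 : 1 <= expR 1 :> R by rewrite -expR0 ler_expR.
have C16 : 16 <= C0 by rewrite ler_peMr.
have C00 : 0 < C0 by rewrite (lt_le_trans _ C16).
pose r : R := 2 * C0 * d.
have rE : 32 * expR 1 * d = r by rewrite /r /C0; ring.
rewrite rE in fM.
have r0 : 0 < r by rewrite !mulr_gt0.
have M0 : 0 <= M by apply: le_trans (fM 0 _); rewrite ?cabs_ge0// cabs0 ltW.
have dr : 2 * d <= r by rewrite /r -mulrA ler_pM2l// ler_peMl ?(ltW d0)// (le_trans _ C16)// ler1n.
pose p : {poly C} := \poly_(n < N.+1) mcoef f n.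
have pE z : p.[z] = \sum_(n < N.+1) mcoef f n * z ^+ n by rewrite horner_poly.
have T z : cabs z <= d -> cabs (f z - p.[z]) <= 8 * M / (2 * C0) ^+ N.+1.
  move=> zd; have zr : cabs z < r.
    by rewrite (le_lt_trans zd)// (lt_le_trans _ dr)// mulr_natl mulr2n ltrDl.
  rewrite pE; apply: (le_trans (taylor_rem N.+1 fd r0 fM zr)).
  rewrite mulr0 addr0 -exprVn.
  have h1 : cabs z / r <= (2 * C0)^-1.
    rewrite ler_pdivrMr// /r mulrA [X in X * d]mulVf ?mul1r//.
    by rewrite gt_eqF// mulr_gt0.
  have h2 : r / (r - cabs z) <= 2.
    by rewrite ler_pdivrMr ?subr_gt0//; clear -zd dr; lra.
  rewrite -mulrA; apply: (@le_trans _ _ (4 * M * ((2 * C0)^-1 ^+ N.+1 * 2))).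
    rewrite ler_wpM2l ?mulr_ge0//; apply: ler_pM => //.
    - by rewrite exprn_ge0// divr_ge0 ?cabs_ge0// ltW.
    - by rewrite divr_ge0 ?(ltW r0)// subr_ge0 ltW.
    - have c0 : 0 <= cabs z / r by rewrite divr_ge0 ?cabs_ge0// ltW.
      by rewrite lerXn2r// nnegrE// (le_trans c0).
  by rewrite le_eqVlt; apply/orP; left; apply/eqP; ring.
set A : R := 8 * M / _ in T.
have A0 : 0 <= A.
  by rewrite divr_ge0 ?mulr_ge0// exprn_ge0// mulr_ge0// ltW.
have -> : f s - \sum_(i < N.+1) lagr i s * f (x i)%:C =
   (f s - p.[s]) - \sum_(i < N.+1) lagr i s * (f (x i)%:C - p.[(x i)%:C]).
  rewrite {1}(@lagr_interp p s) ?size_poly//.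
  under [X in _ - X = _]eq_bigr => i _ do rewrite -(subrK p.[(x i)%:C] (f _)) mulrDr.
  by rewrite big_split /=; set X := \sum_(i < _) _; set Y := \sum_(i < _) _; ring.
apply: (le_trans (ler_cabsB _ _)).
have S : cabs (\sum_(i < N.+1) lagr i s * (f (x i)%:C - p.[(x i)%:C])) <= C0 ^+ N * A.
  apply: (@le_trans _ _ (\sum_(i < N.+1) cabs (lagr i s) * A)).
    apply: (@le_trans _ _ (\sum_(i < N.+1) cabs (lagr i s * (f (x i)%:C - p.[(x i)%:C])))).
      apply: (big_ind2 (fun a b => cabs a <= b)) => //; first by rewrite cabs0.
      by move=> a b c e h1 h2; rewrite (le_trans (ler_cabsD _ _))// lerD.
    apply: ler_sum => i _; rewrite cabsM ler_wpM2l ?cabs_ge0//; apply: T.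
    have /andP[x0 xd'] := xd (ltn_ord i : (i <= N)%N).
    by rewrite cabs_real ger0_norm.
  by rewrite -mulr_suml ler_wpM2r// lagr_sum_le.
have c1 : 1 <= C0 ^+ N by rewrite exprn_ege1// (le_trans _ C16)// ler1n.
apply: (@le_trans _ _ (2 * C0 ^+ N * A)).
  have := T s sd; have : A <= C0 ^+ N * A by rewrite ler_peMl.
  by move: S; clear; lra.
have -> : 2 * C0 ^+ N * A = 8 / C0 * (M / 2 ^+ N).
  have E (c : R) : 0 < c ->
      2 * c ^+ N * (8 * M / (2 * c) ^+ N.+1) = 8 / c * (M / 2 ^+ N).
    by move=> c0; rewrite !exprMn !exprS; field; rewrite !expf_neq0 ?gt_eqF.
  exact: E.
rewrite ler_piMl ?divr_ge0 ?exprn_ge0// ler_pdivrMr// mul1r (le_trans _ C16)//.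
by rewrite ler_nat.
Qed.

End Lagrange.

(** * Hartogs' theorem in two variables, with a parameter *)

Section Hartogs.
Variable R : realType.
Local Notation C := R[i].

Lemma cabs_sum_le n (F : nat -> C) (B : nat -> R) :
  (forall i, (i < n)%N -> cabs (F i) <= B i) ->
  cabs (\sum_(i < n) F i) <= \sum_(i < n) B i.
Proof.
move=> H; elim: n H => [|n IH] H; first by rewrite !big_ord0 cabs0.
rewrite !big_ord_recr /= (le_trans (ler_cabsD _ _))// lerD ?H//.
by apply: IH => i ni; apply: H; rewrite ltnS ltnW.
Qed.

Lemma cdiff_lincomb (g : C -> C) n (k : nat -> C) (h : nat -> C -> C) :
  (forall z, cdiff g z) -> (forall i z, cdiff (h i) z) ->
  (forall z, cdiff (fun z => g z - \sum_(i < n) k i * h i z) z) /\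
  forall j, mcoef (fun z => g z - \sum_(i < n) k i * h i z) j =
     mcoef g j - \sum_(i < n) k i * mcoef (h i) j.
Proof.
move=> gd hd; elim: n => [|n [IH1 IH2]].
  have -> : (fun z => g z - \sum_(i < 0) k i * h i z) = g.
    by apply/funext => z; rewrite big_ord0 subr0.
  by split=> // j; rewrite big_ord0 subr0.
have -> : (fun z => g z - \sum_(i < n.+1) k i * h i z) =
    fun z => (g z - \sum_(i < n) k i * h i z) - k n * h n z.
  by apply/funext => z; rewrite big_ord_recr opprD addrA.
have kd z : cdiff (fun z => k n * h n z) z.
  by have [l /cderivZ H] := hd n z; exists (k n * l); exact: H.
split=> [z|j]; first exact: cdiffB.
by rewrite mcoefB// IH2 mcoefZ// big_ord_recr opprD addrA.
Qed.

Lemma cdiff_shift (f : C -> C) z0 z : (forall z, cdiff f z) -> cdiff (fun u => f (z0 + u)) z.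
Proof.
move=> fd; have [l H] := fd (z0 + z); exists l => e /H[d d0 Hd]; exists d => // h /Hd.
by rewrite addrA.
Qed.

(* If f is unbounded on a square, it is so on one of the four quarters; the nested quarters
   shrink to a point at which f is continuous. *)
Lemma entire_bounded (f : C -> C) (r : R) : (forall z, cdiff f z) ->
  exists M : R, forall z, cabs z <= r -> cabs (f z) <= M.
Proof.
move=> fd; apply: contrapT => no.
have {}no (M : R) : exists2 z, cabs z <= r & M < cabs (f z).
  apply: contrapT => H; apply: no; exists M => z zr; rewrite leNgt; apply/negP => Mf.
  by apply: H; exists z.
pose Bad (a b h : R) := forall M : R, exists x y : R,
  [/\ a <= x <= a + 1 * h, b <= y <= b + 1 * h & M < cabs (f (x +i* y))].
have r0 : 0 <= r by have [z zr _] := no 0; rewrite (le_trans _ zr)// cabs_ge0.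
have h0 : 0 < 2 * r + 1 by lra.
have [||x [y xy]] := @bisect2 _ 1 1 Bad (- r) (- r) (2 * r + 1) ler01 ler01 h0.
- move=> M; have [z zr Mz] := no M; exists (complex.Re z), (complex.Im z).
  have := le_trans (ler_Re_cabs z) zr; have := le_trans (ler_Im_cabs z) zr.
  rewrite !ler_norml => /andP[a1 a2] /andP[b1 b2].
  split; last by case: (z) Mz.
    by apply/andP; split; clear -b1 b2; lra.
  by apply/andP; split; clear -a1 a2; lra.
- move=> a b h h1 B k; rewrite !mul1r.
  have kE : h = k + k by rewrite /k -splitr.
  apply: contrapT => N.
  have {N}N : [/\ ~ Bad a b k, ~ Bad (a + k) b k, ~ Bad a (b + k) k &
      ~ Bad (a + k) (b + k) k].
    split=> H; apply: N; [exact: Or41|exact: Or42|exact: Or43|exact: Or44].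
  have nB a' b' : ~ Bad a' b' k -> exists M : R, forall x y, a' <= x <= a' + k ->
      b' <= y <= b' + k -> cabs (f (x +i* y)) <= M.
    move=> nb; apply: contrapT => H; apply: nb => M; apply: contrapT => H'.
    apply: H; exists M => u v hu hv; rewrite leNgt; apply/negP => Hl; apply: H'.
    by exists u, v; rewrite !mul1r.
  case: N => /nB[M1 H1] /nB[M2 H2] /nB[M3 H3] /nB[M4 H4].
  have [u [v [hu hv]]] := B (Num.max (Num.max M1 M2) (Num.max M3 M4)).
  rewrite !gt_max => /andP[/andP[m1 m2] /andP[m3 m4]].
  move: hu hv; rewrite !mul1r kE => /andP[u1 u2] /andP[v1 v2].
  have [ua|ua] := leP u (a + k); have [va|va] := leP v (b + k).
  + by move: m1; rewrite ltNge H1// ?u1 ?v1.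
  + by move: m3; rewrite ltNge H3 ?u1//= (ltW va) -addrA.
  + by move: m2; rewrite ltNge H2 ?v1//= (ltW ua) -addrA.
  + by move: m4; rewrite ltNge H4//= ?(ltW va) ?(ltW ua) -addrA.
have [l Hl] := fd (x +i* y); have [d d0 Hd] := cderiv_ccont Hl ltr01.
have [a [b [h [/andP[h1 h2] /andP[x1 x2] /andP[y1 y2] B]]]] := xy (d / 2) ltac:(by rewrite divr_gt0).
have [u [v [/andP[u1 u2] /andP[v1 v2] Mf]]] := B (cabs (f (x +i* y)) + 1).
have := Hd ((u - x) +i* (v - y)).
rewrite (_ : x +i* y + _ = u +i* v); last by apply: complex_eqP => /=; ring.
have -> : cabs ((u - x) +i* (v - y)) <= d.
  rewrite (le_trans (cabs_le_ReIm _))//=.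
  have a1 : `|u - x| <= h by rewrite ler_norml; apply/andP; split; clear -u1 u2 x1 x2; lra.
  have a2 : `|v - y| <= h by rewrite ler_norml; apply/andP; split; clear -v1 v2 y1 y2; lra.
  by clear -a1 a2 h2; lra.
move=> /(_ isT) H; move: Mf; rewrite ltNge => /negP; apply.
by rewrite -(subrK (f (x +i* y)) (f (u +i* v))) (le_trans (ler_cabsD _ _))// addrC lerD2l.
Qed.

Lemma le_of_geom (x a b : R) : (forall J, x <= a + b / 2 ^+ J) -> x <= a.
Proof.
move=> H; rewrite leNgt; apply/negP => ax.
have b0 : 0 < b.
  have := H 0%N; rewrite expr0 divr1 => h; clear -h ax; lra.
have /cvgrPdist_lt/(_ ((x - a) / b)) := @cvg_expr R 2^-1 ltac:(rewrite ger0_norm; lra).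
rewrite divr_gt0 ?subr_gt0// => /(_ isT)[n _ /(_ n (leqnn n))] /=.
rewrite sub0r normrN ger0_norm ?exprn_ge0//.
rewrite ltr_pdivlMr// => Hn; have := H n; rewrite -exprVn mulrC => h.
by clear -h Hn; lra.
Qed.

(* By Baire, |f| <= k for s in a large disc and z in a small disc of radius r. The j-th Taylor
   coefficient in z is estimated by interpolating in s at L j + 1 nodes x_i for which f(x_i, .)
   is bounded: the error is at most k 2^(- L j) on the small disc, and L is chosen so that this
   yields a bound O(S'^-j), valid on the large disc. *)
Lemma hartogs2 (T : Type) (f : T -> C -> C -> C) :
  (forall t z s, cdiff (fun s => f t s z) s) ->
  (forall t s z, cdiff (f t s) z) ->
  (forall s (r : R), exists M : R, forall t z, cabs z <= r -> cabs (f t s z) <= M) ->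
  (forall z (r : R), exists M : R, forall t s, cabs s <= r -> cabs (f t s z) <= M) ->
  forall r : R, exists M : R, forall t s z,
    cabs s <= r -> cabs z <= r -> cabs (f t s z) <= M.
Proof.
move=> fs fz Hs Hz rho0; pose rho : R := Num.max 1 rho0.
suff [M HM] : exists M : R, forall t s z, cabs s <= rho -> cabs z <= rho -> cabs (f t s z) <= M.
  by exists M => t s z sr zr; apply: HM; rewrite le_max ?sr ?zr orbT.
have rho_gt0 : 0 < rho by rewrite lt_max ltr01.
move: rho rho_gt0 => {rho0} rho rho_gt0.
have [C0 C0E] : exists C0 : R, C0 = 16 * expR 1 by eexists.
have C00 : 0 < C0 by rewrite C0E mulr_gt0// expR_gt0.
(* The radius on which [interp_error] asks for a bound when d = rho. *)
pose Rr : R := 32 * expR 1 * rho.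
have [||k [z0 [r r0 Hk]]] := @baire_disc R
  (fun k z => forall t s, cabs s <= Rr -> cabs (f t s z) <= k%:R).
- move=> z; have [M HM] := Hz z Rr; exists (Num.trunc M).+1 => t s sr.
  by rewrite (le_trans (HM t s sr))// ltW// truncnS_gt.
- move=> k z /existsNP[t /existsNP[s /not_implyP[sr /negP]]].
  rewrite -ltNge => kf; have [l Hl] := fz t s z.
  have [|d d0 Hd] := cderiv_ccont Hl (_ : 0 < (cabs (f t s z) - k%:R) / 2).
    by rewrite divr_gt0// subr_gt0.
  exists d => // h /Hd H /(_ t s sr) H'.
  have := ler_cabsB (f t s (z + h)) (f t s (z + h) - f t s z).
  by rewrite subKr; clear -H H' kf; lra.
(* For |z| <= rho this gives |z - z0| <= S' / 2, so that the series with terms A (|z - z0| / S')^j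
   sums to at most 2 A. *)
have [S' S'E] : exists S' : R, S' = 2 * (rho + cabs z0 + 1) by eexists.
have S'0 : 0 < S' by rewrite S'E mulr_gt0// ltr_wpDl// addr_ge0 ?cabs_ge0// ltW.
have [L HL] : exists L, S' / r <= 2 ^+ L.
  exists (Num.trunc (S' / r)).+1; rewrite (le_trans (ltW (truncnS_gt _)))//.
  by rewrite -natrX ler_nat ltnW// ltn_expl.
(* Then C0^(L j) / S^j = S'^-j: Cauchy's estimate at radius S absorbs the Lebesgue constant of L j +
   1 nodes. *)
pose S : R := C0 ^+ L * S'.
have S0 : 0 < S by rewrite mulr_gt0// exprn_gt0.
pose E n : set R := [set x | forall t z, cabs z <= S -> cabs (f t x%:C (z0 + z)) <= n%:R]%classic.
have [|||n Hn] := @spaced_nodes R E rho rho_gt0.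
- move=> n; rewrite -[E n]setCK; apply: measurableC; apply: measurable_realfun.open_measurable.
  rewrite openE => x /= /existsNP[t /existsNP[z /not_implyP[zS /negP]]].
  rewrite -ltNge => nf; have [l Hl] := fs t (z0 + z) x%:C.
  have [|d d0 Hd] := cderiv_ccont Hl (_ : 0 < (cabs (f t x%:C (z0 + z)) - n%:R) / 2).
    by rewrite divr_gt0// subr_gt0.
  apply/nbhs_ballP; exists d => // y; rewrite /ball/= distrC => /ltW xy /(_ t z zS) H'.
  have := Hd (y - x)%:C; rewrite cabs_real => /(_ xy).
  rewrite -[x%:C + _]rmorphD [x + _]addrC subrK => H.
  have := ler_cabsB (f t y%:C (z0 + z)) (f t y%:C (z0 + z) - f t x%:C (z0 + z)).
  by rewrite subKr; clear -H H' nf; lra.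
- move=> n x /= H t z zS; rewrite (le_trans (H t z zS))// ler_nat//.
- move=> x xr; have [M HM] := Hs x%:C (cabs z0 + S).
  exists (Num.trunc M).+1 => t z zS; rewrite (le_trans (HM t _ _))//.
    by rewrite (le_trans (ler_cabsD _ _))// lerD2l.
  by rewrite ltW// truncnS_gt.
pose b t s j := mcoef (fun z => f t s (z0 + z)) j.
pose A : R := 2 * k%:R + 2 * n%:R.
have bA t s j : cabs s <= rho -> cabs (b t s j) <= A / S' ^+ j.
  move=> sr; have [x [xE xs xi]] := Hn (L * j)%N.
  have xd i : (i <= L * j)%N -> 0 <= x i <= rho by move=> /xE[].
  have [Gd Gc] := @cdiff_lincomb (fun z => f t s (z0 + z)) (L * j).+1
    (fun i => lagr x (inord i : 'I_(L * j).+1) s) (fun i z => f t (x i)%:C (z0 + z))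
    (fun z => cdiff_shift z0 z (fz t s)) (fun i z => cdiff_shift z0 z (fz t (x i)%:C)).
  pose G z := f t s (z0 + z) -
    \sum_(i < (L * j).+1) lagr x (inord i : 'I_(L * j).+1) s * f t (x i)%:C (z0 + z).
  have -> : b t s j = mcoef G j +
      \sum_(i < (L * j).+1) lagr x (inord i : 'I_(L * j).+1) s * b t (x i)%:C j.
    by rewrite /G Gc subrK.
  have GM z : cabs z <= r -> cabs (G z) <= k%:R / 2 ^+ (L * j).
    move=> zr; have := interp_error rho_gt0 xd xs xi (fs t (z0 + z)) _ sr.
    move=> /(_ k%:R (fun u ur => Hk z zr t u ur)).
    by rewrite /G; under [in X in _ -> X]eq_bigr do rewrite inord_val.
  have j0 : 0 < S' ^+ j by rewrite exprn_gt0.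
  apply: (le_trans (ler_cabsD _ _)); rewrite /A mulrDl lerD//.
    have GM' z : cabs z = r -> cabs (G z) <= k%:R / 2 ^+ (L * j).
      by move=> zr; apply: GM; rewrite zr.
    apply: (le_trans (mcoef_le j Gd r0 GM')).
    rewrite -!mulrA ler_pM2l// ler_wpM2l// -invfM lef_pV2 ?posrE ?mulr_gt0 ?exprn_gt0//.
    rewrite exprM -exprMn lerXn2r// ?nnegrE ?mulr_ge0 ?exprn_ge0 ?(ltW S'0) ?(ltW r0)//.
    by rewrite -ler_pdivrMr.
  apply: (@le_trans _ _ (\sum_(i < (L * j).+1)
      cabs (lagr x (inord i : 'I_(L * j).+1) s) * (2 * n%:R / S ^+ j))).
    apply: (@cabs_sum_le _ (fun i => lagr x (inord i : 'I_(L * j).+1) s * b t (x i)%:C j)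
       (fun i => cabs (lagr x (inord i : 'I_(L * j).+1) s) * (2 * n%:R / S ^+ j))).
    move=> i iN; rewrite cabsM ler_wpM2l ?cabs_ge0//.
    apply: mcoef_le => // [z|z zS]; first exact: cdiff_shift.
    by apply: (xE i _).1 => //; rewrite zS.
  rewrite -mulr_suml; under eq_bigr do rewrite inord_val.
  apply: (@le_trans _ _ (C0 ^+ (L * j) * (2 * n%:R / S ^+ j))).
    rewrite ler_wpM2r ?divr_ge0 ?mulr_ge0 ?exprn_ge0 ?(ltW S0)//.
    by rewrite C0E (lagr_sum_le rho_gt0 xd xs xi sr).
  rewrite /S exprMn exprM invfM mulrCA mulVKf//.
  by rewrite !expf_neq0// gt_eqF.
have A0 : 0 <= A by rewrite addr_ge0// mulr_ge0.
exists (2 * A) => t s z sr zr.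
(* This M depends on s and z, but it only multiplies a remainder that vanishes as J grows; the
   surviving bound 2 A is uniform. *)
have [M HM] := Hs s (cabs z0 + 2 * (cabs (z - z0) + 1)).
have M0 : 0 <= M.
  apply: le_trans (HM t 0 _); rewrite ?cabs_ge0// cabs0 addr_ge0 ?cabs_ge0//.
  by rewrite mulr_ge0// addr_ge0// cabs_ge0.
apply: (@le_of_geom _ _ (8 * M + 2 * M)) => J.
set w := z - z0 in HM; pose q : R := 2 * (cabs w + 1).
have w0 := cabs_ge0 w.
have q0 : 0 < q by rewrite mulr_gt0// ltr_wpDl.
have wq : cabs w < q by rewrite /q; clear -w0; lra.
have Tay M' := fun H => @taylor_rem _ (fun z => f t s (z0 + z)) q M' w J
   (fun z => cdiff_shift z0 z (fz t s)) q0 H wq.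
have z0w : z0 + w = z by rewrite /w addrC subrK.
rewrite z0w in Tay.
have {}Tay := Tay M.
have {Tay} T1 : cabs (f t s z - \sum_(j < J) b t s j * w ^+ j) <=
    4 * M * (cabs w / q) ^+ J * (q / (q - cabs w)) + 2 * M * (J == 0%N)%:R.
  by apply: Tay => u uq; apply: HM; rewrite (le_trans (ler_cabsD _ _))// lerD2l.
have T2 : cabs (\sum_(j < J) b t s j * w ^+ j) <= 2 * A.
  have wS : cabs w / S' <= 2^-1.
    rewrite ler_pdivrMr// S'E mulKf// (le_trans (ler_cabsB _ _))//.
    by rewrite -addrA lerD// lerDl.
  apply: (@le_trans _ _ (\sum_(j < J) A * 2^-1 ^+ j)).
    apply: (@cabs_sum_le _ (fun j => b t s j * w ^+ j) (fun j => A * 2^-1 ^+ j)) => j _.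
    rewrite cabsM cabsX; apply: (@le_trans _ _ (A / S' ^+ j * cabs w ^+ j)).
      by rewrite ler_wpM2r ?exprn_ge0// bA.
    rewrite -mulrA ler_wpM2l// mulrC -exprVn -exprMn lerXn2r ?nnegrE//.
    by rewrite divr_ge0// ltW.
  rewrite -mulr_sumr mulrC ler_wpM2r//.
  have : \sum_(j < J) (2^-1 : R) ^+ j = 2 - 2 * 2^-1 ^+ J.
    elim: (J) => [|J' IH]; first by rewrite big_ord0 expr0; ring.
    by rewrite big_ord_recr /= IH exprS; field.
  move=> ->; rewrite lerBlDr lerDl mulr_ge0// exprn_ge0//.
rewrite -(subrK (\sum_(j < J) b t s j * w ^+ j) (f t s z)) (le_trans (ler_cabsD _ _))//.
rewrite [leRHS]addrC lerD// (le_trans T1)// [leRHS]mulrDl; apply: lerD.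
  have h1 : cabs w / q <= 2^-1.
    by rewrite ler_pdivrMr// /q mulKf// lerDl.
  have h2 : q / (q - cabs w) <= 2.
    by rewrite ler_pdivrMr ?subr_gt0// /q; clear -w0; lra.
  have cq : 0 <= cabs w / q by apply: divr_ge0 => //; exact: ltW.
  apply: (@le_trans _ _ (4 * M * 2^-1 ^+ J * 2)).
    apply: ler_pM => //.
    - by apply: mulr_ge0; [exact: mulr_ge0|exact: exprn_ge0].
    - by apply: divr_ge0; [exact: ltW|rewrite subr_ge0 ltW].
    - by apply: ler_wpM2l; [exact: mulr_ge0|rewrite lerXn2r// nnegrE].
  by rewrite exprVn le_eqVlt; apply/orP; left; apply/eqP; ring.
case: (J) => [|J']; first by rewrite expr0 divr1 mulr1.
by rewrite mulr0 divr_ge0 ?mulr_ge0// exprn_ge0.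
Qed.

End Hartogs.

(** * Separately entire functions of several variables *)

Section SeparatelyEntire.
Variable R : realType.
Variable m : nat.
Local Notation C := R[i].
Local Notation vecC := 'rV[(R[i])^o]_m.
Implicit Types (x y v p : vecC) (j : 'I_m).

Definition setc x j (t : C) : vecC := \row_k (if k == j then (t : C^o) else x 0 k).

Lemma setc_same x j : setc x j (x 0 j) = x.
Proof. by apply/rowP => k; rewrite mxE; case: eqP => [->|]. Qed.

Lemma setc_setc x j s t : setc (setc x j s) j t = setc x j t.
Proof. by apply/rowP => k; rewrite !mxE; case: eqP. Qed.

Lemma setcC x j k s t : j != k -> setc (setc x j s) k t = setc (setc x k t) j s.
Proof.
move=> jk; apply/rowP => i; rewrite !mxE; case: (eqVneq i k) => [->|//].
by rewrite eq_sym (negPf jk).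
Qed.

Variable f : vecC -> C.

Definition sep_entire := forall x j t, cdiff (fun t => f (setc x j t)) t.

Hypothesis fe : sep_entire.

(** Induction on the number of free coordinates. Freezing a or b leaves one fewer, which gives the
    two separate bounds; the remaining coordinates form the parameter [T], in which [hartogs2] is
    uniform. *)
Lemma sep_entire_bounded_on (n : nat) (I : {set 'I_m}) x0 (r : R) : (#|I| <= n)%N ->
  exists M : R, forall x, (forall i, i \notin I -> x 0 i = x0 0 i) ->
    (forall i, i \in I -> cabs (x 0 i) <= r) -> cabs (f x) <= M.
Proof.
elim: n => [|n IH] in I x0 r * => In.
  have I0 : I = finset.set0 by apply/eqP; rewrite -cards_eq0 -leqn0.
  exists (cabs (f x0)) => x xx0 _.
  by have -> : x = x0 by apply/rowP => i; apply: xx0; rewrite I0 inE.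
have [I0|[a aI]] := finset.set_0Vmem I.
  exists (cabs (f x0)) => x xx0 _.
  by have -> : x = x0 by apply/rowP => i; apply: xx0; rewrite I0 inE.
have [J0|[b bJ]] := finset.set_0Vmem (I :\ a)%SET.
  have [M HM] := entire_bounded r (fe x0 a).
  exists M => x xx0 xr; have -> : x = setc x0 a (x 0 a).
    apply/rowP => i; rewrite mxE; case: eqVneq => [->//|ia]; apply: xx0.
    by apply/negP => iI; move/finset.setP/(_ i): J0; rewrite !inE ia iI.
  by apply: HM; exact: xr.
have [bI ba] : b \in I /\ b != a by move: bJ; rewrite !inE => /andP[].
have Ia : (#|(I :\ a)%SET| <= n)%N by move: In; rewrite (cardsD1 a) aI.
have Ib : (#|(I :\ b)%SET| <= n)%N by move: In; rewrite (cardsD1 b) bI.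
pose T := {x : vecC | (forall i, i \notin I -> x 0 i = x0 0 i) /\
   (forall i, i \in I -> i != a -> i != b -> cabs (x 0 i) <= r)}.
pose g (t : T) s z := f (setc (setc (sval t) a s) b z).
have [||||M HM] := @hartogs2 R T g _ _ _ _ r.
- move=> t z s; rewrite /g.
  rewrite (_ : (fun s => _) = fun s => f (setc (setc (sval t) b z) a s)); first exact: fe.
  by apply/funext => u; rewrite setcC// eq_sym.
- by move=> t s z; exact: fe.
- move=> s r'; have [M HM] := IH (I :\ a)%SET (setc x0 a s) (Num.max r r') Ia.
  exists M => -[t [t1 t2]] z zr; apply: HM => i; rewrite !inE !mxE.
    rewrite negb_and negbK => /orP[/eqP->|iI]; first by rewrite eq_sym (negPf ba) eqxx.
    case: eqP iI => [->|_ iI]; first by rewrite bI.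
    by case: eqP => // _; exact: t1.
  move=> /andP[ia iI]; case: eqP => [_|/eqP ib]; first by rewrite le_max zr orbT.
  by rewrite (negPf ia) le_max t2.
- move=> z r'; have [M HM] := IH (I :\ b)%SET (setc x0 b z) (Num.max r r') Ib.
  exists M => -[t [t1 t2]] s sr; apply: HM => i; rewrite !inE !mxE.
    rewrite negb_and negbK => /orP[/eqP->|iI]; first by rewrite eqxx.
    case: eqP => // _; case: eqP iI => [->|_ iI]; first by rewrite aI.
    exact: t1.
  move=> /andP[ib iI]; rewrite (negPf ib); case: eqP => [_|/eqP ia].
    by rewrite le_max sr orbT.
  by rewrite le_max t2.
exists M => x x1 x2.
have xT : (forall i, i \notin I -> x 0 i = x0 0 i) /\
   (forall i, i \in I -> i != a -> i != b -> cabs (x 0 i) <= r).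
  by split=> // i iI _ _; exact: x2.
have := HM (exist _ x xT) (x 0 a) (x 0 b) (x2 _ aI) (x2 _ bI).
by rewrite /g /= setc_same setc_same.
Qed.

Lemma sep_entire_bounded (r : R) :
  exists M : R, forall x, (forall i, cabs (x 0 i) <= r) -> cabs (f x) <= M.
Proof.
have [M HM] := @sep_entire_bounded_on _ (finset.setTfor 'I_m) 0 r (leqnn _).
by exists M => x xr; apply: HM => // i; rewrite inE.
Qed.

(** Stations of a path from x to y that changes one coordinate at a time. *)
Definition hybrid x y (k : nat) : vecC := \row_i (if (i < k)%N then y 0 i else x 0 i).

Lemma hybrid0 x y : hybrid x y 0 = x.
Proof. by apply/rowP => i; rewrite mxE. Qed.

Lemma hybridm x y : hybrid x y m = y.
Proof. by apply/rowP => i; rewrite mxE ltn_ord. Qed.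

Lemma hybridS x y j : hybrid x y j.+1 = setc (hybrid x y j) j (y 0 j).
Proof.
apply/rowP => i; rewrite !mxE ltnS leq_eqVlt; case: (eqVneq i j) => [->|ij].
  by rewrite eqxx.
by rewrite (_ : (i == j :> nat) = false)//; apply/negbTE.
Qed.

Lemma hybrid_telescope x y : f y - f x = \sum_(j < m) (f (hybrid x y j.+1) - f (hybrid x y j)).
Proof.
rewrite -[in LHS](hybridm x y) -[in X in _ - f X = _](hybrid0 x y).
by rewrite -(telescope_sumr (fun k => f (hybrid x y k)) (leq0n m)) big_mkord.
Qed.

Lemma mcoef0 (g : C -> C) : (forall z, cdiff g z) -> mcoef g 0 = g 0.
Proof.
move=> gd; have [M HM] := entire_bounded 1 gd.
apply/esym/eqP; rewrite -subr_eq0; apply/eqP/cabs_le_all => e e0.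
have := taylor_rem 1 gd ltr01 HM (_ : cabs 0 < 1).
rewrite cabs0 ltr01 => /(_ isT); rewrite big_ord1 expr0 mulr1 mul0r expr1 mulr0 mul0r add0r.
by rewrite mulr0 => h; rewrite (le_trans h)// ltW.
Qed.

Lemma entire_lip (g : C -> C) (q M : R) h : (forall z, cdiff g z) -> 0 < q ->
  (forall z, cabs z <= q -> cabs (g z) <= M) -> cabs h <= q / 2 ->
  cabs (g h - g 0) <= 8 * M / q * cabs h.
Proof.
move=> gd q0 gM hq.
have M0 : 0 <= M by apply: le_trans (gM 0 _); rewrite ?cabs_ge0// cabs0 ltW.
have h1 : cabs h < q by rewrite (le_lt_trans hq)// ltr_pdivrMr// ltr_pMr// ltr1n.
have := taylor_rem 1 gd q0 gM h1.
rewrite big_ord1 mcoef0// expr0 mulr1 mulr0 addr0 expr1 => /le_trans; apply.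
have h2 : q / (q - cabs h) <= 2.
  by rewrite ler_pdivrMr ?subr_gt0//; lra.
have c0 : 0 <= 4 * M * (cabs h / q).
  by apply: mulr_ge0; [exact: mulr_ge0|rewrite divr_ge0 ?cabs_ge0 ?(ltW q0)].
apply: (le_trans (ler_wpM2l c0 h2)).
by rewrite le_eqVlt; apply/orP; left; apply/eqP; ring.
Qed.

Lemma entire_quad (g : C -> C) (q M : R) h : (forall z, cdiff g z) -> 0 < q ->
  (forall z, cabs z <= q -> cabs (g z) <= M) -> cabs h <= q / 2 ->
  cabs (g h - g 0 - mcoef g 1 * h) <= 8 * M / q ^+ 2 * cabs h ^+ 2.
Proof.
move=> gd q0 gM hq.
have M0 : 0 <= M by apply: le_trans (gM 0 _); rewrite ?cabs_ge0// cabs0 ltW.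
have h1 : cabs h < q by rewrite (le_lt_trans hq)// ltr_pdivrMr// ltr_pMr// ltr1n.
have := taylor_rem 2 gd q0 gM h1.
rewrite big_ord_recl big_ord1 /= /bump /= addn0 mcoef0// expr0 mulr1 mulr0 addr0 expr1.
rewrite opprD addrA => /le_trans; apply.
have h2 : q / (q - cabs h) <= 2.
  by rewrite ler_pdivrMr ?subr_gt0//; lra.
have c0 : 0 <= 4 * M * (cabs h / q) ^+ 2.
  apply: mulr_ge0; first exact: mulr_ge0.
  by rewrite exprn_ge0// divr_ge0 ?cabs_ge0 ?(ltW q0).
apply: (le_trans (ler_wpM2l c0 h2)).
by rewrite expr_div_n le_eqVlt; apply/orP; left; apply/eqP; ring.
Qed.

Lemma setc_shift x j t z : cdiff (fun u => f (setc x j (t + u))) z.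
Proof. exact: (@cdiff_shift _ (fun u => f (setc x j u)) t z (fe x j)). Qed.

Lemma sep_entire_lip (r : R) : 0 <= r -> exists2 L : R, 0 <= L & forall x y,
  (forall i, cabs (x 0 i) <= r) -> (forall i, cabs (y 0 i) <= r) ->
  cabs (f y - f x) <= L * \sum_i cabs (y 0 i - x 0 i).
Proof.
(* Coordinates move by at most 2 r <= q / 2, the range allowed by [entire_lip]. *)
move=> r0; pose q : R := 4 * r + 1.
have q0 : 0 < q by rewrite ltr_wpDl// mulr_ge0.
have [M HM] := sep_entire_bounded (q + r).
have M0 : 0 <= M.
  by apply: le_trans (HM 0 _) => [|i]; rewrite ?cabs_ge0// mxE cabs0 addr_ge0// ltW.
exists (8 * M / q); first by rewrite divr_ge0 ?mulr_ge0// ltW.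
move=> x y xr yr; rewrite (hybrid_telescope x y) mulr_sumr.
have hyb k i : cabs (hybrid x y k 0 i) <= r by rewrite mxE; case: ifP.
apply: (@le_trans _ _ (\sum_(j < m) cabs (f (hybrid x y j.+1) - f (hybrid x y j)))).
  apply: (big_ind2 (fun a b => cabs a <= b)) => //; first by rewrite cabs0.
  by move=> a b c e h1 h2; rewrite (le_trans (ler_cabsD _ _))// lerD.
apply: ler_sum => j _; rewrite hybridS; set h := hybrid x y j.
have hj : h 0 j = x 0 j by rewrite mxE ltnn.
have := @entire_lip (fun u => f (setc h j (x 0 j + u))) q M (y 0 j - x 0 j)
  (setc_shift h j (x 0 j)) q0.
rewrite [x 0 j + (_ - _)]addrC subrK addr0 -hj setc_same; apply.
  move=> z zq; apply: HM => i; rewrite mxE; case: eqP => _.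
    by rewrite (le_trans (ler_cabsD _ _))// addrC lerD// hyb.
  by rewrite (le_trans (hyb _ _))// lerDr ltW.
rewrite (le_trans (ler_cabsB _ _))// (le_trans (lerD (yr j) (hyb _ _)))//.
by rewrite /q ler_pdivlMr//; lra.
Qed.

Definition cpartial p j : C := mcoef (fun u => f (setc p j (p 0 j + u))) 1.

Lemma cderiv_cpartial p j : cderiv (fun u => f (setc p j (p 0 j + u))) 0 (cpartial p j).
Proof.
move=> e e0; pose g u := f (setc p j (p 0 j + u)).
have [M HM] := entire_bounded 1 (setc_shift p j (p 0 j)).
have M0 : 0 <= M by apply: le_trans (HM 0 _); rewrite ?cabs_ge0// cabs0.
exists (Num.min (1 / 2) (e / (8 * M + 1))).
  by rewrite lt_min divr_gt0//= divr_gt0// ltr_wpDl// mulr_ge0.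
move=> h; rewrite le_min add0r => /andP[h2 he].
have := @entire_quad g 1 M h (setc_shift p j (p 0 j)) ltr01 HM h2.
rewrite /g expr1n divr1 => /le_trans; apply.
rewrite expr2 mulrA ler_wpM2r ?cabs_ge0//.
have c0 : 0 < 8 * M + 1 by rewrite ltr_wpDl// mulr_ge0.
move: he; rewrite ler_pdivlMr// mulrC; apply: le_trans.
by rewrite ler_wpM2r ?cabs_ge0// lerDl.
Qed.

(** Along the hybrid path each increment is a one-variable Taylor expansion with quadratic
    remainder, whose linear coefficient belongs to the hybrid point. Cauchy's estimate for g - g0,
    which is O(t) by [sep_entire_lip], replaces that coefficient by the one at p, at the cost of
    another O(t^2). *)
Lemma sep_entire_cderiv p v : cderiv (fun t => f (t *: v + p)) 0 (\sum_j v 0 j * cpartial p j).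
Proof.
pose r : R := \sum_i (cabs (p 0 i) + cabs (v 0 i)).
have r0 : 0 <= r by apply: sumr_ge0 => i _; rewrite addr_ge0 ?cabs_ge0.
have pvr i : cabs (p 0 i) + cabs (v 0 i) <= r.
  by rewrite /r (bigD1 i)//= lerDl sumr_ge0// => k _; rewrite addr_ge0 ?cabs_ge0.
have pr i : cabs (p 0 i) <= r by rewrite (le_trans _ (pvr i))// lerDl cabs_ge0.
have vr i : cabs (v 0 i) <= r by rewrite (le_trans _ (pvr i))// lerDr cabs_ge0.
pose q : R := 2 * r + 2.
have q0 : 0 < q by rewrite ltr_wpDl// mulr_ge0.
have [M HM] := sep_entire_bounded (q + r).
have [L L0 HL] := sep_entire_lip (r := q + r) ltac:(by rewrite addr_ge0// ltW).
have M0 : 0 <= M.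
  by apply: le_trans (HM 0 _) => [|i]; rewrite ?cabs_ge0// mxE cabs0 addr_ge0// ltW.
pose V : R := \sum_i cabs (v 0 i).
have V0 : 0 <= V by apply: sumr_ge0 => i _; exact: cabs_ge0.
pose K : R := \sum_(j < m) (8 * M / q ^+ 2 * cabs (v 0 j) ^+ 2 + 2 * L * V * cabs (v 0 j)).
have K0 : 0 <= K.
  apply: sumr_ge0 => j _; rewrite addr_ge0// mulr_ge0 ?sqr_ge0 ?cabs_ge0 ?mulr_ge0//.
  by rewrite invr_ge0 exprn_ge0// ltW.
move=> e e0; have K1 : 0 < K + 1 by rewrite ltr_wpDl.
exists (Num.min 1 (e / (K + 1))); first by rewrite lt_min ltr01 divr_gt0.
move=> t; rewrite le_min add0r scale0r add0r => /andP[t1 te].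
apply: (@le_trans _ _ (K * cabs t ^+ 2)); last first.
  rewrite expr2 mulrA ler_wpM2r ?cabs_ge0//.
  move: te; rewrite ler_pdivlMr// mulrC; apply: le_trans.
  by rewrite ler_wpM2r ?cabs_ge0// lerDl.
rewrite (hybrid_telescope p (t *: v + p)) mulr_suml -sumrB /K mulr_suml.
apply: (@le_trans _ _ (\sum_(j < m) cabs (f (hybrid p (t *: v + p) j.+1) -
   f (hybrid p (t *: v + p) j) - v 0 j * cpartial p j * t))).
  apply: (big_ind2 (fun a b => cabs a <= b)) => //; first by rewrite cabs0.
  by move=> a b c e' h1 h2; rewrite (le_trans (ler_cabsD _ _))// lerD.
apply: ler_sum => j _; rewrite hybridS; set a := hybrid p (t *: v + p) j.
have aj : a 0 j = p 0 j by rewrite mxE ltnn.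
have tvr i : cabs (t * v 0 i) <= cabs (v 0 i).
  by rewrite cabsM ler_piMl ?cabs_ge0.
have ar i : cabs (a 0 i) <= r.
  rewrite mxE; case: ifP => _ //; rewrite !mxE (le_trans (ler_cabsD _ _))//.
  by rewrite (le_trans _ (pvr i))// addrC lerD2l.
have -> : (t *: v + p) 0 j = p 0 j + t * v 0 j by rewrite !mxE addrC.
pose g u := f (setc a j (p 0 j + u)).
have gd : forall z, cdiff g z by exact: setc_shift.
pose g0 u := f (setc p j (p 0 j + u)).
have g0d : forall z, cdiff g0 z by exact: setc_shift.
have fa : f a = g 0 by rewrite /g addr0 -aj setc_same.
rewrite fa -/(g (t * v 0 j)).
have -> : g (t * v 0 j) - g 0 - v 0 j * cpartial p j * t =
  (g (t * v 0 j) - g 0 - mcoef g 1 * (t * v 0 j)) +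
  (mcoef g 1 - mcoef g0 1) * (t * v 0 j) by rewrite /cpartial -/g0; ring.
apply: (le_trans (ler_cabsD _ _)); rewrite [leRHS]mulrDl; apply: lerD.
  have := @entire_quad g q M (t * v 0 j) gd q0.
  move=> H; rewrite -[leRHS]mulrA -exprMn [_ * cabs t]mulrC -cabsM; apply: H.
    move=> z zq; apply: HM => i; rewrite mxE; case: eqP => _.
      by rewrite (le_trans (ler_cabsD _ _))// addrC lerD// pr.
    by rewrite (le_trans (ar _))// lerDr ltW.
  rewrite (le_trans (tvr j))// (le_trans (vr j))// /q.
  by rewrite ler_pdivlMr//; lra.
rewrite -mcoefB// cabsM.
have := @mcoef_le _ (fun z => g z - g0 z) 1 1 (L * (cabs t * V))
  (fun z => cdiffB (gd z) (g0d z)) ltr01.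
rewrite expr1n divr1 => H.
rewrite cabsM [leRHS](_ : _ = 2 * (L * (cabs t * V)) * (cabs t * cabs (v 0 j))); last by ring.
apply: ler_wpM2r; first by rewrite mulr_ge0 ?cabs_ge0.
apply: H => z z1; rewrite /g /g0.
have zq : cabs z <= q by rewrite z1 /q; lra.
apply: (le_trans (HL (setc p j (p 0 j + z)) (setc a j (p 0 j + z)) _ _)).
- move=> i; rewrite mxE; case: eqP => _.
    by rewrite (le_trans (ler_cabsD _ _))// addrC lerD// pr.
  by rewrite (le_trans (pr _))// lerDr ltW.
- move=> i; rewrite mxE; case: eqP => _.
    by rewrite (le_trans (ler_cabsD _ _))// addrC lerD// pr.
  by rewrite (le_trans (ar _))// lerDr ltW.
rewrite ler_wpM2l// mulr_sumr; apply: ler_sum => i _.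
rewrite !mxE; case: eqP => _; first by rewrite subrr cabs0 mulr_ge0 ?cabs_ge0.
case: ifP => _; last by rewrite subrr cabs0 mulr_ge0 ?cabs_ge0.
by rewrite addrK cabsM.
Qed.

Lemma cderiv_uniq (g : C -> C) z l k : cderiv g z l -> cderiv g z k -> l = k.
Proof.
move=> H1 H2; apply/eqP; rewrite -subr_eq0; apply/eqP/cabs_le_all => e e0.
have [d1 d10 G1] := H1 (e / 2) ltac:(by rewrite divr_gt0).
have [d2 d20 G2] := H2 (e / 2) ltac:(by rewrite divr_gt0).
pose h : R := Num.min d1 d2; have h0 : 0 < h by rewrite lt_min d10.
have hC : cabs h%:C = h by rewrite cabs_real ger0_norm// ltW.
have := G1 h%:C; have := G2 h%:C; rewrite hC !ge_min !lexx orbT /=.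
move=> /(_ isT) a2 /(_ isT) a1.
rewrite -(ler_pM2r h0) -{1}hC -cabsM.
have -> : (l - k) * h%:C = (g (z + h%:C) - g z - k * h%:C) - (g (z + h%:C) - g z - l * h%:C).
  by ring.
by rewrite (le_trans (ler_cabsB _ _))// (splitr e) mulrDl lerD.
Qed.

End SeparatelyEntire.

(** * The intertwining operator *)

Section PolynomialFunctions.
Variable R : realType.

Lemma is_derive_line (V : normedModType R) (f : V -> R) x v (l : R) :
  is_derive (0 : R) 1 (fun h : R => f (h *: v + x)) l -> is_derive x v f l.
Proof.
move=> [d1 d2].
have E : (fun h : R => h^-1 *: ((f \o shift x) (h *: v) - f x)) =
    (fun h : R => h^-1 *: (((fun h : R => f (h *: v + x)) \o shift 0) (h *: 1) -
      (fun h : R => f (h *: v + x)) 0)).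
  apply/funext => h; rewrite /= addr0 scale0r add0r.
  by rewrite (_ : h *: (1 : R) = h)// /GRing.scale/= mulr1.
apply: DeriveDef; first by rewrite /derivable E; exact: d1.
by rewrite /derive E; exact: d2.
Qed.

Variable m : nat.

Lemma mpoly_gen_ind (P : {mpoly R[m]} -> Prop) :
  (forall c, P c%:MP) -> (forall i, P 'X_i) ->
  (forall p q, P p -> P q -> P (p + q)) -> (forall p q, P p -> P q -> P (p * q)) ->
  forall p, P p.
Proof.
move=> PC PX PD PM p; rewrite [p]mpolyE.
apply: (big_ind P) => [||k _]; [by rewrite -mpolyC0; exact: PC|by move=> *; exact: PD|].
rewrite -mul_mpolyC mpolyXE_id; apply: (PM _ _); first exact: PC.
apply: (big_ind P) => [||i _]; [by rewrite -mpolyC1; exact: PC|by move=> *; exact: PM|].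
by elim: (k i) => [|d IH]; [rewrite expr0 -mpolyC1; exact: PC|rewrite exprS; exact: PM].
Qed.

Lemma meval_continuous (c : 'I_m -> R -> R) (p : {mpoly R[m]}) :
  (forall i, continuous (c i)) -> continuous (fun t : R => p.@[c^~ t]).
Proof.
move=> cc; elim/mpoly_gen_ind: p => [k|i|p q IHp IHq|p q IHp IHq] t.
- rewrite (_ : (fun t : R => _) = fun=> k); first exact: cst_continuous.
  by apply/funext => u; rewrite mevalC.
- rewrite (_ : (fun t : R => _) = c i); first exact: cc.
  by apply/funext => u; rewrite mevalXU.
- rewrite (_ : (fun t : R => _) = fun t => p.@[c^~ t] + q.@[c^~ t]).
    by apply: continuousD; [exact: IHp|exact: IHq].
  by apply/funext => u; rewrite mevalD.
- rewrite (_ : (fun t : R => _) = fun t => p.@[c^~ t] * q.@[c^~ t]).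
    by apply: continuousM; [exact: IHp|exact: IHq].
  by apply/funext => u; rewrite mevalM.
Qed.

Lemma meval_is_derive (c : 'I_m -> R -> R) (dc : 'I_m -> R) (t : R) (p : {mpoly R[m]}) :
  (forall i, is_derive t 1 (c i) (dc i)) ->
  is_derive t 1 (fun t : R => p.@[c^~ t]) (\sum_i dc i * (p^`M(i)).@[c^~ t]).
Proof.
move=> cd; elim/mpoly_gen_ind: p => [k|i|p q IHp IHq|p q IHp IHq].
- rewrite (_ : (fun t : R => _) = cst k); last by apply/funext => u; rewrite mevalC.
  by rewrite big1 => [|i _]; rewrite ?mderivC ?meval0 ?mulr0//; exact: is_derive_cst.
- rewrite (_ : (fun t : R => _) = c i); last by apply/funext => u; rewrite mevalXU.
  rewrite (bigD1 i)//= big1 => [|k ki].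
    have -> : 'X_i^`M(i) = 1 :> {mpoly R[m]}.
      rewrite mderivX mnm1E eqxx scale1r -[X in (X - _)%MM]add0m addmK.
      by rewrite mpolyX0.
    by rewrite meval1 mulr1 addr0.
  by rewrite mderivX mnm1E eq_sym (negPf ki) scale0r meval0 mulr0.
- rewrite (_ : (fun t : R => _) = (fun t => p.@[c^~ t]) + (fun t => q.@[c^~ t])).
    rewrite (_ : \sum_i _ = \sum_i dc i * (p^`M(i)).@[c^~ t] + \sum_i dc i * (q^`M(i)).@[c^~ t]).
      exact: is_deriveD.
    by rewrite -big_split/=; apply: eq_bigr => i _; rewrite mderivD mevalD mulrDr.
  by apply/funext => u; rewrite mevalD.
- rewrite (_ : (fun t : R => _) = (fun t => p.@[c^~ t]) * (fun t => q.@[c^~ t])).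
    rewrite (_ : \sum_i _ = p.@[c^~ t] *: (\sum_i dc i * (q^`M(i)).@[c^~ t]) +
       q.@[c^~ t] *: (\sum_i dc i * (p^`M(i)).@[c^~ t])).
      exact: is_deriveM.
    rewrite /GRing.scale/= !mulr_sumr -big_split/=; apply: eq_bigr => i _.
    by rewrite mderivM mevalD !mevalM; ring.
  by apply/funext => u; rewrite mevalM.
Qed.

Local Notation vecR := 'rV[R]_m.

Lemma peval_is_derive (p : {mpoly R[m]}) (x v : vecR) :
  is_derive x v (peval p) (\sum_i v 0 i * peval p^`M(i) x).
Proof.
apply: is_derive_line.
have := @meval_is_derive (fun i h => h * v 0 i + x 0 i) (fun i => v 0 i) 0 p.
have E h : (fun i => h * v 0 i + x 0 i) =1 (h *: v + x) 0 by move=> i; rewrite !mxE.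
have E0 : (fun i => 0 * v 0 i + x 0 i) =1 x 0 by move=> i; rewrite mul0r add0r.
rewrite (_ : (fun t : R => _) = (fun h : R => peval p (h *: v + x))); last first.
  by apply/funext => h; exact: meval_eq.
rewrite (_ : \sum_i _ = \sum_i v 0 i * peval p^`M(i) x); last first.
  by apply: eq_bigr => i _; congr (_ * _); exact: meval_eq.
apply=> i.
have : is_derive (0 : R) 1 (fun h : R => v 0 i *: h + cst (x 0 i) h) (v 0 i *: 1 + 0).
  exact: is_deriveD.
rewrite addr0 /GRing.scale/= mulr1.
by congr is_derive; apply/funext => h; rewrite mulrC.
Qed.

Lemma derive_peval p (x : vecR) j : 'D_(eR R j) (peval p) x = peval p^`M(j) x.
Proof.
have [_ ->] := peval_is_derive p x (eR R j).
rewrite (bigD1 j)//= big1 => [|i ij]; first by rewrite mxE eqxx mul1r addr0.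
by rewrite mxE (negPf ij) mul0r.
Qed.

Lemma pevalX j (x : vecR) : peval 'X_j x = x 0 j.
Proof. by rewrite /peval mevalXU. Qed.

Lemma euler_mpoly (p : {mpoly R[m]}) n : p \is n.-homog ->
  \sum_j 'X_j * p^`M(j) = n%:R *: p.
Proof.
move=> /dhomogP ph; rewrite [p in RHS]mpolyE [p in LHS]mpolyE scaler_sumr.
under eq_bigr do rewrite raddf_sum/= mulr_sumr.
rewrite exchange_big/=; apply: eq_big_seq => k kp.
under eq_bigr do rewrite mderivZ mderivX -scalerAr.
rewrite -scaler_sumr scalerA mulrC -scalerA; congr (_ *: _).
rewrite -(ph k kp : mdeg k = n) mdegE natr_sum scaler_suml; apply: eq_bigr => j _.
rewrite -scalerAr -mpolyXD; case: (posnP (k j)) => [->|k0]; first by rewrite !scale0r.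
by rewrite addmC submK// lep1mP -lt0n.
Qed.

End PolynomialFunctions.

(** * Majorants of polynomials *)

Section Domination.
Variables (R : realType) (m : nat).
Implicit Types p q : {mpoly R[m]}.

Definition mdom p q := forall k, `|p@_k| <= q@_k.

Lemma mdomD p q p' q' : mdom p q -> mdom p' q' -> mdom (p + p') (q + q').
Proof. by move=> h h' k; rewrite !mcoeffD (le_trans (ler_normD _ _))// lerD. Qed.

Lemma mdomM p q p' q' : mdom p q -> mdom p' q' -> mdom (p * p') (q * q').
Proof.
move=> h h' k; rewrite !mcoeffM (le_trans (ler_norm_sum _ _ _))//.
by apply: ler_sum => i _; rewrite normrM ler_pM.
Qed.

Lemma mdomX p q n : mdom p q -> mdom (p ^+ n) (q ^+ n).
Proof.
move=> h; elim: n => [|n IH]; last by rewrite !exprS; exact: mdomM.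
by move=> k; rewrite !expr0 mcoeff1 ger0_norm.
Qed.

Lemma mdomZ c p q : mdom p q -> mdom (c *: p) (`|c| *: q).
Proof. by move=> h k; rewrite !mcoeffZ normrM ler_wpM2l. Qed.

Lemma mdom_sum (I : Type) (s : seq I) (F G : I -> {mpoly R[m]}) :
  (forall i, mdom (F i) (G i)) -> mdom (\sum_(i <- s) F i) (\sum_(i <- s) G i).
Proof.
move=> h; elim: s => [|i s IH]; last by rewrite !big_cons; exact: mdomD.
by move=> k; rewrite !big_nil mcoeff0 normr0.
Qed.

Lemma mdom_mon k : mdom 'X_[k] 'X_[k].
Proof. by move=> j; rewrite mcoeffX ger0_norm. Qed.

Definition mabs p : {mpoly R[m]} := \sum_(k <- msupp p) `|p@_k| *: 'X_[k].

Lemma mdom_abs p : mdom p (mabs p).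
Proof.
rewrite {1}[p]mpolyE /mabs; apply: mdom_sum => k; apply: mdomZ; exact: mdom_mon.
Qed.

(** On monomials the functional is bounded by evaluation at (r, ..., r), so a majorant evaluated
    there bounds it everywhere. Estimates of [V] on products and powers thus follow from its values
    on monomials. *)
Lemma linear_mdom_le (L : {mpoly R[m]} -> R) (r : R) p q : 0 <= r ->
  (forall c u v, L (c *: u + v) = c * L u + L v) ->
  (forall k, `|L 'X_[k]| <= r ^+ mdeg k) -> mdom p q -> `|L p| <= q.@[fun=> r].
Proof.
move=> r0 Ll Lk pq; pose w := maxn (msize p) (msize q).
have L0 : L 0 = 0.
  have := Ll 1 0 0; rewrite scale1r addr0 mul1r => /eqP.
  by rewrite addrC -subr_eq subrr eq_sym => /eqP.
have LD u v : L (u + v) = L u + L v by rewrite -[u]scale1r Ll scale1r mul1r.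
have LZ c u : L (c *: u) = c * L u by rewrite -[c *: u]addr0 Ll L0 addr0.
rewrite [p](@mpolywE _ _ w) ?leq_maxl// [q](@mpolywE _ _ w) ?leq_maxr//.
rewrite raddf_sum (big_morph L LD L0) (le_trans (ler_norm_sum _ _ _))//.
apply: ler_sum => k _; rewrite LZ normrM [leRHS]/= mevalZ mevalX.
rewrite prodrXr -mdegE.
by rewrite ler_pM.
Qed.

End Domination.

(** * Reflections, sums over roots and the maximum principle *)

Section Reflections.
Variables (R : realType) (m : nat).
Notation vecR := ('rV[R]_m).
Implicit Types (x y a b : vecR) (c : R).

Lemma dotRC x y : dotR x y = dotR y x.
Proof. by apply: eq_bigr => j _; rewrite mulrC. Qed.
Lemma dotRDl x y a : dotR (x + y) a = dotR x a + dotR y a.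
Proof. by rewrite -big_split; apply: eq_bigr => j _; rewrite mxE mulrDl. Qed.
Lemma dotRZl c x a : dotR (c *: x) a = c * dotR x a.
Proof. by rewrite mulr_sumr; apply: eq_bigr => j _; rewrite mxE mulrA. Qed.
Lemma dotRNl x a : dotR (- x) a = - dotR x a.
Proof. by rewrite -scaleN1r dotRZl mulN1r. Qed.
Lemma dotRDr x y a : dotR a (x + y) = dotR a x + dotR a y.
Proof. by rewrite !(dotRC a) dotRDl. Qed.
Lemma dotRZr c x a : dotR a (c *: x) = c * dotR a x.
Proof. by rewrite !(dotRC a) dotRZl. Qed.
Lemma dotRNr x a : dotR a (- x) = - dotR a x.
Proof. by rewrite !(dotRC a) dotRNl. Qed.
Definition dotRE := (dotRDl, dotRDr, dotRNl, dotRNr, dotRZl, dotRZr).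

Lemma dotR_ge0 x : 0 <= dotR x x.
Proof. by apply: sumr_ge0 => j _; rewrite -expr2 sqr_ge0. Qed.

Lemma dotR_eq0 x : (dotR x x == 0) = (x == 0).
Proof.
apply/eqP/eqP => [h|->]; last by apply: big1 => j _; rewrite mxE mul0r.
apply/rowP => j; rewrite mxE; apply/eqP.
have /psumr_eq0P : forall i, true -> 0 <= x 0 i * x 0 i by move=> i _; rewrite -expr2 sqr_ge0.
by move=> /(_ h j isT) /eqP; rewrite mulf_eq0 orbb.
Qed.

Lemma sqr_coord_le x j : x 0 j ^+ 2 <= dotR x x.
Proof. by rewrite /dotR (bigD1 j)//= expr2 lerDl sumr_ge0// => i _; rewrite -expr2 sqr_ge0. Qed.

Lemma coord_le x (r : R) j : 0 <= r -> dotR x x <= r ^+ 2 -> `|x 0 j| <= r.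
Proof.
move=> r0 xr; rewrite -(@ler_pXn2r _ 2)// ?nnegrE// real_normK ?num_real//.
exact: le_trans (sqr_coord_le x j) xr.
Qed.

Lemma reflE a x : refl a x = x - (2 * dotR x a / dotR a a) *: a.
Proof. by []. Qed.

Lemma refl_dot a x y : a != 0 -> dotR (refl a x) (refl a y) = dotR x y.
Proof.
rewrite -dotR_eq0 !reflE !dotRE (dotRC a y) => a0; by field.
Qed.

Lemma refl_root a x : a != 0 -> dotR (refl a x) a = - dotR x a.
Proof. by rewrite -dotR_eq0 !reflE !dotRE => a0; field. Qed.

Lemma reflK a : a != 0 -> involutive (refl a).
Proof.
move=> a0 x; rewrite {1}/refl refl_root// mulrN mulNr scaleNr opprK.
by rewrite reflE subrK.
Qed.

Lemma refl_opp a x : refl (- a) x = refl a x.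
Proof.
by rewrite !reflE !dotRE opprK mulrN mulNr scalerN scaleNr opprK.
Qed.

Lemma refl_lin a c x y : refl a (c *: x + y) = c *: refl a x + refl a y.
Proof.
rewrite !reflE scalerBr scalerA addrACA -opprD -scalerDl !dotRE; congr (_ - _ *: _).
by rewrite !mulrDr mulrDl !mulrA [2 * c]mulrC.
Qed.

Lemma reflN a x : refl a (- x) = - refl a x.
Proof.
by rewrite !reflE !dotRE opprD opprK -scaleNr mulrN mulNr opprK.
Qed.

Lemma refl_conj a b x : b != 0 -> refl b (refl a x) = refl (refl b a) (refl b x).
Proof.
move=> b0; rewrite [refl a x]reflE [RHS]reflE !refl_dot// addrC -scaleNr refl_lin.
by rewrite scaleNr addrC.
Qed.

End Reflections.

Section RootSums.
Variables (R : realType) (m : nat).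
Notation vecR := ('rV[R]_m).
Variables (Rs Rp : seq vecR) (kappa : vecR -> R).
Hypotheses (HRs : root_system Rs) (HRp : positive_subsystem Rs Rp)
  (Hk : multiplicity Rs kappa).

Lemma pos_root a : a \in Rp -> a \in Rs.
Proof. by case: HRp => _ [b [_ h]] /h[]. Qed.

Lemma root_neq0 a : a \in Rs -> a != 0.
Proof. by case: HRs => _ R0 _ _ _ aR; apply: contraNneq R0 => <-. Qed.

Lemma pos_root_neq0 a : a \in Rp -> a != 0.
Proof. by move=> /pos_root/root_neq0. Qed.

Lemma mult_ge0 a : a \in Rp -> 0 <= kappa a.
Proof. by move=> /pos_root; case: Hk => h _; exact: h. Qed.

Lemma multN a : a \in Rs -> kappa (- a) = kappa a.
Proof.
move=> aR; case: Hk => _ /(_ a a aR aR) <-; congr kappa.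
rewrite reflE -mulrA divff ?mulr1 ?dotR_eq0 ?root_neq0//.
by rewrite scaler_nat mulr2n opprD addNKr.
Qed.

Lemma sum_root_pos (h : vecR -> R) : (forall a, a \in Rs -> h (- a) = h a) ->
  \sum_(a <- Rs) h a = 2 * \sum_(a <- Rp) h a.
Proof.
case: HRs => uR _ _ RN _; case: HRp => uP [b [b0 bP]] hN.
have pR : perm_eq Rs (Rp ++ map -%R Rp).
  apply: uniq_perm => //.
    rewrite cat_uniq uP (map_inj_uniq oppr_inj) uP andbT/=.
    apply/hasPn => _ /mapP[a /bP[_ a0] ->]; apply/negP => /bP[_].
    by rewrite dotRNl; lra.
  move=> a; rewrite mem_cat; apply/idP/orP => [aR|[/bP[]//|/mapP[c /bP[cR _] ->]]]; last exact: RN.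
  have := b0 a aR; rewrite neq_lt => /orP[a0|a0]; [right|by left; apply/bP].
  apply/mapP; exists (- a); rewrite ?opprK//; apply/bP; split; first exact: RN.
  by rewrite dotRNl oppr_gt0.
rewrite (perm_big _ pR) big_cat big_map/= mulr2n mulrDl mul1r; congr (_ + _).
by apply: eq_big_seq => a /pos_root; exact: hN.
Qed.

(** A reflection need not preserve [Rp], but it permutes [Rs], and for even h the sum over [Rp] is
    half the one over [Rs]. *)
Lemma sum_pos_refl b (h : vecR -> R) : b \in Rs -> (forall a, a \in Rs -> h (- a) = h a) ->
  \sum_(a <- Rp) h (refl b a) = \sum_(a <- Rp) h a.
Proof.
move=> bR hN; case: (HRs) => uR _ Rr _ _.
have b0 := root_neq0 bR.
apply: (@mulfI R 2); rewrite // -!sum_root_pos//; last first.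
  by move=> a aR; rewrite reflN hN// Rr.
have pR : perm_eq (map (refl b) Rs) Rs.
  apply: uniq_perm => //; first by rewrite map_inj_uniq//; exact: inv_inj (reflK b0).
  move=> a; apply/mapP/idP => [[c cR ->]|aR]; first exact: Rr.
  by exists (refl b a); rewrite ?reflK//; exact: Rr.
by rewrite -[RHS](perm_big _ pR)/= big_map.
Qed.

(* At a point where u is nearly maximal the reflection terms are nearly nonnegative,
   so the first-order term alone controls the size of u. *)
Lemma max_principle (u : vecR -> R) (n r b M : R) : 0 < n ->
  (forall x, dotR x x <= r -> `|u x| <= M) ->
  (forall x, dotR x x <= r ->
     `|n * u x + \sum_(a <- Rp) kappa a * (u x - u (refl a x))| <= n * b) ->
  forall x, dotR x x <= r -> `|u x| <= b.
Proof.
move=> n0 uM un.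
have refl_ball x a : a \in Rp -> dotR x x <= r -> dotR (refl a x) (refl a x) <= r.
  by move=> aR; rewrite refl_dot// pos_root_neq0.
pose A := [set `|u x| | x in [set x | dotR x x <= r]]%classic.
pose S := sup A.
move=> x0 x0r.
have hA : has_sup A.
  by split; [exists `|u x0|, x0|exists M => _ [x xr <-]; exact: uM].
have uS x : dotR x x <= r -> `|u x| <= S by move=> xr; apply: (sup_upper_bound hA); exists x.
apply: le_trans (uS _ x0r) _; rewrite -(ler_pM2l n0).
pose k : R := \sum_(a <- Rp) kappa a.
have k0 : 0 <= k by rewrite /k big_seq sumr_ge0// => a; exact: mult_ge0.
apply/ler_addgt0Pr => e e0.
(* The loss is n d in the first-order term and k d in the reflection terms, e in total. *)
pose d : R := e / (n + k).
have d0 : 0 < d by rewrite divr_gt0// ltr_wpDr.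
have [_ [x xr <-] xS] := sup_adherent d0 hA.
have {}xS : S - d < `|u x| by exact: xS.
have key (s : R) : s * u x = `|u x| -> `|s| = 1 -> n * S <= n * b + e.
  move=> sux s1.
  have h : s * (n * u x + \sum_(a <- Rp) kappa a * (u x - u (refl a x))) <= n * b.
    by rewrite (le_trans (ler_norm _))// normrM s1 mul1r un.
  have h2 : s * \sum_(a <- Rp) kappa a * (u x - u (refl a x)) >= - (d * k).
    rewrite /k !mulr_sumr -sumrN !big_seq; apply: ler_sum => a aR.
    rewrite mulrCA -mulNr mulrC; apply: ler_wpM2l; first exact: mult_ge0.
    rewrite mulrBr sux.
    have : s * u (refl a x) <= S.
      by rewrite (le_trans (ler_norm _))// normrM s1 mul1r uS// refl_ball.
    by clear -xS; lra.
  have h3 : n * (S - d) <= n * `|u x| by rewrite ler_pM2l// ltW.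
  have h4 : (n + k) * d = e by rewrite mulrC divfK// gt_eqF// ltr_wpDr.
  move: h; rewrite mulrDr mulrCA sux => h.
  by clear -h h2 h3 h4; lra.
have [u0|u0] := leP 0 (u x).
  by apply: (key 1); rewrite ?normr1// mul1r ger0_norm.
by apply: (key (-1)); rewrite ?normrN1// mulN1r ltr0_norm.
Qed.

(** The direction b is positive on every positive root, so along t b + x each root vanishes for one
    value of t only. *)
Lemma regular_near (x : vecR) : exists b : vecR, \forall t \near (0 : R)^'%classic, regular Rp (t *: b + x).
Proof.
case: HRp => _ [b [_ bP]]; exists b.
suff : \forall t \near (0 : R)^'%classic, forall a, a \in Rp -> dotR a (t *: b + x) != 0 by [].
have : forall a, a \in Rp -> 0 < dotR a b by move=> a /bP[].
elim: Rp => [|a s IH] h; first by near=> t.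
have {IH} := IH (fun a' h' => h a' (mem_behead (s := a :: s) h')).
have a0 : 0 < dotR a b by apply: h; rewrite mem_head.
have : \forall t \near (0 : R)^'%classic, t != - dotR a x / dotR a b.
  have [->|e0] := eqVneq (- dotR a x / dotR a b) 0; first exact: nbhs_dnbhs_neq.
  have : nbhs (0 : R) [set t | t != - dotR a x / dotR a b]%classic.
    by apply: open_nbhs_nbhs; split; [exact: open_neq | rewrite /= eq_sym].
  exact: nbhs_dnbhs.
apply: filterS2 => t t0 ht c; rewrite inE => /predU1P[->|]; last exact: ht.
apply: contra t0; rewrite !dotRE addr_eq0 => /eqP <-.
by rewrite mulfK// gt_eqF.
Unshelve. all: by end_near.
Qed.

(** The relations for [V] and [E] are given off the reflecting hyperplanes; continuity along lines
    carries their consequences across. *)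
Lemma regular_density (V : normedModType R) (f g : vecR -> V) x :
  (forall v : vecR, {for 0, continuous (fun t : R => f (t *: v + x))}) ->
  (forall v : vecR, {for 0, continuous (fun t : R => g (t *: v + x))}) ->
  (forall y, regular Rp y -> f y = g y) -> f x = g x.
Proof.
move=> cf cg fg; have [b hb] := regular_near x.
have lim h : (forall v : vecR, {for 0, continuous (fun t : R => h (t *: v + x))}) ->
    (h (t *: b + x) @[t --> (0 : R)^'] --> (h x : V))%classic.
  move=> /(_ b); rewrite /prop_for/continuous_at scale0r add0r => ch.
  exact: cvg_trans (cvg_app _ (@nbhs_dnbhs _ 0)) ch.
have hf := lim f cf.
have hg : (f (t *: b + x) @[t --> (0 : R)^'] --> (g x : V))%classic.
  apply: cvg_trans (lim g cg); apply: near_eq_cvg.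
  by apply: filterS hb => t /fg.
exact: (cvg_unique (@norm_hausdorff _ _) hf hg).
Qed.

End RootSums.

Section PevalTheory.
Variables (R : realType) (m : nat).
Notation vecR := ('rV[R]_m).
Implicit Types (x v : vecR) (p q : {mpoly R[m]}).

Lemma cvg_bigsum (T I : Type) (F : set_system T) {FF : Filter F} (K : numFieldType)
  (W : normedModType K) (s : seq I) (f : I -> T -> W) (l : I -> W) :
  (forall i, f i x @[x --> F] --> l i)%classic ->
  (\sum_(i <- s) f i x @[x --> F] --> \sum_(i <- s) l i)%classic.
Proof.
move=> h; elim: s => [|i s IH].
  rewrite big_nil (_ : (fun _ => _) = cst 0); first exact: cvg_cst.
  by apply/funext => x; rewrite big_nil.
rewrite big_cons (_ : (fun _ => _) = fun x : T => f i x + \sum_(j <- s) f j x); first exact: cvgD.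
by apply/funext => x; rewrite big_cons.
Qed.

Lemma pevalD p q x : peval (p + q) x = peval p x + peval q x.
Proof. exact: mevalD. Qed.
Lemma pevalZ c p x : peval (c *: p) x = c * peval p x.
Proof. exact: mevalZ. Qed.
Lemma pevalM p q x : peval (p * q) x = peval p x * peval q x.
Proof. exact: mevalM. Qed.
Lemma peval1 x : peval 1 x = 1.
Proof. exact: meval1. Qed.
Lemma peval_sum (I : Type) (r : seq I) (P : pred I) (F : I -> {mpoly R[m]}) x :
  peval (\sum_(i <- r | P i) F i) x = \sum_(i <- r | P i) peval (F i) x.
Proof. by rewrite /peval raddf_sum. Qed.

Lemma peval_line_continuous p x v : {for 0, continuous (fun t : R => peval p (t *: v + x))}.
Proof.
have := @meval_continuous _ _ (fun i (t : R) => (t *: v + x) 0 i) p; apply => i t.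
rewrite (_ : (fun _ => _) = fun u : R => u * v 0 i + x 0 i); last by apply/funext => u; rewrite !mxE.
by apply: cvgD; [apply: cvgM; [exact: cvg_id|exact: cvg_cst] | exact: cvg_cst].
Qed.

Lemma peval_bounded p r x : 0 <= r -> dotR x x <= r ^+ 2 -> `|peval p x| <= (mabs p).@[fun=> r].
Proof.
move=> r0 xr; apply: linear_mdom_le (mdom_abs p) => //.
  by move=> c u v; rewrite mevalD mevalZ.
move=> k; rewrite mevalX normr_prod mdegE -prodrXr; apply: ler_prod => i _.
by rewrite normr_ge0 normrX lerXn2r ?nnegrE// coord_le.
Qed.

End PevalTheory.

(** * Recursion and bounds for the intertwining operator *)

Section Intertwiner.
Variables (R : realType) (m : nat).
Notation vecR := ('rV[R]_m).
Variables (Rs Rp : seq vecR) (kappa : vecR -> R).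
Hypotheses (HRs : root_system Rs) (HRp : positive_subsystem Rs Rp)
  (Hk : multiplicity Rs kappa).
Variable V : {mpoly R[m]} -> {mpoly R[m]}.
Hypothesis HV : intertwiner Rp kappa V.

Lemma VlinP c p q : V (c *: p + q) = c *: V p + V q.
Proof. by case: HV. Qed.
Lemma VD p q : V (p + q) = V p + V q.
Proof. by rewrite -[p]scale1r VlinP !scale1r. Qed.
Lemma V0 : V 0 = 0.
Proof. by apply: (@addrI _ (V 0)); rewrite -VD !addr0. Qed.
Lemma VZ c p : V (c *: p) = c *: V p.
Proof. by rewrite -[_ *: p]addr0 VlinP V0 addr0. Qed.
Lemma Vsum (I : Type) (r : seq I) (P : pred I) (F : I -> {mpoly R[m]}) :
  V (\sum_(i <- r | P i) F i) = \sum_(i <- r | P i) V (F i).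
Proof. exact: (big_morph V VD V0). Qed.
Lemma V1 : V 1 = 1.
Proof. by case: HV. Qed.

(** Contracting T_j V p = V d_j p with x_j turns alpha_j into <alpha, x>, which cancels the
    denominator of the Dunkl operator; what is left is continuous and extends to the hyperplanes. *)
Lemma intertwiner_rec p n x : p \is n.-homog ->
  n%:R * peval (V p) x + \sum_(a <- Rp) kappa a * (peval (V p) x - peval (V p) (refl a x))
  = \sum_j x 0 j * peval (V p^`M(j)) x.
Proof.
move=> ph; have Vh : V p \is n.-homog by case: HV => _ _ h _ _; exact: h.
pose lhs (x : vecR) := n%:R * peval (V p) x +
  \sum_(a <- Rp) kappa a * (peval (V p) x - peval (V p) (refl a x)).
pose rhs (x : vecR) := \sum_j x 0 j * peval (V p^`M(j)) x.
apply: (regular_density HRp (V := R^o) (f := lhs) (g := rhs)) => [v|v|y yr].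
- apply: cvgD; first by apply: cvgM; [exact: cvg_cst|exact: peval_line_continuous].
  apply: cvg_bigsum => a; apply: cvgM; first exact: cvg_cst.
  apply: cvgB; first exact: peval_line_continuous.
  rewrite refl_lin (_ : (fun _ => _) = fun t : R => peval (V p) (t *: refl a v + refl a x)).
    exact: peval_line_continuous.
  by apply/funext => t; rewrite refl_lin.
- apply: cvg_bigsum => j; apply: cvgM; last exact: peval_line_continuous.
  rewrite -pevalX (_ : (fun _ => _) = fun t : R => peval 'X_j (t *: v + x)).
    exact: peval_line_continuous.
  by apply/funext => t; rewrite pevalX.
rewrite /lhs /rhs.
have -> : n%:R * peval (V p) y = \sum_j y 0 j * peval (V p)^`M(j) y.
  rewrite -pevalZ -(euler_mpoly Vh) peval_sum; apply: eq_bigr => j _.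
  by rewrite pevalM pevalX.
case: HV => _ _ _ _ /(_ _ p y yr) Vd; under [RHS]eq_bigr do rewrite -Vd /dunkl derive_peval mulrDr.
rewrite [RHS]big_split/=; congr (_ + _).
under [RHS]eq_bigr do rewrite mulr_sumr.
rewrite exchange_big/=; apply: eq_big_seq => a aP.
rewrite -[LHS](mulfK (yr a aP)) mulrAC [_ * dotR a y]mulrC /dotR !mulr_suml.
by apply: eq_bigr => j _; rewrite -/(dotR a y); ring.
Qed.

Lemma intertwiner_max_principle p n r b : p \is n.-homog -> (0 < n)%N -> 0 <= r ->
  (forall x, dotR x x <= r ^+ 2 -> `|\sum_j x 0 j * peval (V p^`M(j)) x| <= n%:R * b) ->
  forall x, dotR x x <= r ^+ 2 -> `|peval (V p) x| <= b.
Proof.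
move=> ph n0 r0 hb.
apply: (max_principle HRs HRp Hk (n := n%:R) (M := (mabs (V p)).@[fun=> r])).
- by rewrite ltr0n.
- by move=> x xr; exact: peval_bounded.
- by move=> x xr; rewrite (intertwiner_rec x ph); exact: hb.
Qed.

(** Induction on the degree: the right-hand side of the recursion is at most sum_j r k_j r^(|k| - 1)
    = |k| r^|k|, and the maximum principle divides by |k|. *)
Lemma intertwiner_monom_le r k z : 0 <= r -> dotR z z <= r ^+ 2 -> `|peval (V 'X_[k]) z| <= r ^+ mdeg k.
Proof.
move=> r0; have [n] := ubnP (mdeg k); elim: n => // n IH in k z *; rewrite ltnS => kn zr.
have [k0|k0] := posnP (mdeg k).
  by move/eqP: k0; rewrite mdeg_eq0 => /eqP ->; rewrite mpolyX0 V1 peval1 mdeg0 normr1.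
apply: (intertwiner_max_principle (n := mdeg k)) zr => //; first by rewrite dhomogX/=.
move=> x xr; rewrite (le_trans (ler_norm_sum _ _ _))// [X in X%:R * _]mdegE natr_sum mulr_suml.
apply: ler_sum => j _; rewrite mderivX VZ pevalZ mulrCA normrM ger0_norm//.
have [->|kj] := posnP (k j); first by rewrite !mul0r.
rewrite ler_wpM2l// normrM -[in leRHS](prednK k0) exprS.
have dk : mdeg (k - U_(j))%MM = (mdeg k).-1.
  have /(congr1 mdeg) : (k = (k - U_(j)) + U_(j))%MM by rewrite submK// lep1mP -lt0n.
  by rewrite mdegD mdeg1 addn1 => ->.
apply: ler_pM; rewrite ?normr_ge0 ?coord_le//.
by rewrite -dk; apply: IH => //; rewrite dk prednK.
Qed.

End Intertwiner.

Lemma recursionB (T : Type) (R : comPzRingType) (s : seq T) (k f g : T -> R) (c u v : R) :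
  c * (u - v) + \sum_(a <- s) k a * (u - v - (f a - g a)) =
  (c * u + \sum_(a <- s) k a * (u - f a)) - (c * v + \sum_(a <- s) k a * (v - g a)).
Proof.
rewrite mulrBr opprD addrACA; congr (_ + _); rewrite -sumrB; apply: eq_bigr => a _.
by ring.
Qed.

(** Lets |x|^2 + 1 serve as a radius enclosing x, without a square root. *)
Lemma le_sqr_add1 (R : realType) (t : R) : 0 <= t -> t <= (t + 1) ^+ 2.
Proof. by move=> t0; nra. Qed.

(** * Homogeneous parts of the Dunkl kernel and their symmetry *)

Section DunklHomogeneous.
Variables (R : realType) (m : nat).
Notation vecR := ('rV[R]_m).

Definition lin (w : vecR) : {mpoly R[m]} := \sum_j w 0 j *: 'X_j.
Definition norm1 (w : vecR) : R := \sum_j `|w 0 j|.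

Lemma norm1_ge0 w : 0 <= norm1 w.
Proof. exact: sumr_ge0. Qed.

Lemma lin_linear (c : R) w w' : lin (c *: w + w') = c *: lin w + lin w'.
Proof.
rewrite scaler_sumr -big_split; apply: eq_bigr => j _.
by rewrite !mxE scalerDl scalerA.
Qed.

Lemma peval_lin w x : peval (lin w) x = dotR x w.
Proof. by rewrite peval_sum; apply: eq_bigr => j _; rewrite pevalZ pevalX mulrC. Qed.

Lemma lin_homog w n : lin w ^+ n \is n.-homog.
Proof.
have : lin w \is 1.-homog.
  by apply: rpred_sum => j _; rewrite rpredZ// dhomogX/= mdeg1.
by move=> /(dhomogMn n); rewrite mul1n.
Qed.

Lemma mderiv_lin w j : (lin w)^`M(j) = (w 0 j)%:MP.
Proof.
rewrite raddf_sum (bigD1 j)//= big1 => [|i ij].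
  rewrite mderivZ mderivX mnm1E eqxx scale1r -[X in (X - _)%MM]add0m addmK mpolyX0 addr0.
  by rewrite alg_mpolyC.
by rewrite mderivZ mderivX mnm1E (negPf ij) scale0r scaler0.
Qed.

Lemma mderiv_linX w n j : (lin w ^+ n)^`M(j) = (n%:R * w 0 j) *: lin w ^+ n.-1.
Proof.
elim: n => [|n IH]; first by rewrite expr0 mderivC mul0r scale0r.
rewrite exprS mderivM IH mderiv_lin mul_mpolyC -scalerAr.
case: n {IH} => [|n]; first by rewrite !mul0r scale0r addr0 mul1r.
rewrite /= -exprS -scalerDl; congr (_ *: _); rewrite -[n.+2]add1n natrD; ring.
Qed.

Definition labs (w : vecR) : {mpoly R[m]} := \sum_j `|w 0 j| *: 'X_j.

Lemma mdom_lin w : mdom (lin w) (labs w).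
Proof. by apply: mdom_sum => j; apply: mdomZ; exact: mdom_mon. Qed.

Lemma meval_labs w r : (labs w).@[fun=> r] = norm1 w * r.
Proof.
rewrite raddf_sum mulr_suml; apply: eq_bigr => j _.
by rewrite /= mevalZ mevalXU.
Qed.

Variables (Rs Rp : seq vecR) (kappa : vecR -> R).
Hypotheses (HRs : root_system Rs) (HRp : positive_subsystem Rs Rp)
  (Hk : multiplicity Rs kappa).
Variable V : {mpoly R[m]} -> {mpoly R[m]}.
Hypothesis HV : intertwiner Rp kappa V.

Lemma intertwiner_linX_le q w n (r : R) x : 0 <= r -> dotR x x <= r ^+ 2 ->
  `|peval (V (q * lin w ^+ n)) x| <= (mabs q).@[fun=> r] * (norm1 w * r) ^+ n.
Proof.
move=> r0 xr; rewrite -meval_labs -rmorphXn -mevalM.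
apply: (linear_mdom_le (L := fun p => peval (V p) x)) => // [c u v|k|].
- by rewrite (VlinP HV) pevalD pevalZ.
- exact: (intertwiner_monom_le HRs HRp Hk HV).
- by apply: mdomM; [exact: mdom_abs|apply: mdomX; exact: mdom_lin].
Qed.

(** This is n! times the part of E(x, w) of degree n in x. *)
Definition dunklH n x w : R := peval (V (lin w ^+ n)) x.

Lemma dunklH0 x w : dunklH 0 x w = 1.
Proof. by rewrite /dunklH expr0 (V1 HV) peval1. Qed.

Lemma dunklH_le n x w r : 0 <= r -> dotR x x <= r ^+ 2 -> `|dunklH n x w| <= (norm1 w * r) ^+ n.
Proof.
move=> r0 xr; have := intertwiner_linX_le 1 w n r0 xr; rewrite mul1r.
by rewrite /mabs msupp1 big_seq1 mcoeff1 eqxx normr1 scale1r mpolyX0 meval1 mul1r.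
Qed.

Lemma dunklH_rec n x w :
  n%:R * dunklH n x w + \sum_(a <- Rp) kappa a * (dunklH n x w - dunklH n (refl a x) w)
  = n%:R * dotR x w * dunklH n.-1 x w.
Proof.
have [h hE] : exists h : R, h = dunklH n.-1 x w by eexists.
rewrite (intertwiner_rec HRp HV x (lin_homog w n)) -hE /dotR mulr_sumr mulr_suml.
by apply: eq_bigr => j _; rewrite mderiv_linX (VZ HV) pevalZ -/(dunklH n.-1 x w) -hE; ring.
Qed.

(** The maximum principle with zero right-hand side. It asks for local boundedness only, so it
    applies to [dunklH] in either argument and to Taylor coefficients of [E] alike. *)
Lemma dunkl_homog_uniq (u : vecR -> R) n : (0 < n)%N ->
  (forall r, 0 <= r -> exists M : R, forall x, dotR x x <= r ^+ 2 -> `|u x| <= M) ->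
  (forall x, n%:R * u x + \sum_(a <- Rp) kappa a * (u x - u (refl a x)) = 0) ->
  forall x, u x = 0.
Proof.
move=> n0 bu eu x; pose r := dotR x x + 1.
have d0 := dotR_ge0 x; have r0 : 0 <= r by rewrite addr_ge0.
have [M HM] := bu _ r0; apply/eqP; rewrite -normr_le0.
apply: (max_principle HRs HRp Hk (n := n%:R) (M := M) (r := r ^+ 2)) => //.
- by rewrite ltr0n.
- by move=> y _; rewrite eu normr0 mulr0.
- exact: le_sqr_add1.
Qed.

(** As functions of x both sides obey the same recursion, since the reflection permutes the sum over
    positive roots and [kappa] is invariant. This is the step that makes symmetry accessible. *)
Lemma dunklH_refl n b x w : b \in Rs -> dunklH n (refl b x) (refl b w) = dunklH n x w.
Proof.
move=> bR; have b0 := root_neq0 HRs bR; elim: n => [|n IH] in x *; first by rewrite !dunklH0.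
apply/eqP; rewrite -subr_eq0; apply/eqP; move: x.
apply: (dunkl_homog_uniq (n := n.+1)) => // [r r0|x].
  exists ((norm1 (refl b w) * r) ^+ n.+1 + (norm1 w * r) ^+ n.+1) => x xr.
  rewrite (le_trans (ler_normB _ _))// lerD//; apply: dunklH_le => //.
  by rewrite refl_dot.
have h1 := dunklH_rec n.+1 (refl b x) (refl b w); have h2 := dunklH_rec n.+1 x w.
move: h1; rewrite IH refl_dot// -h2.
have -> : \sum_(a <- Rp) kappa a * (dunklH n.+1 (refl b x) (refl b w)
       - dunklH n.+1 (refl a (refl b x)) (refl b w)) =
   \sum_(a <- Rp) kappa a * (dunklH n.+1 (refl b x) (refl b w)
       - dunklH n.+1 (refl b (refl a x)) (refl b w)).
  rewrite -(sum_pos_refl HRs HRp bR).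
    apply: eq_big_seq => a /(pos_root HRp) aR.
    by rewrite -refl_conj//; case: Hk => _ ->.
  by move=> a aR; rewrite (multN HRs Hk)// refl_opp.
move=> /eqP; rewrite -subr_eq0 => /eqP hz; rewrite -[RHS]hz.
exact: recursionB.
Qed.

(** The recursion for [dunklH n x w] reflects x. By [dunklH_refl] the reflections move over to w, in
    which [dunklH n w x] obeys the same recursion; the right-hand sides agree by induction on n. *)
Lemma dunklH_sym n x w : dunklH n x w = dunklH n w x.
Proof.
elim: n => [|n IH] in x w *; first by rewrite !dunklH0.
apply/eqP; rewrite -subr_eq0; apply/eqP; move: w.
apply: (dunkl_homog_uniq (n := n.+1)) => // [r r0|w].
  have d0 := dotR_ge0 x.
  pose s := dotR x x + 1; have s0 : 0 <= s by rewrite addr_ge0.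
  have xs : dotR x x <= s ^+ 2 by exact: le_sqr_add1.
  exists ((m%:R * r * s) ^+ n.+1 + (norm1 x * r) ^+ n.+1) => w wr.
  rewrite (le_trans (ler_normB _ _))// lerD//; last exact: dunklH_le.
  rewrite (le_trans (dunklH_le _ _ s0 xs))// lerXn2r ?nnegrE ?mulr_ge0 ?norm1_ge0//.
  rewrite ler_wpM2r// /norm1 -[m in leRHS]card_ord -sum1_card natr_sum mulr_suml.
  by apply: ler_sum => j _; rewrite mul1r coord_le.
have h1 := dunklH_rec n.+1 w x; have := dunklH_rec n.+1 x w.
rewrite (dotRC x) IH -h1.
have -> : \sum_(a <- Rp) kappa a * (dunklH n.+1 x w - dunklH n.+1 (refl a x) w)
   = \sum_(a <- Rp) kappa a * (dunklH n.+1 x w - dunklH n.+1 x (refl a w)).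
  apply: eq_big_seq => a /(pos_root HRp) aR.
  by rewrite -[in LHS](dunklH_refl _ (refl a x) w aR) reflK// (root_neq0 HRs aR).
move=> /eqP; rewrite -subr_eq0 => /eqP hz; rewrite -[RHS]hz.
exact: recursionB.
Qed.

End DunklHomogeneous.

(** * Power series of the Dunkl kernel *)

Section EulerCoefficients.
Variable R : realType.
Local Notation C := R[i].

Lemma mcoef_mulid (f : C -> C) n : mcoef (fun z => z * f z) n.+1 = mcoef f n.
Proof.
rewrite /mcoef; congr (_ * _); apply: eq_cmean => t.
by rewrite exprS invfM mulrACA divff ?mul1r// cexp_neq0.
Qed.

Lemma mcoef_dilate (f : C -> C) (r : R) n : (forall z, cdiff f z) -> 0 < r ->
  mcoef (fun z => f (r%:C * z)) n = r%:C ^+ n * mcoef f n.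
Proof.
move=> fd r0; rewrite [in RHS](mcoef_any n (ln r))// [RHS]mulrCA -cmeanZ; last first.
  by move=> z; exact/cdiff_ccont/mcoef_cdiff.
rewrite /mcoef; congr (_ * _).
have E (t : R) : f (r%:C * cexp (0 +i* t)) * cexp (0 +i* t) ^- n =
    r%:C ^+ n * (f (cexp (ln r +i* t)) * cexp (ln r +i* t) ^- n).
  have -> : cexp (ln r +i* t) = r%:C * cexp (0 +i* t).
    have -> : ln r +i* t = (ln r)%:C + (0 +i* t) by apply: complex_eqP; rewrite /= ?addr0 ?add0r.
    rewrite cexpD; congr (_ * _); apply: complex_eqP; rewrite /= ?sin0 ?cos0 ?mulr0 ?mulr1//.
    by rewrite lnK.
  rewrite exprMn invfM mulrCA; congr (_ * _); rewrite mulVKf// expf_neq0//.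
  by rewrite gt_eqF ?ltcR.
by rewrite /cmean; congr (_ +i* _); congr itg; apply/funext => t; rewrite E.
Qed.

Lemma cderiv_mcoef1 (g : C -> C) : (forall z, cdiff g z) -> cderiv g 0 (mcoef g 1).
Proof.
move=> gd e e0; have [M HM] := entire_bounded 1 gd.
have M0 : 0 <= M by apply: le_trans (HM 0 _); rewrite ?cabs_ge0// cabs0.
have d0 : 0 < e / (8 * M + 1) by rewrite divr_gt0// ltr_wpDl// mulr_ge0.
exists (Num.min (1 / 2) (e / (8 * M + 1))); first by rewrite lt_min d0 divr_gt0.
move=> h; rewrite le_min => /andP[h1 h2]; rewrite add0r.
apply: le_trans (entire_quad gd ltr01 HM h1) _.
rewrite expr1n divr1 expr2 mulrA ler_wpM2r ?cabs_ge0//.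
move: h2; rewrite ler_pdivlMr ?ltr_wpDl ?mulr_ge0// => h2.
by rewrite mulrC (le_trans _ h2)// ler_wpM2l ?cabs_ge0// lerDl.
Qed.

Lemma expr1D_taylor n : exists2 K : R, 0 <= K & forall h : R, 0 <= h <= 1 ->
  `|(1 + h) ^+ n - 1 - n%:R * h| <= K * h ^+ 2.
Proof.
elim: n => [|n [K K0 IH]].
  by exists 0 => // h _; rewrite expr0 subrr mul0r subrr normr0 mul0r.
have n0 : 0 <= n%:R :> R by [].
exists (2 * K + n%:R) => [|h /andP[h0 h1]]; first by rewrite addr_ge0 ?mulr_ge0.
have := IH h; rewrite h0 h1 => /(_ isT); set q := (1 + h) ^+ n => H.
have -> : (1 + h) ^+ n.+1 - 1 - n.+1%:R * h = (1 + h) * (q - 1 - n%:R * h) + n%:R * h ^+ 2.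
  by rewrite exprS -/q -natr1; ring.
rewrite (le_trans (ler_normD _ _))// [leRHS]mulrDl lerD//; last first.
  by rewrite ger0_norm// mulr_ge0// sqr_ge0.
rewrite normrM ger0_norm ?addr_ge0// -mulrA ler_pM ?addr_ge0//.
by rewrite -natr1 addrC lerD2r.
Qed.

(* Dilation by 1 + h multiplies the n-th coefficient by (1 + h)^n; compare first-order terms. *)
Lemma mcoef_euler (g A : C -> C) n : (forall z, cdiff g z) -> (forall z, cdiff A z) ->
  (forall z, cabs z = 1 -> exists2 l, cderiv g z l & z * l = A z) ->
  n%:R * mcoef g n = mcoef A n.
Proof.
(* Expansions of radius 2 are taken at points of the unit circle, whence the radius 3. *)
move=> gd Ad gA; have [M HM] := entire_bounded 3 gd.
have M0 : 0 <= M by apply: le_trans (HM 0 _); rewrite ?cabs_ge0// cabs0.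
have [K K0 HK] := expr1D_taylor n.
(* The first term is the bound [F1], doubled by [mcoef_le]; the second comes from expanding (1 +
   h)^n. *)
pose B : R := 4 * M + K * cabs (mcoef g n).
have B0 : 0 <= B by rewrite addr_ge0// mulr_ge0// cabs_ge0.
suff key (h : R) : 0 < h -> h <= 1 -> cabs (n%:R * mcoef g n - mcoef A n) <= B * h.
  apply/eqP; rewrite -subr_eq0; apply/eqP/cabs_le_all => e e0.
  have h0 : 0 < e / (B + 1) by rewrite divr_gt0// ltr_wpDl.
  apply: le_trans (key (Num.min 1 (e / (B + 1))) _ _) _; rewrite ?lt_min ?ltr01 ?h0 ?ge_min ?lexx//.
  have : Num.min 1 (e / (B + 1)) <= e / (B + 1) by rewrite ge_min lexx orbT.
  rewrite ler_pdivlMr ?ltr_wpDl// => h3; apply: le_trans h3.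
  by rewrite mulrC ler_wpM2l ?lerDl// le_min ler01 ltW.
move=> h0 h1.
have h1C : 0 < 1 + h :> R by rewrite addr_gt0.
have hC : cabs h%:C = h by rewrite cabs_real ger0_norm// ltW.
pose F z := g ((1 + h)%:C * z) - g z - h%:C * A z.
have gdil z : cdiff (fun z => g ((1 + h)%:C * z)) z.
  have [k gk] := gd ((1 + h)%:C * z); exists (k * (1 + h)%:C).
  apply: cderiv_comp gk; have /cderivZ : cderiv id z 1.
    by move=> e e0; exists 1 => // u _; rewrite mul1r /= [z + u]addrC addrK subrr cabs0 mulr_ge0 ?cabs_ge0// ltW.
  by move=> /(_ (1 + h)%:C); rewrite mulr1.
have Fd z : cdiff F z.
  apply: cdiffB; last by apply: cdiffM => //; exact: cdiff_cst.
  exact: cdiffB.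
have F1 z : cabs z = 1 -> cabs (F z) <= 2 * M * h ^+ 2.
  move=> z1; have [l gl lA] := gA z z1.
  have gsd u : cdiff (fun u => g (z + u)) u by exact: cdiff_shift.
  have HMz u : cabs u <= 2 -> cabs (g (z + u)) <= M.
    move=> u2; apply: HM; rewrite (le_trans (ler_cabsD _ _))// z1.
    by rewrite [3](_ : _ = 1 + 2) ?lerD2l//; ring.
  have lE : mcoef (fun u => g (z + u)) 1 = l.
    apply: (cderiv_uniq (cderiv_mcoef1 gsd)) => e /gl[d d0 Hd]; exists d => // u /Hd.
    by rewrite add0r addr0.
  have hz : cabs (h%:C * z) <= 2 / 2 by rewrite cabsM z1 hC mulr1 divff.
  have := entire_quad gsd (ltr0Sn R 1) HMz hz.
  rewrite lE addr0 cabsM z1 mulr1 hC.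
  have -> : 8 * M / 2 ^+ 2 = 2 * M by field.
  apply: le_trans; rewrite le_eqVlt /F -lA; apply/orP; left; apply/eqP; congr cabs.
  by rewrite rmorphD rmorph1 mulrDl mul1r; ring.
have := mcoef_le n Fd ltr01 F1; rewrite expr1n divr1.
rewrite mcoefB ?mcoefB ?mcoefZ ?mcoef_dilate//; last first.
- by move=> z; apply: cdiffM => //; exact: cdiff_cst.
- by move=> z; exact: cdiffB.
move=> H.
have H2 := HK h; rewrite (ltW h0) h1 in H2; move: H2 => /(_ isT) H2.
rewrite -(ler_pM2r h0) -{1}hC -cabsM.
have -> : (n%:R * mcoef g n - mcoef A n) * h%:C =
  ((1 + h)%:C ^+ n * mcoef g n - mcoef g n - h%:C * mcoef A n)
  - ((1 + h) ^+ n - 1 - n%:R * h)%:C * mcoef g n.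
  by rewrite !rmorphB rmorphM rmorphXn rmorph1 rmorph_nat; ring.
rewrite (le_trans (ler_cabsB _ _))// -mulrA -expr2 mulrDl lerD//.
  by rewrite (le_trans H)// mulrA; apply: ler_wpM2r; rewrite ?sqr_ge0//; lra.
by rewrite cabsM cabs_real mulrAC ler_wpM2r// cabs_ge0.
Qed.

End EulerCoefficients.

(** * The Dunkl kernel along complex lines *)

Section DunklKernelSeries.
Variables (R : realType) (m : nat).
Notation vecR := ('rV[R]_m).
Notation vecC := ('rV[(R[i])^o]_m).
Local Notation C := R[i].
Variables (Rs Rp : seq vecR) (kappa : vecR -> R).
Hypotheses (HRs : root_system Rs) (HRp : positive_subsystem Rs Rp)
  (Hk : multiplicity Rs kappa).
Variable E : vecC -> vecC -> C.
Hypothesis HE : dunkl_kernel Rp kappa E.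

Lemma setc_line j (x : vecC) (t : C) : setc x j (x 0 j + t) = (t : C) *: eC R j + x.
Proof.
apply/rowP => k; rewrite !mxE; case: eqP => [->|_]; first by rewrite addrC mulr1.
by rewrite mulr0 add0r.
Qed.

Lemma kernel_sep_entire w : sep_entire (fun x => E x w).
Proof.
case: HE => Ed _ _ x j t; have /derivable_cderiv H := Ed w (setc x j t) j.
exists ('D_(eC R j) (fun x : vecC => (E x w : C^o)) (setc x j t)) => e /H[d d0 Hd].
exists d => // h /Hd; rewrite add0r scale0r add0r -setc_line setc_setc.
by rewrite !mxE eqxx.
Qed.

Lemma kernel_cpartial w p j :
  'D_(eC R j) (fun x : vecC => (E x w : C^o)) p = cpartial (fun x => E x w) p j.
Proof.
case: HE => Ed _ _; have H := derivable_cderiv (Ed w p j).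
apply: (cderiv_uniq H) => e /(cderiv_cpartial (kernel_sep_entire w) p j)[d d0 Hd].
by exists d => // h /Hd; rewrite !setc_line.
Qed.

Definition kline (w : vecC) (x : vecR) (s : C) : C := E ((s : C) *: toC x) w.

Lemma dotC_toC (x y : vecR) : dotC (toC x) (toC y) = (dotR x y)%:C.
Proof. by rewrite rmorph_sum; apply: eq_bigr => j _; rewrite !mxE rmorphM. Qed.

Lemma reflC_line (a : vecR) (s : C) (x : vecR) : reflC a (s *: toC x) = s *: toC (refl a x).
Proof.
apply/rowP => j; rewrite !mxE.
have -> : dotC (s *: toC x) (toC a) = s * (dotR x a)%:C.
  by rewrite -dotC_toC mulr_sumr; apply: eq_bigr => i _; rewrite !mxE mulrA.
rewrite rmorphB/= !rmorphM/= fmorphV rmorph_nat.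
rewrite /GRing.scale/=; ring.
Qed.

Lemma kline_cderiv w (x : vecR) s :
  cderiv (kline w x) s (\sum_j toC x 0 j * cpartial (fun x => E x w) (s *: toC x) j).
Proof.
have H := sep_entire_cderiv (kernel_sep_entire w) (s *: toC x) (toC x).
by move=> e /H[d d0 Hd]; exists d => // h /Hd; rewrite /kline add0r scale0r add0r [s + h]addrC scalerDl.
Qed.

Lemma kline_cdiff w (x : vecR) s : cdiff (kline w x) s.
Proof. by eexists; exact: kline_cderiv. Qed.

(** T_j E = w_j E contracted with x_j at the point s x. That point is regular only for s != 0, which
    suffices since [mcoef_euler] consults |s| = 1 alone. *)
Lemma kline_ode w (x : vecR) (s : C) : regular Rp x -> s != 0 ->
  s * (\sum_j toC x 0 j * cpartial (fun x => E x w) (s *: toC x) j) =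
  s * dotC (toC x) w * kline w x s -
  \sum_(a <- Rp) (kappa a)%:C * (kline w x s - kline w (refl a x) s).
Proof.
move=> xr s0; set p := s *: toC x.
have pr : regularC Rp p.
  move=> a aR; rewrite (_ : dotC _ _ = s * (dotR a x)%:C).
    by rewrite mulf_neq0// fmorph_eq0 xr.
  by rewrite -dotC_toC mulr_sumr; apply: eq_bigr => i _; rewrite !mxE; rewrite /GRing.scale/=; ring.
case: HE => _ Ee _.
have e1 j : cpartial (fun x => E x w) p j = w 0 j * kline w x s -
    \sum_(a <- Rp) ((kappa a * a 0 j)%:C * (kline w x s - kline w (refl a x) s) / dotC (toC a) p).
  rewrite -(Ee w p j pr) /dunklC kernel_cpartial -addrA -sumrB big1 ?addr0// => a _.
  by rewrite /kline reflC_line subrr.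
under eq_bigr do rewrite e1 mulrBr.
rewrite sumrB mulrBr; congr (_ - _).
  rewrite -mulrA; congr (_ * _); rewrite [RHS]mulr_suml; apply: eq_bigr => j _.
  by rewrite mulrA.
under eq_bigr do rewrite mulr_sumr.
rewrite exchange_big mulr_sumr; apply: eq_big_seq => a aR /=.
have ap := pr a aR.
have -> : \sum_j toC x 0 j * ((kappa a * a 0 j)%:C * (kline w x s - kline w (refl a x) s) / dotC (toC a) p)
   = (\sum_j s * toC x 0 j * (a 0 j)%:C) * (kappa a)%:C * (kline w x s - kline w (refl a x) s) / dotC (toC a) p / s.
  rewrite !mulr_suml; apply: eq_bigr => j _; rewrite rmorphM /=; field.
  by rewrite s0 ap.
rewrite (_ : \sum_j _ = dotC (toC a) p).
  by field; rewrite s0 ap.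
by apply: eq_bigr => j _; rewrite !mxE mulrC.
Qed.

Lemma ode_coef (l : seq vecR) (c : C) (F : C -> C) (G : vecR -> C -> C) n :
  (forall s, cdiff F s) -> (forall a s, cdiff (G a) s) ->
  let A := fun s => s * (c * F s) - \sum_(a <- l) (kappa a)%:C * (F s - G a s) in
  (forall s, cdiff A s) /\ mcoef A n.+1 =
    c * mcoef F n - \sum_(a <- l) (kappa a)%:C * (mcoef F n.+1 - mcoef (G a) n.+1).
Proof.
move=> Fd Gd /=; have cFd s : cdiff (fun s => c * F s) s by apply: cdiffM => //; exact: cdiff_cst.
elim: l => [|a l [IHd IHc]].
  have E0 : (fun s => s * (c * F s) - \sum_(a <- [::]) (kappa a)%:C * (F s - G a s))
      = fun s => s * (c * F s) by apply/funext => u; rewrite big_nil subr0.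
  rewrite E0 big_nil subr0; split=> [s|].
    by apply: cdiffM => //; exact: cdiff_id.
  by rewrite (mcoef_mulid (fun s => c * F s)) mcoefZ.
have FGd s : cdiff (fun s => F s - G a s) s by exact: cdiffB.
have kFGd s : cdiff (fun s => (kappa a)%:C * (F s - G a s)) s by apply: cdiffM => //; exact: cdiff_cst.
have -> : (fun s => s * (c * F s) - \sum_(a <- a :: l) (kappa a)%:C * (F s - G a s))
  = fun s => s * (c * F s) - \sum_(a <- l) (kappa a)%:C * (F s - G a s)
     - (kappa a)%:C * (F s - G a s).
  by apply/funext => u; rewrite big_cons opprD addrCA addrC.
split=> [s|]; first exact: cdiffB.
by rewrite mcoefB// IHc mcoefZ// mcoefB// big_cons opprD [RHS]addrCA [RHS]addrC.
Qed.

Variable w : vecR.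
Let f := kline (toC w).

Lemma kline_coef_rec n x : regular Rp x ->
  n.+1%:R * mcoef (f x) n.+1 = (dotR x w)%:C * mcoef (f x) n -
    \sum_(a <- Rp) (kappa a)%:C * (mcoef (f x) n.+1 - mcoef (f (refl a x)) n.+1).
Proof.
move=> xr; have fd x' s : cdiff (f x') s by exact: kline_cdiff.
have [Ad <-] := ode_coef Rp (dotR x w)%:C n (fd x) (fun a s => fd (refl a x) s).
apply: mcoef_euler => // z z1; eexists; first exact: kline_cderiv.
rewrite kline_ode//; first by rewrite dotC_toC mulrA.
by apply/eqP => z0; move: z1; rewrite z0 cabs0 => /eqP; rewrite eq_sym oner_eq0.
Qed.

Lemma cabs_line (s : C) (x : vecR) i : cabs s = 1 -> cabs ((s *: toC x) 0 i) = `|x 0 i|.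
Proof. by move=> s1; rewrite !mxE cabsM s1 mul1r cabs_real. Qed.

Lemma kline_coef_lip n (r : R) : 0 <= r -> exists2 L : R, 0 <= L & forall x y : vecR,
  (forall i, `|x 0 i| <= r) -> (forall i, `|y 0 i| <= r) ->
  cabs (mcoef (f y) n - mcoef (f x) n) <= L * \sum_i `|y 0 i - x 0 i|.
Proof.
move=> r0; have [L L0 HL] := sep_entire_lip (kernel_sep_entire (toC w)) r0.
exists (2 * L) => [|x y xr yr]; first by rewrite mulr_ge0.
have fd x' s : cdiff (f x') s by exact: kline_cdiff.
rewrite -mcoefB//.
have B z : cabs z = 1 -> cabs (f y z - f x z) <= L * \sum_i `|y 0 i - x 0 i|.
  move=> z1; apply: le_trans (HL (z *: toC x) (z *: toC y) _ _) _.
  - by move=> i; rewrite cabs_line.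
  - by move=> i; rewrite cabs_line.
  rewrite ler_wpM2l//; apply: ler_sum => i _.
  by rewrite !mxE -mulrBr cabsM z1 mul1r -rmorphB cabs_real.
have := mcoef_le n _ ltr01 B; rewrite expr1n divr1 mulrA; apply => z; exact: cdiffB.
Qed.

Lemma kline_coef_bounded n (r : R) : 0 <= r -> exists M : R, forall x : vecR,
  dotR x x <= r ^+ 2 -> cabs (mcoef (f x) n) <= M.
Proof.
move=> r0; have [M HM] := sep_entire_bounded (kernel_sep_entire (toC w)) r.
exists (2 * M / 1 ^+ n) => x xr; apply: mcoef_le => // [z|z z1]; first exact: kline_cdiff.
by apply: HM => i; rewrite cabs_line// coord_le.
Qed.

(** * Real and imaginary parts of the Taylor coefficients *)

Section Part.
Variable phi : C -> R.
Hypothesis phi_lin : forall (a : R) u v, phi (a%:C * u + v) = a * phi u + phi v.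
Hypothesis phi_le : forall u, `|phi u| <= cabs u.

Let phi0 : phi 0 = 0.
Proof. by apply/eqP; rewrite -normr_le0 (le_trans (phi_le 0))// cabs0. Qed.
Let phiD u v : phi (u + v) = phi u + phi v.
Proof. by have := phi_lin 1 u v; rewrite !mul1r. Qed.
Let phiZ (a : R) u : phi (a%:C * u) = a * phi u.
Proof. by have := phi_lin a u 0; rewrite !addr0 phi0 addr0. Qed.
Let phiB u v : phi (u - v) = phi u - phi v.
Proof.
by rewrite phiD -mulN1r; congr (_ + _); have := phiZ (-1) v; rewrite rmorphN1 !mulN1r.
Qed.

(** The functional phi will be the real or the imaginary part: the maximum principle compares real
    functions. *)
Let u n x := phi (mcoef (f x) n).

Lemma part_coef_continuous n (x v : vecR) : {for 0, continuous (fun t : R => u n (t *: v + x))}.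
Proof.
pose r : R := norm1 v + norm1 x; have r0 : 0 <= r by rewrite addr_ge0// norm1_ge0.
have cr (t : R) i : `|t| <= 1 -> `|(t *: v + x) 0 i| <= r.
  move=> t1; rewrite !mxE (le_trans (ler_normD _ _))// lerD//.
    rewrite normrM (@le_trans _ _ `|v 0 i|)//; first by rewrite ler_piMl.
    by rewrite /norm1 (bigD1 i)//= lerDl sumr_ge0.
  by rewrite /norm1 (bigD1 i)//= lerDl sumr_ge0.
have [L L0 HL] := kline_coef_lip n r0.
have B (t : R) : `|t| <= 1 -> `|u n (t *: v + x) - u n x| <= L * norm1 v * `|t|.
  move=> t1; rewrite -phiB (le_trans (phi_le _))//.
  apply: le_trans (HL x (t *: v + x) _ _) _.
  - by move=> i; have := cr 0 i; rewrite scale0r add0r normr0 ler01; apply.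
  - by move=> i; exact: cr.
  rewrite -mulrA ler_wpM2l// /norm1 mulr_suml; apply: ler_sum => i _.
  by rewrite !mxE addrK normrM mulrC.
rewrite /prop_for/continuous_at scale0r add0r; apply/cvgrPdist_le => e e0.
have K0 : 0 <= L * norm1 v by rewrite mulr_ge0// norm1_ge0.
have d0 : 0 < Num.min 1 (e / (L * norm1 v + 1)) by rewrite lt_min ltr01 divr_gt0// ltr_wpDl.
apply/nbhs_ballP; exists (Num.min 1 (e / (L * norm1 v + 1))) => //= t.
rewrite /ball/= sub0r normrN lt_min => /andP[/ltW t1 /ltW t2].
rewrite distrC (le_trans (B t t1))//.
move: t2; rewrite ler_pdivlMr ?ltr_wpDl// => t2.
by apply: le_trans t2; rewrite mulrC ler_wpM2l// lerDl.
Qed.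

Lemma part_coef_rec n x :
  n.+1%:R * u n.+1 x + \sum_(a <- Rp) kappa a * (u n.+1 x - u n.+1 (refl a x)) =
  dotR x w * u n x.
Proof.
pose lhs (x : vecR) := n.+1%:R * u n.+1 x +
  \sum_(a <- Rp) kappa a * (u n.+1 x - u n.+1 (refl a x)).
apply: (regular_density HRp (V := R^o) (f := lhs) (g := fun x => dotR x w * u n x)) => [v|v|y yr].
- apply: cvgD; first by apply: cvgM; [exact: cvg_cst|exact: part_coef_continuous].
  apply: cvg_bigsum => a; apply: cvgM; first exact: cvg_cst.
  apply: cvgB; first exact: part_coef_continuous.
  rewrite refl_lin (_ : (fun _ => _) = fun t : R => u n.+1 (t *: refl a v + refl a x)).
    exact: part_coef_continuous.
  by apply/funext => t; rewrite refl_lin.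
- apply: cvgM; last exact: part_coef_continuous.
  rewrite -peval_lin (_ : (fun _ => _) = fun t : R => peval (lin w) (t *: v + x)).
    exact: peval_line_continuous.
  by apply/funext => t; rewrite peval_lin.
have := congr1 phi (kline_coef_rec n yr); rewrite phiB phiZ -[n.+1%:R * _]/(_).
rewrite -(rmorph_nat (real_complex R)) phiZ (big_morph phi phiD phi0) => h.
rewrite /lhs /u h; apply/eqP; rewrite eq_sym -subr_eq; apply/eqP; congr (_ - _).
by apply: eq_bigr => a _; rewrite phiZ phiB.
Qed.

Variable V : {mpoly R[m]} -> {mpoly R[m]}.
Hypothesis HV : intertwiner Rp kappa V.

(** Both sides satisfy the recursion of [part_coef_rec], so [dunkl_homog_uniq] identifies them by
    induction. The factor phi 1 comes from degree 0, where E 0 w = 1. *)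
Lemma part_coef_eq n x : u n x = phi 1 * dunklH V n x w / n`!%:R.
Proof.
elim: n => [|n IH] in x *.
  rewrite /u mcoef0; last exact: kline_cdiff.
  case: HE => _ _ E0; rewrite /f /kline scale0r E0 (dunklH0 HV); by rewrite fact0 mulr1 divr1.
apply/eqP; rewrite -subr_eq0; apply/eqP; move: x.
apply: (dunkl_homog_uniq HRs HRp Hk (n := n.+1)) => // [r r0|x].
  have [M HM] := kline_coef_bounded n.+1 r0.
  exists (M + `|phi 1| * (norm1 w * r) ^+ n.+1 / n.+1`!%:R) => x xr.
  rewrite (le_trans (ler_normB _ _))// lerD//; first by rewrite (le_trans (phi_le _))// HM.
  rewrite !normrM [`|n.+1`!%:R^-1|]ger0_norm ?invr_ge0// ler_wpM2r ?invr_ge0// ler_wpM2l//.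
  exact: (dunklH_le HRs HRp Hk HV).
rewrite recursionB part_coef_rec IH.
pose q : R := phi 1 / n.+1`!%:R.
have qE y : phi 1 * dunklH V n.+1 y w / n.+1`!%:R = q * dunklH V n.+1 y w by rewrite /q; ring.
under eq_bigr do rewrite !qE -mulrBr mulrCA.
rewrite qE -mulr_sumr [n.+1%:R * (q * _)]mulrCA -mulrDr (dunklH_rec HRp HV) /q /= factS natrM.
have n1 : n.+1%:R != 0 :> R by [].
have n2 : n`!%:R != 0 :> R by rewrite pnatr_eq0 -lt0n fact_gt0.
have F (a b d c h : R) : a != 0 -> b != 0 -> d * (c * h / b) - c / (a * b) * (a * d * h) = 0.
  by move=> a0 b0; field; rewrite a0 b0.
exact: F.
Qed.
End Part.

Variable V : {mpoly R[m]} -> {mpoly R[m]}.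
Hypothesis HV : intertwiner Rp kappa V.

Lemma kline_coef n x : mcoef (f x) n = (dunklH V n x w / n`!%:R)%:C.
Proof.
have rR (a : R) u v : complex.Re (a%:C * u + v) = a * complex.Re u + complex.Re v.
  by rewrite ReD ReM /= mul0r subr0.
have rI (a : R) u v : complex.Im (a%:C * u + v) = a * complex.Im u + complex.Im v.
  by rewrite ImD ImM /= mul0r addr0.
apply: complex_eqP.
  by rewrite (part_coef_eq rR (@ler_Re_cabs R) HV) /= mul1r.
by rewrite (part_coef_eq rI (@ler_Im_cabs R) HV) /= !mul0r.
Qed.

Lemma kernel_series x (s : C) (e : R) : 0 < e -> exists N0, forall N, (N0 <= N)%N ->
  cabs (E (s *: toC x) (toC w) - \sum_(n < N) (dunklH V n x w / n`!%:R)%:C * s ^+ n) <= e.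
Proof.
move=> e0; have fd s' : cdiff (f x) s' by exact: kline_cdiff.
pose r : R := cabs s + 1; have r0 : 0 < r by rewrite ltr_wpDl ?cabs_ge0.
have [M HM] := entire_bounded r fd.
have sr : cabs s < r by rewrite ltrDl.
pose q : R := cabs s / r.
have q1 : `|q| < 1 by rewrite ger0_norm ?divr_ge0 ?cabs_ge0 ?(ltW r0)// ltr_pdivrMr// mul1r.
pose K : R := 4 * M * (r / (r - cabs s)).
have : (K * q ^+ N @[N --> \oo] --> K * 0)%classic.
  by apply: cvgM; [exact: cvg_cst|exact: cvg_expr].
(* The successor excludes N = 0, for which [taylor_rem] has an extra term. *)
rewrite mulr0 => /cvgrPdist_le /(_ e e0) [N0 _ HN]; exists N0.+1 => N NN.
have := taylor_rem N fd r0 HM sr; under eq_bigr do rewrite kline_coef.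
move=> /le_trans; apply.
have -> : (N == 0)%N = false by apply/eqP => N0'; move: NN; rewrite N0'.
rewrite mulr0 addr0; have := HN N (ltnW NN); rewrite sub0r normrN.
by apply: le_trans; rewrite (le_trans _ (ler_norm _))// /K mulrAC.
Qed.

End DunklKernelSeries.

(** * The heat semigroup applied to the kernel *)

Section ExponentialSeries.
Variable R : realType.
Implicit Types (u : nat -> R) (x K : R).

Lemma exp_partial_le x N : 0 <= x -> \sum_(n < N) x ^+ n / n`!%:R <= expR x.
Proof.
move=> x0; rewrite -(big_mkord xpredT (fun n => x ^+ n / n`!%:R)).
have -> : \sum_(0 <= n < N) x ^+ n / n`!%:R = series (exp_coeff x) N.
  by apply: eq_bigr => n _; rewrite exp_coeffE mulrC.
apply: nondecreasing_cvgn_le; last exact: is_cvg_series_exp_coeff.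
by apply/nondecreasing_seqP => n; rewrite seriesSr lerDl exp_coeff_ge0.
Qed.

Lemma exp_series_partial_le u K x N : 0 <= x -> (forall n, `|u n| <= K * (x ^+ n / n`!%:R)) ->
  `|series u N| <= K * expR x.
Proof.
move=> x0 uK; rewrite seriesEord (le_trans (ler_norm_sum _ _ _))//.
have K0 : 0 <= K by have := le_trans (normr_ge0 _) (uK 0%N); rewrite expr0 fact0 divr1 mulr1.
rewrite (@le_trans _ _ (K * \sum_(n < N) x ^+ n / n`!%:R))//.
  by rewrite mulr_sumr; apply: ler_sum.
by rewrite ler_wpM2l// exp_partial_le.
Qed.

Lemma exp_series_cvg u K x : 0 <= x -> (forall n, `|u n| <= K * (x ^+ n / n`!%:R)) ->
  cvgn (series u).
Proof.
move=> x0 uK; apply: (@normed_cvg R R^o u).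
have K0 : 0 <= K by have := le_trans (normr_ge0 _) (uK 0%N); rewrite expr0 fact0 divr1 mulr1.
apply: (series_le_cvg (v_ := K *: exp_coeff x)) => [n|n|n|].
- exact: normr_ge0.
- by apply: mulr_ge0 => //; exact: exp_coeff_ge0.
- have -> : (K *: exp_coeff x) n = K * (x ^+ n / n`!%:R) by rewrite exp_coeffE mulrC [in RHS]mulrC [x ^+ n / _]mulrC.
  exact: uK.
- by apply: is_cvg_seriesZ; exact: is_cvg_series_exp_coeff.
Qed.

Lemma exp_series_lim_le u K x : 0 <= x -> (forall n, `|u n| <= K * (x ^+ n / n`!%:R)) ->
  `|limn (series u)| <= K * expR x.
Proof.
move=> x0 uK; have uc := exp_series_cvg x0 uK.
have B N := exp_series_partial_le N x0 uK.
rewrite ler_norml; apply/andP; split.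
  by apply: limr_ge => //; apply: nearW => N; have := B N; rewrite ler_norml => /andP[].
by apply: limr_le => //; apply: nearW => N; have := B N; rewrite ler_norml => /andP[].
Qed.

Lemma is_derive_quad (f : R -> R) (l K : R) :
  (forall t, `|t| <= 1 -> `|f t - f 0 - t * l| <= K * t ^+ 2) -> is_derive (0 : R) 1 f l.
Proof.
move=> fK.
have K0 : 0 <= K by have := le_trans (normr_ge0 _) (fK 1 ltac:(by rewrite normr1)); rewrite expr1n mulr1.
have H : (h^-1 *: ((f \o shift 0) (h *: (1 : R)) - f 0) @[h --> (0 : R)^'] --> l)%classic.
  apply/cvgrPdist_le => e e0; apply/nbhs_ballP.
  have d0 : 0 < Num.min 1 (e / (K + 1)) by rewrite lt_min ltr01 divr_gt0// ltr_wpDl.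
  exists (Num.min 1 (e / (K + 1))) => //= h.
  rewrite /ball/= sub0r normrN lt_min => /andP[/ltW h1 /ltW h2] h0.
  have -> : h *: (1 : R) = h by rewrite /GRing.scale/= mulr1.
  rewrite addr0 distrC.
  have -> : h^-1 *: (f h - f 0) - l = h^-1 * (f h - f 0 - h * l).
    by rewrite [in RHS]mulrBr mulKf.
  rewrite normrM normfV ler_pdivrMl ?normr_gt0//.
  apply: le_trans (fK _ h1) _; rewrite -real_normK ?num_real// expr2 mulrA [leRHS]mulrC ler_wpM2r//.
  move: h2; rewrite ler_pdivlMr ?ltr_wpDl// => h2; apply: le_trans h2.
  by rewrite mulrC ler_wpM2l// lerDl.
by apply: DeriveDef; [apply/cvg_ex; exists l|exact: cvg_lim H].
Qed.

End ExponentialSeries.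

(** * Majorants for second-order remainders of powers *)

Section DominationTaylor.
Variables (R : realType) (m : nat).
Implicit Types p q : {mpoly R[m]}.

Lemma mdom_trans p q s : mdom p q -> mdom q s -> mdom p s.
Proof. by move=> pq qs k; rewrite (le_trans (pq k))// (le_trans (ler_norm _) (qs k)). Qed.

Lemma mdom_id p q : mdom p q -> mdom q q.
Proof. by move=> pq k; rewrite ger0_norm// (le_trans _ (pq k)). Qed.

Lemma mdomMn p q n : mdom p q -> mdom (p *+ n) (q *+ n).
Proof. by move=> pq k; rewrite !mcoeffMn normrMn lerMn2r pq orbT. Qed.

(** The explicit factor t^2 is what allows exponential series to be differentiated term by term. The
    step in n adds n (a + b)^(n+1), which the powers of 2 absorb because n <= 2^n. *)
Lemma mdom_taylor p q a b (t : R) n : mdom p a -> mdom q b -> `|t| <= 1 ->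
  mdom ((p + t *: q) ^+ n - p ^+ n - (n%:R * t) *: (q * p ^+ n.-1))
       (t ^+ 2 *: (2 *: (a + b)) ^+ n).
Proof.
move=> pa qb t1; have aa := mdom_id pa; have bb := mdom_id qb.
have pt : mdom (p + t *: q) (a + b).
  move=> k; rewrite !mcoeffD mcoeffZ (le_trans (ler_normD _ _))// lerD//.
  by rewrite normrM (le_trans _ (qb k))// ler_piMl.
have aab : mdom a (a + b) by move=> k; rewrite mcoeffD (le_trans (aa k))// lerDl (le_trans _ (qb k)).
have bab : mdom b (a + b) by move=> k; rewrite mcoeffD (le_trans (bb k))// lerDr (le_trans _ (pa k)).
elim: n => [|n IH].
  rewrite !expr0 subrr mul0r scale0r subr0 => k; rewrite mcoeff0 normr0 mcoeffZ mulr_ge0 ?sqr_ge0//.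
  by rewrite mcoeff1.
have -> : (p + t *: q) ^+ n.+1 - p ^+ n.+1 - (n.+1%:R * t) *: (q * p ^+ n.+1.-1) =
    (p + t *: q) * ((p + t *: q) ^+ n - p ^+ n - (n%:R * t) *: (q * p ^+ n.-1))
    + (t ^+ 2) *: ((q ^+ 2 * p ^+ n.-1) *+ n).
  case: n {IH} => [|n]; last first.
    have Zn i (X : {mpoly R[m]}) : (i%:R * t) *: X = i%:R * (t *: X) by rewrite -scalerA scaler_nat [RHS]mulr_natl.
    have Z2 (X : {mpoly R[m]}) : t ^+ 2 *: X = t *: (t *: X) by rewrite scalerA expr2.
    rewrite /= !Zn Z2 -[_ *+ n.+1]mulr_natl -!mul_mpolyC.
    by rewrite -[n.+2]add1n natrD !exprS; generalize (t%:MP_[m]) => T; ring.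
  by rewrite /= !expr0 !expr1 mul1r mulr1 mul0r scale0r subrr subr0 mulr0 mulr0n scaler0 addr0
    [p + _]addrC addrK subrr.
have h1 := mdomM pt IH.
have h2 : mdom (t ^+ 2 *: (q ^+ 2 * p ^+ n.-1 *+ n)) (t ^+ 2 *: ((a + b) ^+ n.+1 *+ n)).
  have -> : t ^+ 2 *: ((a + b) ^+ n.+1 *+ n) = `|t ^+ 2| *: ((a + b) ^+ n.+1 *+ n).
    by rewrite ger0_norm// sqr_ge0.
  apply: mdomZ; case: n {IH h1} => [|n] /=; first by rewrite !mulr0n => k; rewrite mcoeff0 normr0.
  rewrite -[n.+2]/(2 + n)%N exprD; apply: mdomMn.
  by apply: mdomM; apply: mdomX; [exact: mdom_trans bab|exact: mdom_trans aab].
apply: mdom_trans (mdomD h1 h2) _ => k.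
have ab0 : 0 <= ((a + b) ^+ n.+1)@_k by exact: le_trans (mdomX n.+1 pt k).
rewrite -scalerAr -scalerDr !exprZn -scalerAr -exprS.
rewrite -[_ ^+ n.+1 *+ n]scaler_nat -scalerDl !mcoeffZ ger0_norm; last first.
  by apply: mulr_ge0; [exact: sqr_ge0|apply: mulr_ge0 => //; rewrite addr_ge0 ?exprn_ge0].
rewrite ler_wpM2l ?sqr_ge0// ler_wpM2r// exprS [2 * _]mulr_natl [2 ^+ n *+ 2]mulr2n lerD2l.
by rewrite -natrX ler_nat ltnW// ltn_expl.
Qed.

End DominationTaylor.

(** * The heat series as a double series *)

Section PhaseSeries.
Variables (R : realType) (m : nat).
Notation vecR := ('rV[R]_m).
Local Notation C := R[i].
Local Notation iC := (0 +i* 1 : C).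
Variables (L : {mpoly R[m]} -> R) (rho : R).
Hypothesis rho0 : 0 <= rho.
Hypothesis Ll : forall c u v, L (c *: u + v) = c * L u + L v.
Hypothesis Lk : forall k, `|L 'X_[k]| <= rho ^+ mdeg k.
Implicit Types (w : C) (q : {mpoly R[m]}) (y v : vecR).

Let L0 : L 0 = 0.
Proof.
by have := Ll 1 0 0; rewrite scale1r addr0 mul1r => /eqP; rewrite addrC -subr_eq subrr eq_sym => /eqP.
Qed.
Let LD (u v : {mpoly R[m]}) : L (u + v) = L u + L v.
Proof. by rewrite -[u]scale1r Ll scale1r mul1r. Qed.
Let LZ c u : L (c *: u) = c * L u.
Proof. by rewrite -[c *: u]addr0 Ll L0 addr0. Qed.
Let LB (u v : {mpoly R[m]}) : L (u - v) = L u - L v.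
Proof. by rewrite LD -scaleN1r LZ mulN1r. Qed.

Definition majo q : R := (mabs q).@[fun=> rho].
(** For w = 1 and w = -i these are the real and imaginary parts of i^n. Differentiating a series
    shifts n, which multiplies w by i. *)
Definition phase w n : R := complex.Re (w * iC ^+ n).
Definition pterm w q y n : R := phase w n * L (q * lin y ^+ n) / n`!%:R.
Definition pseries w q y : R := limn (series (pterm w q y)).

Lemma cabs_iC : cabs iC = 1.
Proof. by rewrite /cabs /= expr0n expr1n add0r sqrtr1. Qed.

Lemma phase_le w n : cabs w <= 1 -> `|phase w n| <= 1.
Proof. by move=> w1; rewrite (le_trans (ler_Re_cabs _))// cabsM cabsX cabs_iC expr1n mulr1. Qed.

Lemma phaseS w n : phase w n.+1 = phase (w * iC) n.
Proof. by rewrite /phase exprS mulrA. Qed.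

Lemma functional_linX_le q y n : `|L (q * lin y ^+ n)| <= majo q * (norm1 y * rho) ^+ n.
Proof.
rewrite -meval_labs -rmorphXn -mevalM; apply: linear_mdom_le => //.
by apply: mdomM; [exact: mdom_abs|apply: mdomX; exact: mdom_lin].
Qed.

Lemma pterm_le w q y n : cabs w <= 1 ->
  `|pterm w q y n| <= majo q * ((norm1 y * rho) ^+ n / n`!%:R).
Proof.
move=> w1; rewrite mulrA normrM [`|_^-1|]ger0_norm ?invr_ge0// ler_wpM2r ?invr_ge0//.
by rewrite normrM (le_trans _ (functional_linX_le q y n))// ler_piMl// phase_le.
Qed.

Let nr0 y : 0 <= norm1 y * rho. Proof. by rewrite mulr_ge0// norm1_ge0. Qed.

Lemma pseries_cvg w q y : cabs w <= 1 -> cvgn (series (pterm w q y)).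
Proof. by move=> w1; apply: exp_series_cvg (nr0 y) _ => n; exact: pterm_le. Qed.

Lemma pseries_le w q y : cabs w <= 1 -> `|pseries w q y| <= majo q * expR (norm1 y * rho).
Proof. by move=> w1; apply: exp_series_lim_le (nr0 y) _ => n; exact: pterm_le. Qed.

Lemma pseries_lin (a : R) w q q' y : cabs w <= 1 ->
  pseries w (a *: q + q') y = a * pseries w q y + pseries w q' y.
Proof.
move=> w1; have c1 := @pseries_cvg w q y w1; have c2 := @pseries_cvg w q' y w1.
apply: cvg_lim => //.
have -> : series (pterm w (a *: q + q') y) =
    fun N => a * series (pterm w q y) N + series (pterm w q' y) N.
  apply/funext => N; rewrite /series/= mulr_sumr -big_split; apply: eq_bigr => n _.
  rewrite /pterm [(a *: q + q') * _]mulrDl.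
  by rewrite -[(a *: q) * _]scalerAl Ll /=; ring.
by apply: cvgD => //; apply: cvgM => //; exact: cvg_cst.
Qed.

Lemma pseriesN w q y : cabs w <= 1 -> pseries (- w) q y = - pseries w q y.
Proof.
move=> w1; rewrite /pseries; apply: cvg_lim => //.
have -> : series (pterm (- w) q y) = fun N => - series (pterm w q y) N.
  apply/funext => N; rewrite /series/= -sumrN; apply: eq_bigr => n _.
  by rewrite /pterm /phase mulNr ReN !mulNr.
by apply: cvgN; exact: pseries_cvg.
Qed.

Lemma lin_line y v (t : R) : lin (t *: v + y) = lin y + t *: lin v.
Proof. by rewrite lin_linear addrC. Qed.

(** By [mdom_taylor] the second-order remainder of every partial sum is at most a fixed multiple of
    t^2. This bound passes to the limit, where it yields the derivative directly; derivatives of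
    partial sums are never interchanged with the limit. *)
Lemma pseries_is_derive w q y v : cabs w <= 1 ->
  is_derive y v (pseries w q) (pseries (w * iC) (lin v * q) y).
Proof.
move=> w1; have wi1 : cabs (w * iC) <= 1 by rewrite cabsM cabs_iC mulr1.
apply: is_derive_line; pose X : R := 2 * (norm1 y + norm1 v) * rho.
have X0 : 0 <= X by rewrite mulr_ge0// mulr_ge0// addr_ge0// norm1_ge0.
apply: (is_derive_quad (K := majo q * expR X)) => t t1; rewrite scale0r add0r.
pose dterm n := phase w n * (n%:R * L (q * (lin v * lin y ^+ n.-1))) / n`!%:R.
have dE N : series dterm N.+1 = series (pterm (w * iC) (lin v * q) y) N.
  rewrite /series /= !big_mkord big_ord_recl /dterm mul0r mulr0 mul0r add0r; apply: eq_bigr => n _ /=.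
  rewrite /pterm add0n phaseS [q * (lin v * _)]mulrCA [lin v * (q * _)]mulrA factS natrM.
  have n1 : n.+1%:R != 0 :> R by [].
  have n2 : n`!%:R != 0 :> R by rewrite pnatr_eq0 -lt0n fact_gt0.
  have F (a b c d : R) : a != 0 -> b != 0 -> c * (a * d) / (a * b) = c * d / b.
    by move=> a0 b0; field; rewrite a0 b0.
  exact: F.
have dl : (series dterm N @[N --> \oo] --> pseries (w * iC) (lin v * q) y)%classic.
  by rewrite -cvg_shiftS/=; under eq_fun do rewrite dE; exact: pseries_cvg.
have B N : `|series (pterm w q (t *: v + y)) N - series (pterm w q y) N - t * series dterm N|
   <= majo q * expR X * t ^+ 2.
  have -> : series (pterm w q (t *: v + y)) N - series (pterm w q y) N - t * series dterm N
     = series (fun n => pterm w q (t *: v + y) n - pterm w q y n - t * dterm n) N.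
    by rewrite /series/= mulr_sumr -!sumrB.
  rewrite mulrAC; apply: exp_series_partial_le => // n.
  rewrite /pterm /dterm lin_line.
  have -> : phase w n * L (q * (lin y + t *: lin v) ^+ n) / n`!%:R -
      phase w n * L (q * lin y ^+ n) / n`!%:R -
      t * (phase w n * (n%:R * L (q * (lin v * lin y ^+ n.-1))) / n`!%:R) =
    phase w n * L (q * ((lin y + t *: lin v) ^+ n - lin y ^+ n
       - (n%:R * t) *: (lin v * lin y ^+ n.-1))) / n`!%:R.
    have LBB (A B D : {mpoly R[m]}) c : L (q * (A - B - c *: D)) = L (q * A) - L (q * B) - c * L (q * D).
      by rewrite [q * _]mulrBr [q * (A - B)]mulrBr !LB -[q * (c *: D)]scalerAr LZ.
    by rewrite LBB; ring.
  rewrite mulrA normrM [`|_^-1|]ger0_norm ?invr_ge0// ler_wpM2r ?invr_ge0//.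
  rewrite normrM (@le_trans _ _ `|L (q * ((lin y + t *: lin v) ^+ n - lin y ^+ n
       - (n%:R * t) *: (lin v * lin y ^+ n.-1)))|)//.
    by rewrite ler_piMl// phase_le.
  have -> : majo q * t ^+ 2 * X ^+ n =
    (mabs q * (t ^+ 2 *: (2 *: (labs y + labs v)) ^+ n)).@[fun=> rho].
    rewrite mevalM mevalZ rmorphXn /= mevalZ mevalD !meval_labs /majo /X.
    by rewrite -mulrDl !mulrA.
  apply: linear_mdom_le => //; apply: mdomM; first exact: mdom_abs.
  by apply: mdom_taylor => //; exact: mdom_lin.
have lim : (series (pterm w q (t *: v + y)) N - series (pterm w q y) N - t * series dterm N
   @[N --> \oo] --> pseries w q (t *: v + y) - pseries w q y - t * pseries (w * iC) (lin v * q) y)%classic.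
  by apply: cvgB; [apply: cvgB; exact: pseries_cvg|apply: cvgM => //; exact: cvg_cst].
rewrite -(cvg_lim _ (cvg_norm lim))//.
by apply: limr_le; [apply/cvg_ex; eexists; exact: cvg_norm lim|exact: nearW].
Qed.

(** Stands for w L(q e^(i <y, X>)): as [L] is real, the imaginary part is the series with w replaced
    by -i w. *)
Definition pseriesC w q y : C := pseries w q y +i* pseries (w * - iC) q y.

Lemma cabs_iCM w : cabs w <= 1 -> cabs (w * iC) <= 1.
Proof. by rewrite cabsM cabs_iC mulr1. Qed.
Lemma cabs_NiCM w : cabs w <= 1 -> cabs (w * - iC) <= 1.
Proof. by rewrite cabsM cabsN cabs_iC mulr1. Qed.

Lemma iC_sqr : iC * iC = - 1.
Proof. by apply: complex_eqP; rewrite /= ?mul0r ?mulr0 ?mulr1 ?sub0r ?addr0 ?oppr0. Qed.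

Lemma lin_eR j : lin (eR R j) = 'X_j :> {mpoly R[m]}.
Proof.
rewrite /lin (bigD1 j)//= big1 => [|i ij]; first by rewrite mxE eqxx scale1r addr0.
by rewrite mxE (negPf ij) scale0r.
Qed.

Lemma partialRC_pseriesC w q j : cabs w <= 1 ->
  partialRC j (pseriesC w q) = pseriesC (w * iC) ('X_j * q).
Proof.
move=> w1; apply/funext => y; rewrite /partialRC /pseriesC.
have [_ h1] := pseries_is_derive q y (eR R j) w1.
have [_ h2] := pseries_is_derive q y (eR R j) (cabs_NiCM w1).
by rewrite /= h1 h2 lin_eR mulrAC.
Qed.

Lemma pseries0 w y : cabs w <= 1 -> pseries w 0 y = 0.
Proof.
move=> w1; have := pseries_lin 1 0 0 y w1; rewrite scaler0 addr0 mul1r => /eqP.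
by rewrite addrC -subr_eq subrr eq_sym => /eqP.
Qed.

Lemma pseriesC_sum (I : Type) (r : seq I) (F : I -> {mpoly R[m]}) w y : cabs w <= 1 ->
  pseriesC w (\sum_(i <- r) F i) y = \sum_(i <- r) pseriesC w (F i) y.
Proof.
move=> w1; have w2 := cabs_NiCM w1; elim: r => [|i r IH].
  by rewrite !big_nil /pseriesC !pseries0.
by rewrite !big_cons -IH /pseriesC -[F i]scale1r !pseries_lin// !mul1r scale1r.
Qed.

Lemma pseriesCN w q y : cabs w <= 1 -> pseriesC (- w) q y = - pseriesC w q y.
Proof.
by move=> w1; rewrite /pseriesC mulNr !pseriesN ?cabs_NiCM.
Qed.

Definition sumsqX : {mpoly R[m]} := \sum_j 'X_j ^+ 2.

Lemma laplaceRC_pseriesC w q : cabs w <= 1 ->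
  laplaceRC (pseriesC w q) = pseriesC (- w) (sumsqX * q).
Proof.
move=> w1; apply/funext => y; rewrite /laplaceRC /sumsqX mulr_suml pseriesC_sum; last by rewrite cabsN.
apply: eq_bigr => j _; rewrite partialRC_pseriesC// partialRC_pseriesC ?cabs_iCM//.
by rewrite -mulrA iC_sqr mulrN1 mulrA -expr2.
Qed.

Lemma iter_laplaceRC n q y :
  iter n (@laplaceRC R m) (pseriesC 1 q) y = (-1) ^+ n * pseriesC 1 (sumsqX ^+ n * q) y.
Proof.
have c1 : cabs (1 : C) <= 1 by rewrite (cabs_real 1) normr1.
have cs k : cabs ((-1 : C) ^+ k) <= 1 by rewrite cabsX cabsN (cabs_real 1) normr1 expr1n.
have -> : iter n (@laplaceRC R m) (pseriesC 1 q) = pseriesC ((-1) ^+ n) (sumsqX ^+ n * q).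
  elim: n => [|n IH]; first by rewrite !expr0 mul1r.
  by rewrite iterS IH laplaceRC_pseriesC// !exprS mulN1r mulrA.
generalize (sumsqX ^+ n * q) => {}q; elim: n => [|n IH]; first by rewrite !expr0 mul1r.
by rewrite !exprS !mulN1r pseriesCN// IH mulNr.
Qed.

Lemma mabs_id q : mdom q q -> mabs q = q.
Proof.
move=> qq; rewrite [RHS]mpolyE; apply: eq_bigr => k _; congr (_ *: _).
by rewrite ger0_norm// (le_trans _ (qq k)).
Qed.

Lemma majo_sumsqX n : majo (sumsqX ^+ n) = (m%:R * rho ^+ 2) ^+ n.
Proof.
rewrite /majo mabs_id; last first.
  by apply: mdomX; apply: mdom_sum => j; apply: mdomX; exact: mdom_mon.
rewrite rmorphXn /= raddf_sum; congr (_ ^+ n).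
rewrite (eq_bigr (fun=> rho ^+ 2)) => [|j _]; last by rewrite /= rmorphXn/= mevalXU.
by rewrite sumr_const card_ord mulr_natl.
Qed.

Definition heatA : R := m%:R * rho ^+ 2 / 2.
Lemma heatA_ge0 : 0 <= heatA.
Proof. by rewrite divr_ge0// mulr_ge0// sqr_ge0. Qed.

Definition heatc k : R := (2 ^+ k * k`!%:R)^-1.
Lemma heatc_ge0 k : 0 <= heatc k.
Proof. by rewrite invr_ge0 mulr_ge0// exprn_ge0. Qed.

Definition hterm w y k : R := heatc k * pseries w (sumsqX ^+ k) y.
Definition hseries w y : R := limn (series (hterm w y)).

Lemma heatcA k : heatc k * (m%:R * rho ^+ 2) ^+ k = heatA ^+ k / k`!%:R.
Proof. by rewrite /heatc /heatA expr_div_n invfM mulrC mulrA. Qed.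

Lemma hterm_le w y k : cabs w <= 1 ->
  `|hterm w y k| <= expR (norm1 y * rho) * (heatA ^+ k / k`!%:R).
Proof.
move=> w1; rewrite -heatcA normrM ger0_norm ?heatc_ge0// mulrCA ler_wpM2l ?heatc_ge0//.
by rewrite -majo_sumsqX mulrC; exact: pseries_le.
Qed.

Lemma hseries_cvg w y : cabs w <= 1 -> cvgn (series (hterm w y)).
Proof. by move=> w1; apply: exp_series_cvg heatA_ge0 _ => k; exact: hterm_le. Qed.

Definition cell w y k n : R := heatc k * pterm w (sumsqX ^+ k) y n.

Lemma cell_le w y k n : cabs w <= 1 ->
  `|cell w y k n| <= (heatA ^+ k / k`!%:R) * ((norm1 y * rho) ^+ n / n`!%:R).
Proof.
move=> w1; rewrite -heatcA normrM ger0_norm ?heatc_ge0// -mulrA ler_wpM2l ?heatc_ge0//.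
by rewrite -majo_sumsqX; exact: pterm_le.
Qed.

(** Truncation by the degree 2k + n of the polynomial |X|^(2k) <y, X>^n, the one that matches the
    Hermite expansion. *)
Definition tri w y N : R := \sum_(k < N) \sum_(n < N | (2 * k + n < N)%N) cell w y k n.

Lemma tri_le w y N : cabs w <= 1 -> `|tri w y N| <= expR heatA * expR (norm1 y * rho).
Proof.
move=> w1; have A0 := heatA_ge0; have B0 := nr0 y.
have t0 (x : R) n : 0 <= x -> 0 <= x ^+ n / n`!%:R by move=> x0; rewrite divr_ge0 ?exprn_ge0.
rewrite (le_trans (ler_norm_sum _ _ _))//.
rewrite (@le_trans _ _ ((\sum_(k < N) heatA ^+ k / k`!%:R) * \sum_(n < N) (norm1 y * rho) ^+ n / n`!%:R))//.
  rewrite mulr_suml; apply: ler_sum => k _; rewrite (le_trans (ler_norm_sum _ _ _))//.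
  rewrite mulr_sumr big_mkcond; apply: ler_sum => n _.
  by case: ifP => _; [exact: cell_le|rewrite mulr_ge0 ?t0].
by apply: ler_pM; rewrite ?exp_partial_le// sumr_ge0// => n _; exact: t0.
Qed.

(* Outside the triangle 2k + n < N each cell is at most 2^(2k+n-N) times its modulus, which makes
   the discarded part geometrically small. *)
Lemma square_tri_le w y N M M' : cabs w <= 1 -> (N <= M)%N -> (N <= M')%N ->
  `|\sum_(k < M) \sum_(n < M') cell w y k n - tri w y N|
    <= 2 ^- N * (expR (4 * heatA) * expR (2 * (norm1 y * rho))).
Proof.
move=> w1 NM NM'; have A0 := heatA_ge0; have B0 := nr0 y.
have t0 (x : R) n : 0 <= x -> 0 <= x ^+ n / n`!%:R by move=> x0; rewrite divr_ge0 ?exprn_ge0.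
have -> : tri w y N = \sum_(k < M) \sum_(n < M' | (2 * k + n < N)%N) cell w y k n.
  pose G k := \sum_(n < M' | (2 * k + n < N)%N) cell w y k n.
  rewrite /tri (eq_bigr (fun k : 'I_N => G k)); last first.
    move=> k _; rewrite /G.
    pose P n := (2 * k + n < N)%N.
    rewrite (big_ord_widen_cond M' P (cell w y k) NM'); apply: eq_bigl => n.
    by rewrite andb_idr// /P => h; rewrite (leq_ltn_trans _ h)// leq_addl.
  rewrite (big_ord_widen M G NM) big_mkcond; apply: eq_bigr => k _; case: ifP => // kN.
  rewrite /G big1// => n h; exfalso; move: h; rewrite ltnNge => /negP; apply.
  by move/negbT: kN; rewrite -leqNgt; lia.
have -> : \sum_(k < M) \sum_(n < M') cell w y k n -
    \sum_(k < M) \sum_(n < M' | (2 * k + n < N)%N) cell w y k n =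
    \sum_(k < M) \sum_(n < M' | (N <= 2 * k + n)%N) cell w y k n.
  rewrite -sumrB; apply: eq_bigr => k _.
  rewrite (bigID (fun n : 'I_M' => (2 * k + n < N)%N))/= addrC addrK.
  by apply: eq_bigl => n; rewrite -leqNgt.
rewrite (le_trans (ler_norm_sum _ _ _))//.
rewrite (@le_trans _ _ (2 ^- N * ((\sum_(k < M) (4 * heatA) ^+ k / k`!%:R) *
   \sum_(n < M') (2 * (norm1 y * rho)) ^+ n / n`!%:R)))//.
  rewrite mulr_suml mulr_sumr; apply: ler_sum => k _; rewrite (le_trans (ler_norm_sum _ _ _))//.
  rewrite !mulr_sumr big_mkcond; apply: ler_sum => n _.
  case: ifP => [h|_]; last first.
    by apply: mulr_ge0; [rewrite invr_ge0 exprn_ge0|apply: mulr_ge0; apply: t0; apply: mulr_ge0].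
  apply: le_trans (cell_le y k n w1) _.
  have -> : 2 ^- N * ((4 * heatA) ^+ k / k`!%:R * ((2 * (norm1 y * rho)) ^+ n / n`!%:R)) =
     (2 ^+ (2 * k + n) / 2 ^+ N) * (heatA ^+ k / k`!%:R * ((norm1 y * rho) ^+ n / n`!%:R)).
    have -> : (4 : R) = 2 ^+ 2 by rewrite expr2 -natrM.
    rewrite exprD exprM !exprMn; ring.
  apply: ler_peMl; first by apply: mulr_ge0; apply: t0.
  by rewrite ler_pdivlMr ?exprn_gt0// mul1r ler_weXn2l// ler1n.
rewrite ler_wpM2l ?invr_ge0 ?exprn_ge0//.
have a4 : 0 <= 4 * heatA by apply: mulr_ge0.
have b2 : 0 <= 2 * (norm1 y * rho) by apply: mulr_ge0.
by apply: ler_pM; rewrite ?exp_partial_le//; apply: sumr_ge0 => n _; apply: t0.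
Qed.

(** The bound on finite rectangles of cells does not depend on their sides, which tend to infinity
    one after the other. *)
Lemma hseries_tri w y N : cabs w <= 1 ->
  `|hseries w y - tri w y N| <= 2 ^- N * (expR (4 * heatA) * expR (2 * (norm1 y * rho))).
Proof.
move=> w1; set B := (X in _ <= X).
have H M : (N <= M)%N -> `|series (hterm w y) M - tri w y N| <= B.
  move=> NM.
  have lim : (\sum_(k < M) \sum_(n < M') cell w y k n - tri w y N @[M' --> \oo] -->
      series (hterm w y) M - tri w y N)%classic.
    apply: cvgB; last exact: cvg_cst.
    rewrite /series /= big_mkord; apply: cvg_bigsum => k; rewrite /hterm.
    under eq_fun do rewrite -mulr_sumr.
    apply: cvgM; first exact: cvg_cst.
    under eq_fun do rewrite -(big_mkord xpredT (fun n => pterm w (sumsqX ^+ k) y n)).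
    exact: pseries_cvg.
  rewrite -(cvg_lim _ (cvg_norm lim))//; apply: limr_le; first by apply/cvg_ex; eexists; exact: cvg_norm lim.
  by exists N => // M' /= NM'; exact: square_tri_le.
have lim : (series (hterm w y) M - tri w y N @[M --> \oo] --> hseries w y - tri w y N)%classic.
  by apply: cvgB; [exact: hseries_cvg|exact: cvg_cst].
rewrite -(cvg_lim _ (cvg_norm lim))//; apply: limr_le; first by apply/cvg_ex; eexists; exact: cvg_norm lim.
by exists N.
Qed.

Lemma cvgC_ReIm (u : nat -> C) (l : C) :
  (complex.Re (u n) @[n --> \oo] --> complex.Re l)%classic ->
  (complex.Im (u n) @[n --> \oo] --> complex.Im l)%classic ->
  ((u n : C^o) @[n --> \oo] --> (l : C^o))%classic.
Proof.
move=> /cvgrPdist_le hR /cvgrPdist_le hI; apply/cvgrPdist_le => e /gt0_complex[d d0 ->].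
have d2 : 0 < d / 2 by rewrite divr_gt0.
near=> n; rewrite normCabs lecR (le_trans (cabs_le_ReIm _))//.
rewrite ReD ReN ImD ImN [leRHS](splitr d) lerD//; near: n; [exact: hR|exact: hI].
Unshelve. all: by end_near.
Qed.

(** Each Laplacian contributes - |X|^2, and this sign cancels the one in the heat series: formally
    e^(-Delta/2) e^(i <y, X>) = e^(|X|^2/2) e^(i <y, X>). Only the positive coefficients [heatc k]
    remain. *)
Lemma heat_half_pseriesC y :
  heat_half (pseriesC 1 1) y = hseries 1 y +i* hseries (- iC) y.
Proof.
have c1 : cabs (1 : C) <= 1 by rewrite (cabs_real 1) normr1.
have ci : cabs (- iC) <= 1 by rewrite cabsN cabs_iC.
rewrite /heat_half.
have -> : (fun N => \sum_(0 <= n < N) (((-1) ^+ n / (2 ^+ n * n`!%:R) : R)%:C *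
    iter n (@laplaceRC R m) (pseriesC 1 1) y : C^o)) =
  fun N => (series (hterm 1 y) N +i* series (hterm (- iC) y) N : C^o).
  apply/funext => N; rewrite /series /=; elim/big_ind3 : _ => //.
    by move=> x1 x2 x3 y1 y2 y3 -> ->; apply: complex_eqP.
  move=> n _; rewrite iter_laplaceRC mulr1 /hterm /pseriesC mul1r.
  have -> : (((-1) ^+ n / (2 ^+ n * n`!%:R) : R)%:C : C) = (-1) ^+ n * (heatc n)%:C.
    by rewrite /heatc rmorphM rmorphXn rmorphN1.
  rewrite mulrACA -expr2 sqrr_sign mul1r.
  by apply: complex_eqP; rewrite ?ReM ?ImM /= ?mul0r ?subr0 ?addr0.
apply: (@cvg_lim (R[i])^o (@norm_hausdorff _ _)).
by apply: cvgC_ReIm => /=; exact: hseries_cvg.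
Qed.

End PhaseSeries.

(** * Hermite expansions *)

Section AppellCoefficients.
Variable R : realType.

(* c = 0 gives the powers of X, c = 1 the (probabilists') Hermite polynomials. *)
Fixpoint appell (c : R) n : {poly R} :=
  match n with
  | 0 => 1
  | k.+1 => match k with
            | 0 => 'X
            | j.+1 => 'X * appell c k - (c * k%:R) *: appell c j
            end
  end.

Arguments appell : simpl never.

Lemma appellSS c n :
  appell c n.+2 = 'X * appell c n.+1 - (c * n.+1%:R) *: appell c n.
Proof. by []. Qed.

Lemma appell0E n : appell 0 n = 'X^n.
Proof.
have [] : appell 0 n = 'X^n /\ appell 0 n.+1 = 'X^(n.+1); last by [].
elim: n => [|n [IH1 IH2]]; first by rewrite expr0 expr1.
by split=> //; rewrite appellSS IH2 mul0r scale0r subr0 -exprS.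
Qed.

Variable m : nat.
Variables (y : 'rV[R]_m) (c : R) (S : nat -> {mpoly R[m]}).
Hypothesis S0 : S 0 = 1.
Hypothesis Sd : forall d j,
  (S d.+1)^`M(j) = y 0 j *: S d - c *: (if d is e.+1 then 'X_j * S e else 0).

Lemma mcoeffXM j (q : {mpoly R[m]}) k :
  ('X_j * q)@_k = if k j == 0%N then 0 else q@_(k - U_(j))%MM.
Proof.
rewrite mulrC; case: eqVneq => [k0|k0].
  rewrite mcoeffM big1// => i /eqP ki; rewrite mcoeffX.
  case: eqVneq => [e|_]; last by rewrite mulr0.
  by have := congr1 (fun k' : 'X_{1..m} => k' j) ki; rewrite /= k0 mnmDE -e mnm1E eqxx addn1.
by rewrite -[in LHS](@submK _ U_(j) k) ?lep1mP// addmC mcoeffMX.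
Qed.

(** [Sd] is the differential equation of exp(<y, X> - c |X|^2 / 2), with [S d] as its part of degree
    d. Read at the coefficient of X^(k - e_j), it becomes the three-term recursion of [appell] in
    the j-th variable. *)
Lemma appell_mcoeff k :
  (S (mdeg k))@_k = \prod_j ((appell c (k j)).[y 0 j] / (k j)`!%:R).
Proof.
have [n] := ubnP (mdeg k); elim: n => // n IH in k *; rewrite ltnS => kn.
have [k0|kpos] := posnP (mdeg k).
  rewrite k0 S0; move/eqP: k0; rewrite mdeg_eq0 => /eqP ->.
  by rewrite mcoeff1 eqxx big1// => j _; rewrite mnm0E hornerC fact0 divr1.
have [j kj] : exists j, (0 < k j)%N.
  apply/existsP; apply: contraTT kpos => /existsPn h.
  by rewrite mdegE big1// => i _; apply/eqP; rewrite -leqn0 leqNgt; exact: h.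
pose b := (k - U_(j))%MM.
have kb : k = (b + U_(j))%MM by rewrite submK// lep1mP -lt0n.
have bi i : i != j -> b i = k i by move=> ij; rewrite mnmBE mnm1E eq_sym (negPf ij) subn0.
have kbj : k j = (b j).+1 by rewrite kb mnmDE mnm1E eqxx addn1.
have dk : mdeg k = (mdeg b).+1 by rewrite kb mdegD mdeg1 addn1.
pose rest := \prod_(i | i != j) ((appell c (k i)).[y 0 i] / (k i)`!%:R).
(* Differentiating in X_j sends X^k to X^b with factor b_j + 1 = k_j, so [Sd] at b determines the
   coefficient at k. *)
have key : (S (mdeg k))@_k *+ (b j).+1 =
    ((appell c (k j)).[y 0 j] / (b j)`!%:R) * rest.
  rewrite dk [in LHS]kb -mcoeff_deriv Sd mcoeffB !mcoeffZ IH; last by rewrite -dk.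
  rewrite (bigD1 j)//= (eq_bigr (fun i => (appell c (k i)).[y 0 i] / (k i)`!%:R)); last first.
    by move=> i ij; rewrite bi.
  rewrite -/rest kbj; case E : (b j) => [|e].
    rewrite fact0 !divr1 hornerC mul1r hornerX.
    have -> : (if mdeg b is e.+1 then 'X_j * S e else 0)@_b = 0.
      by case: (mdeg b) => [|e']; rewrite ?mcoeff0// mcoeffXM E.
    by rewrite mulr0 subr0.
  pose d := (b - U_(j))%MM.
  have bd : b = (d + U_(j))%MM by rewrite submK// lep1mP E.
  have db : mdeg b = (mdeg d).+1 by rewrite bd mdegD mdeg1 addn1.
  have dj : d j = e by rewrite mnmBE mnm1E eqxx E subn1.
  rewrite db mcoeffXM E/= -/d IH; last by apply: leq_trans kn; rewrite dk db.
  rewrite (bigD1 j)//= (eq_bigr (fun i => (appell c (k i)).[y 0 i] / (k i)`!%:R)); last first.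
    by move=> i ij; rewrite mnmBE mnm1E eq_sym (negPf ij) subn0 bi.
  rewrite -/rest dj appellSS hornerD hornerN hornerM hornerX hornerZ factS natrM.
  have e1 : e.+1%:R != 0 :> R by [].
  have e2 : e`!%:R != 0 :> R by rewrite pnatr_eq0 -lt0n fact_gt0.
  have F (a f z h h' r : R) : a != 0 -> f != 0 ->
    z * (h / (a * f) * r) - c * (h' / f * r) = (z * h - c * a * h') / (a * f) * r.
    by move=> a0 f0; field; rewrite a0 f0.
  exact: F.
have n1 : (b j).+1%:R != 0 :> R by [].
apply: (mulIf n1); rewrite [LHS]mulr_natr key (bigD1 j)//= -/rest.
have -> : (k j)`!%:R = (b j).+1%:R * (b j)`!%:R :> R by rewrite kbj factS natrM.
have e2 : (b j)`!%:R != 0 :> R by rewrite pnatr_eq0 -lt0n fact_gt0.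
have F (a f h r : R) : a != 0 -> f != 0 -> h / f * r = h / (a * f) * r * a.
  by move=> a0 f0; field; rewrite a0 f0.
exact: F.
Qed.

Hypothesis Sh : forall d, S d \is d.-homog.

(** By homogeneity X^k occurs in [S d] only for d = |k|, so the double sum collapses. *)
Lemma appell_expansion (L : {mpoly R[m]} -> R) (f : nat -> R) N :
  (forall a u v, L (a *: u + v) = a * L u + L v) ->
  \sum_(d < N) f d * L (S d) =
  \sum_(k : 'X_{1..m < N}) f (mdeg k) *
     (L 'X_[k] * \prod_j ((appell c (k j)).[y 0 j] / (k j)`!%:R)).
Proof.
move=> Ll.
have L0 : L 0 = 0.
  by have := Ll 1 0 0; rewrite scale1r addr0 mul1r => /eqP; rewrite addrC -subr_eq subrr eq_sym => /eqP.
have LD (u v : {mpoly R[m]}) : L (u + v) = L u + L v by rewrite -[u]scale1r Ll scale1r mul1r.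
have LZ a (u : {mpoly R[m]}) : L (a *: u) = a * L u by rewrite -[a *: u]addr0 Ll L0 addr0.
have E (d : 'I_N) : f d * L (S d) = \sum_(k : 'X_{1..m < N}) f d * ((S d)@_k * L 'X_[k]).
  have SN : (msize (S d) <= N)%N.
    have [->|nz] := eqVneq (S d) 0; first by rewrite msize0.
    have := dhomog_uniq nz (Sh d) (dhomog_msize (Sh d)).
    by case: (msize _) => // e /= de; rewrite -de.
  rewrite {1}(mpolywE SN) (big_morph L LD L0) mulr_sumr; apply: eq_bigr => k _.
  by rewrite LZ.
under eq_bigr do rewrite E.
rewrite exchange_big; apply: eq_bigr => k _ /=.
have kN : (mdeg k < N)%N by exact: bmdeg.
rewrite (bigD1 (Ordinal kN))//= big1 => [|d dk].
  by rewrite addr0 appell_mcoeff [L _ * _]mulrC.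
rewrite (dhomog_nemf_coeff (Sh d)) ?mul0r ?mulr0//.
by apply: contra dk => /eqP dk; apply/eqP/val_inj.
Qed.

End AppellCoefficients.

(** * Generating families of monomials and of Hermite polynomials *)

Section GeneratingFamilies.
Variables (R : realType) (m : nat).
Notation vecR := ('rV[R]_m).
Local Notation C := R[i].
Local Notation iC := (0 +i* 1 : C).
Implicit Types (x y : vecR).

Lemma lin_expansion (L : {mpoly R[m]} -> R) x (f : nat -> R) N :
  (forall a u v, L (a *: u + v) = a * L u + L v) ->
  \sum_(d < N) f d * L (d`!%:R^-1 *: lin x ^+ d) =
  \sum_(k : 'X_{1..m < N}) f (mdeg k) * (L 'X_[k] * \prod_j (x 0 j ^+ k j / (k j)`!%:R)).
Proof.
move=> Ll; rewrite (@appell_expansion R m x 0 (fun d => d`!%:R^-1 *: lin x ^+ d))//.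
- apply: eq_bigr => k _; congr (_ * (_ * _)); apply: eq_bigr => j _.
  by rewrite appell0E hornerXn.
- by rewrite expr0 fact0 invr1 scale1r.
- move=> d j; rewrite scale0r subr0 mderivZ mderiv_linX !scalerA /=; congr (_ *: _).
  have d1 : d.+1%:R != 0 :> R by [].
  have d2 : d`!%:R != 0 :> R by rewrite pnatr_eq0 -lt0n fact_gt0.
  have F (a b c : R) : a != 0 -> b != 0 -> (a * b)^-1 * (a * c) = c * b^-1.
    by move=> a0 b0; field; rewrite a0 b0.
  by rewrite factS natrM F.
- by move=> d; rewrite rpredZ// lin_homog.
Qed.

Definition hqterm y k n : {mpoly R[m]} :=
  ((-1) ^+ k * heatc R k / n`!%:R) *: (sumsqX R m ^+ k * lin y ^+ n).
(** The part of degree d of exp(<y, X> - |X|^2 / 2). The guard excludes the k at which d - 2 k would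
    be truncated. *)
Definition hqS y d : {mpoly R[m]} :=
  \sum_(k < d.+1) (if (2 * k <= d)%N then hqterm y k (d - 2 * k) else 0).

Lemma sumsqX_homog k : sumsqX R m ^+ k \is (2 * k)%N.-homog.
Proof.
have : sumsqX R m \is 2.-homog.
  apply: rpred_sum => j _; have : ('X_j : {mpoly R[m]}) \is 1.-homog by rewrite dhomogX/= mdeg1.
  by move=> /(dhomogMn 2).
by move=> /(dhomogMn k).
Qed.

Lemma hqS_homog y d : hqS y d \is d.-homog.
Proof.
apply: rpred_sum => k _; case: ifP => kd; last exact: rpred0.
rewrite rpredZ//; have := dhomogM (sumsqX_homog k) (lin_homog y (d - 2 * k)).
by rewrite subnKC.
Qed.

Lemma mderiv_sumsqX k j :
  (sumsqX R m ^+ k)^`M(j) = (2 * k%:R) *: ('X_j * sumsqX R m ^+ k.-1).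
Proof.
have dX (i : 'I_m) : ('X_i)^`M(j) = (i == j)%:R :> {mpoly R[m]}.
  rewrite mderivX mnm1E; case: eqVneq => [->|_]; last by rewrite scale0r.
  by rewrite scale1r -[X in (X - _)%MM]add0m addmK mpolyX0.
have d1 : (sumsqX R m)^`M(j) = 2 *: 'X_j.
  rewrite raddf_sum (bigD1 j)//= big1 => [|i ij].
    by rewrite expr2 mderivM dX eqxx mul1r mulr1 addr0 scaler_nat.
  by rewrite expr2 mderivM dX (negPf ij) mul0r mulr0 addr0.
elim: k => [|k IH]; first by rewrite expr0 mderivC mulr0 scale0r.
rewrite exprS mderivM IH d1 -scalerAl -scalerAr.
case: k {IH} => [|k]; first by rewrite (mulr0 (2 : R)) scale0r addr0 /= (mulr1 (2 : R)).
rewrite /= mulrCA -exprS -scalerDl; congr (_ *: _).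
by rewrite -[k.+2]add1n natrD; ring.
Qed.

Lemma hqterm_deriv y k n j : (hqterm y k n)^`M(j) =
  (if n is n'.+1 then y 0 j *: hqterm y k n' else 0)
  - (if k is k'.+1 then 'X_j * hqterm y k' n else 0).
Proof.
rewrite mderivZ mderivM mderiv_sumsqX mderiv_linX scalerDr addrC; congr (_ + _).
  case: n => [|n]; first by rewrite mul0r scale0r mulr0 scaler0.
  rewrite -scalerAr !scalerA /=; congr (_ *: _).
  have d1 : n.+1%:R != 0 :> R by [].
  have d2 : n`!%:R != 0 :> R by rewrite pnatr_eq0 -lt0n fact_gt0.
  have F (a b c z : R) : a != 0 -> b != 0 -> z / (a * b) * (a * c) = c * (z / b).
    by move=> a0 b0; field; rewrite a0 b0.
  by rewrite factS natrM F.
case: k => [|k]; first by rewrite mulr0 scale0r mul0r scaler0 oppr0.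
have G (a c b : R) (X Q l : {mpoly R[m]}) : a * c = - b ->
    a *: ((c *: (X * Q)) * l) = - (X * (b *: (Q * l))).
  by move=> h; rewrite -[(c *: (X * Q)) * l]scalerAl scalerA h -[X * (b *: _)]scalerAr -mulrA scaleNr.
apply: G.
have d1 : k.+1%:R != 0 :> R by [].
have d2 : k`!%:R != 0 :> R by rewrite pnatr_eq0 -lt0n fact_gt0.
have d3 : (2 : R) ^+ k != 0 by rewrite expf_neq0.
have F (a b p c s : R) : a != 0 -> b != 0 -> p != 0 ->
   -1 * s * (2 * p * (a * b))^-1 / c * (2 * a) = - (s * (p * b)^-1 / c).
  move=> a0 b0 p0; generalize c^-1 => ci.
  by field; rewrite a0 b0 p0.
by rewrite /heatc factS natrM !exprS F.
Qed.

Lemma hqS_deriv y d j : (hqS y d.+1)^`M(j) =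
  y 0 j *: hqS y d - 1 *: (if d is e.+1 then 'X_j * hqS y e else 0).
Proof.
rewrite /hqS raddf_sum scale1r.
have E (k : 'I_d.+2) : (if (2 * k <= d.+1)%N then hqterm y k (d.+1 - 2 * k) else 0)^`M(j) =
    (if (2 * k <= d)%N then y 0 j *: hqterm y k (d - 2 * k) else 0) -
    (if (k : nat) is k'.+1 then if (2 * k' < d)%N then 'X_j * hqterm y k' (d.-1 - 2 * k') else 0 else 0).
  case: leqP => h1; last first.
    rewrite linear0; have -> : (2 * k <= d)%N = false by apply/negbTE; rewrite -ltnNge; lia.
    case: (nat_of_ord k) h1 => [|k'] h1; first by rewrite subr0.
    by have -> : (2 * k' < d)%N = false by [apply/negbTE; rewrite -leqNgt; lia]; rewrite subr0.
  rewrite hqterm_deriv; congr (_ - _).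
    case: leqP => h2; first by rewrite subSn.
    by have -> : (d.+1 - 2 * k = 0)%N by lia.
  case: (nat_of_ord k) h1 => [|k'] h1 //.
  have -> : (2 * k' < d)%N by lia.
  by congr (_ * hqterm _ _ _); lia.
under eq_bigr do rewrite /= E.
rewrite sumrB; congr (_ - _).
  rewrite big_ord_recr /= ifF ?addr0; last by apply/negbTE; rewrite -ltnNge; lia.
  by rewrite scaler_sumr; apply: eq_bigr => k _; case: ifP; rewrite ?scaler0.
rewrite big_ord_recl /= add0r; case: d {E} => [|e].
  by rewrite big_ord_recl big_ord0 /= addr0.
rewrite big_ord_recr /= ifF ?addr0; last by apply/negbTE; rewrite -leqNgt /bump; lia.
rewrite mulr_sumr; apply: eq_bigr => k _; rewrite ltnS /= add0n; case: ifP; by rewrite ?mulr0.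
Qed.

Lemma hqS0 y : hqS y 0 = 1.
Proof.
rewrite /hqS big_ord_recl big_ord0 /= addr0 /hqterm /heatc !expr0 fact0 !mul1r.
by rewrite invr1 mulr1 scale1r.
Qed.

Lemma sum_shift (f : nat -> R) a N :
  \sum_(d < N | (a <= d)%N) f (d - a)%N = \sum_(n < N | (a + n < N)%N) f n.
Proof.
rewrite -(big_geq_mkord (op := +%R) a N xpredT (fun d => f (d - a)%N)) -{1}[a]add0n big_addn big_mkord.
under eq_bigr do rewrite addnK.
rewrite (big_ord_widen N f (leq_subr a N)); apply: eq_bigl => n.
by rewrite ltn_subRL.
Qed.

Lemma phase_shift (w : C) k n : phase w (2 * k + n) = (-1) ^+ k * phase w n.
Proof.
have iC2 : iC ^+ 2 = -1.
  by rewrite expr2; apply: complex_eqP; rewrite /= ?mul0r ?mulr0 ?mulr1 ?sub0r ?addr0 ?oppr0.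
have H (a : R) (z : C) : complex.Re (a%:C * z) = a * complex.Re z by rewrite ReM /= mul0r subr0.
by rewrite /phase exprD exprM iC2 mulrCA -(rmorphN1 (real_complex R)) -rmorphXn H.
Qed.

(** [hqterm] carries a sign (-1)^k that [cell] lacks; since i^(2k) = (-1)^k, taking the phase at 2k
    + n instead of n makes up for it. The triangle then becomes a sum over the degrees d = 2k + n <
    N. *)
Lemma tri_expansion (L : {mpoly R[m]} -> R) (w : C) y N :
  (forall a u v, L (a *: u + v) = a * L u + L v) ->
  tri L w y N = \sum_(k : 'X_{1..m < N}) phase w (mdeg k) *
     (L 'X_[k] * \prod_j ((appell 1 (k j)).[y 0 j] / (k j)`!%:R)).
Proof.
move=> Ll.
have L0 : L 0 = 0.
  by have := Ll 1 0 0; rewrite scale1r addr0 mul1r => /eqP; rewrite addrC -subr_eq subrr eq_sym => /eqP.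
have LD (u v : {mpoly R[m]}) : L (u + v) = L u + L v by rewrite -[u]scale1r Ll scale1r mul1r.
have LZ a (u : {mpoly R[m]}) : L (a *: u) = a * L u by rewrite -[a *: u]addr0 Ll L0 addr0.
rewrite -(@appell_expansion R m y 1 (hqS y) (hqS0 y) (hqS_deriv y) (hqS_homog y) L (phase w) N Ll).
pose F k n := phase w (2 * k + n) * L (hqterm y k n).
have cF k n : cell L w y k n = F k n.
  rewrite /cell /pterm /F phase_shift /hqterm LZ.
  have G (s h p l f : R) : s ^+ 2 = 1 -> h * (p * l / f) = s * p * (s * h / f * l).
    by move=> s2; rewrite -[LHS]mul1r -s2; ring.
  by apply: G; rewrite sqrr_sign.
rewrite /tri; under eq_bigr do under eq_bigr do rewrite cF.
under eq_bigr => k _ do rewrite -(sum_shift (F k) (2 * k) N).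
rewrite (exchange_big_dep xpredT)//=; apply: eq_bigr => d _.
rewrite /hqS (big_morph L LD L0) mulr_sumr.
pose G k := if (2 * k <= d)%N then F k (d - 2 * k)%N else 0.
have -> : \sum_(k < N | (2 * k <= d)%N) F k (d - 2 * k)%N = \sum_(k < N) G k.
  by rewrite big_mkcond.
rewrite (eq_bigr (fun k : 'I_d.+1 => G k)); last first.
  move=> k _; rewrite /G; case: ifP => kd; last by rewrite L0 mulr0.
  by rewrite /F subnKC.
rewrite (big_ord_widen N G (ltn_ord d)) [LHS]big_mkcond/= [RHS]big_mkcond/=; apply: eq_bigr => k _.
by case: ifP => // kd; rewrite /G ifF//; apply/negbTE; move/negbT: kd; rewrite -!ltnNge; lia.
Qed.

End GeneratingFamilies.

(** * Gaussian integrals and Fourier transforms *)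

Section GaussianIntegrals.
Variable R : realType.
Notation mu := (@lebesgue_measure R).
Implicit Types (f g : R -> R) (c t y : R).

(** The universal dominating function: the weight [gw] times any exp(c |t|) is at most a multiple of
    it. *)
Definition gh t : R := expR (- (t ^+ 2 / 4)).
Definition gw t : R := expR (- (t ^+ 2 / 2)).
Definition JR f : R := Rintegral mu setT f.

Lemma normal_pdf_E (s : R) t : 0 < s ->
  normal_pdf 0 s t = normal_peak s * expR (- (t ^+ 2 / (2 * s ^+ 2))).
Proof.
move=> s0; rewrite normal_pdfE ?gt_eqF//= /normal_fun subr0 mulNr.
by rewrite -[s ^+ 2 *+ 2]mulr_natl.
Qed.

Lemma gh_integrable : mu.-integrable setT (EFin \o gh).
Proof.
have s0 : 0 < Num.sqrt 2 :> R by rewrite sqrtr_gt0.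
have p0 := @normal_peak_gt0 R (Num.sqrt 2) (lt0r_neq0 s0).
have -> : EFin \o gh = fun t => ((normal_peak (Num.sqrt 2))^-1%:E * (normal_pdf 0 (Num.sqrt 2) t)%:E)%E.
  apply/funext => t /=; rewrite -EFinM normal_pdf_E// mulKf ?gt_eqF// sqr_sqrtr//.
  by rewrite (_ : 2 * 2 = 4 :> R)// -natrM.
by apply: integrableZl => //; exact: integrable_normal_pdf.
Qed.

Lemma cgh_integrable c : mu.-integrable setT (EFin \o (fun t => c * gh t)).
Proof. exact: (@integrableZl _ _ _ mu setT measurableT c _ gh_integrable). Qed.

Lemma JR_gw : JR gw = Num.sqrt (2 * pi).
Proof.
have p0 : normal_peak (1 : R) != 0 by rewrite gt_eqF// normal_peak_gt0 ?oner_eq0.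
have -> : gw = fun t => (normal_peak 1)^-1 * normal_pdf 0 1 t.
  by apply/funext => t; rewrite normal_pdf_E// mulKf// expr1n mulr1.
rewrite /JR RintegralZl//; last exact: integrable_normal_pdf.
rewrite /Rintegral integral_normal_pdf mulr1 /normal_peak invrK expr1n mul1r.
by rewrite mulr_natl.
Qed.

Lemma dom_integrable f c : measurable_fun setT f -> (forall t, `|f t| <= c * gh t) ->
  mu.-integrable setT (EFin \o f).
Proof.
move=> mf fc; apply: (@le_integrable _ _ _ mu setT measurableT _ (fun t => (c%:E * (gh t)%:E)%E)).
- exact/measurable_EFinP.
- by move=> t _ /=; rewrite lee_fin (le_trans (fc t))// ler_norm.
- exact: cgh_integrable.
Qed.

Lemma JR_le f c : measurable_fun setT f -> (forall t, `|f t| <= c * gh t) ->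
  `|JR f| <= c * JR gh.
Proof.
move=> mf fc; have fi := dom_integrable mf fc.
apply: le_trans (le_normr_Rintegral measurableT fi) _.
rewrite /JR -RintegralZl//; last exact: gh_integrable.
apply: le_Rintegral => //; first exact: (integrable_norm fi).
exact: cgh_integrable.
Qed.

Lemma JR_dct (g_ : nat -> R -> R) g c : (forall n, measurable_fun setT (g_ n)) ->
  (forall n t, `|g_ n t| <= c * gh t) ->
  (forall t, g_ n t @[n --> \oo] --> g t)%classic ->
  measurable_fun setT g /\ (JR (g_ n) @[n --> \oo] --> JR g)%classic.
Proof.
move=> mg gc gg.
have mgl : measurable_fun setT g by apply: measurable_fun_cvg mg _ => t _; exact: gg.
split=> //.
have ic : mu.-integrable setT (fun t => (c%:E * (gh t)%:E)%E).
  exact: cgh_integrable.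
have [||||fi _ lim] := @dominated_convergence _ _ _ mu setT measurableT
   (fun n => EFin \o g_ n) (EFin \o g) _ _ _ _ ic.
- move=> n; apply/measurable_EFinP.
  exact: (mg n).
- exact/measurable_EFinP.
- by apply/aeW => t _; apply: cvg_EFin; [exact: nearW|exact: gg].
- by apply/aeW => t n _ /=; rewrite lee_fin.
apply: fine_cvg; rewrite fineK; last exact: integrable_fin_num.
exact: lim.
Qed.

(** A class closed under linear combinations in which every member is integrable. *)
Definition gdom f := continuous f /\ exists c, forall t, `|f t| <= c * gh t.

Lemma gdom_measurable f : gdom f -> measurable_fun setT f.
Proof. by case=> cf _; exact: continuous_measurable_fun. Qed.

Lemma gdom_integrable f : gdom f -> mu.-integrable setT (EFin \o f).
Proof. by move=> fd; have mf := gdom_measurable fd; case: fd => _ [c fc]; exact: dom_integrable fc. Qed.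

Lemma gdomZD f g c : gdom f -> gdom g -> gdom (fun t => c * f t + g t).
Proof.
move=> [cf [a fa]] [cg [b gb]]; split.
  by move=> t; apply: cvgD; [apply: cvgM; [exact: cvg_cst|exact: cf]|exact: cg].
exists (`|c| * a + b) => t; rewrite (le_trans (ler_normD _ _))// mulrDl lerD//.
by rewrite normrM -mulrA ler_wpM2l.
Qed.

Lemma gdom0 : gdom (fun=> 0).
Proof. by split; [exact: cst_continuous|exists 0 => t; rewrite normr0 mul0r]. Qed.

Lemma JR_lin f g c : gdom f -> gdom g -> JR (fun t => c * f t + g t) = c * JR f + JR g.
Proof.
move=> fd gd; have fi := gdom_integrable fd; have gi := gdom_integrable gd.
rewrite /JR RintegralD// ?RintegralZl//.
by apply: (@integrableZl _ _ _ mu setT measurableT c _ fi).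
Qed.

(** On [-(n+1), n+1] the fundamental theorem leaves boundary values, which tend to 0, while by
    dominated convergence the truncated integrals tend to the full one. *)
Lemma JR_derive0 G g : (forall t : R, is_derive t 1 G (g t)) -> gdom G -> gdom g -> JR g = 0.
Proof.
move=> dG [cG [a Ga]] gd; have mg := gdom_measurable gd; case: (gd) => cg [b gb].
pose I n := `[(- n.+1%:R : R), (n.+1%:R : R)]%classic.
pose gn n t := g t * \1_(I n) t.
have gn_le n t : `|gn n t| <= b * gh t.
  rewrite /gn normrM (le_trans _ (gb t))// ler_piMr//.
  by rewrite indicE; case: (_ \in _) => /=; rewrite ?normr1 ?normr0.
have mgn n : measurable_fun setT (gn n).
  by apply: measurable_funM => //; apply: measurable_indic; exact: measurable_itv.
have gg t : (gn n t @[n --> \oo] --> g t)%classic.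
  apply: cvg_near_cst.
  near=> n; rewrite /gn indicE mem_set ?mulr1// /I /= in_itv/= -ler_norml.
  have : (`|t| <= n%:R)%R by near: n; exact: nbhs_infty_ger.
  by move=> /le_trans; apply; rewrite ler_nat.
have [_ lim] := JR_dct mgn gn_le gg.
have E n : JR (gn n) = G n.+1%:R - G (- n.+1%:R).
  have ab : (- n.+1%:R : R) < n.+1%:R by rewrite gtrN.
  have -> : JR (gn n) = Rintegral mu (I n) g.
    rewrite /JR [RHS]Rintegral_mkcond; apply: eq_Rintegral => t _.
    by rewrite /gn patchE indicE; case: ifP => _; rewrite ?mulr1 ?mulr0.
  rewrite /Rintegral (@continuous_FTC2 _ _ G)//.
  - by apply: continuous_subspaceT => t; exact: cg.
  - split; first by move=> t _; have [] := dG t.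
      by apply: cvg_at_right_filter; exact: cG.
    by apply: cvg_at_left_filter; exact: cG.
  - by move=> t _; rewrite derive1E; have [_ ->] := dG t.
have l0 : (JR (gn n) @[n --> \oo] --> (0 : R))%classic.
  have a0 : 0 <= a.
    have := le_trans (normr_ge0 _) (Ga 0); rewrite /gh expr0n mul0r oppr0 expR0 mulr1//.
  (* From 1 + t^2 / 4 <= exp (t^2 / 4) at t = n + 1, giving the weaker rate 4 / t. *)
  have hn n : gh n.+1%:R <= 4 / n.+1%:R.
    have n0 : 0 < n.+1%:R :> R by [].
    have : 1 + n.+1%:R ^+ 2 / 4 <= expR (n.+1%:R ^+ 2 / 4 : R) by exact: expR_ge1Dx.
    rewrite /gh expRN => h.
    rewrite -[leRHS]invrK lef_pV2 ?posrE ?expR_gt0 ?invr_gt0 ?divr_gt0// invf_div.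
    apply: le_trans h; rewrite expr2 -mulrA ler_wpDl// ler_peMl ?divr_ge0//.
    by rewrite ler1n.
  apply/cvgrPdist_le => e e0.
  near=> n; rewrite sub0r normrN E (le_trans (ler_normB _ _))//.
  have h1 : `|G n.+1%:R| <= a * (4 / n.+1%:R) by rewrite (le_trans (Ga _))// ler_wpM2l.
  have h2 : `|G (- n.+1%:R)| <= a * (4 / n.+1%:R).
    by rewrite (le_trans (Ga _))// ler_wpM2l// /gh sqrrN hn.
  rewrite (le_trans (lerD h1 h2))//.
  have -> : a * (4 / n.+1%:R) + a * (4 / n.+1%:R) = 2 * a * 4 / n.+1%:R by ring.
  rewrite ler_pdivrMr//.
  rewrite [leRHS]mulrC -ler_pdivrMr//.
  have : (2 * a * 4 / e <= n%:R)%R by near: n; exact: nbhs_infty_ger.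
  by move=> /le_trans; apply; rewrite ler_nat.
exact: (cvg_unique (@norm_hausdorff _ _) lim l0).
Unshelve. all: by end_near. Qed.

End GaussianIntegrals.

Arguments appell : simpl never.

(** * Hermite polynomials under the Gaussian weight *)

Section HermiteIntegrals.
Variable R : realType.
Implicit Types (p q : {poly R}) (t y : R) (b : R -> R).
Local Notation gw := (@gw R).
Local Notation gh := (@gh R).

(** Completing the square: the exponents differ by (|t| / 2 - c)^2. *)
Lemma exp_abs_gw (c t : R) : expR (c * `|t|) * gw t <= expR (c ^+ 2) * gh t.
Proof.
rewrite /gw /gh -!expRD ler_expR -subr_ge0.
rewrite (_ : _ - _ = (`|t| / 2 - c) ^+ 2); first exact: sqr_ge0.
have -> : t ^+ 2 = `|t| ^+ 2 by rewrite real_normK ?num_real.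
by field.
Qed.

Lemma pow_le_exp (x : R) n : 0 <= x -> x ^+ n <= n`!%:R * expR x.
Proof.
move=> x0; rewrite mulrC -ler_pdivrMr ?ltr0n ?fact_gt0//.
apply: le_trans (exp_partial_le n.+1 x0); rewrite big_ord_recr /= lerDr sumr_ge0// => i _.
by rewrite divr_ge0 ?exprn_ge0.
Qed.

Lemma poly_le_exp p : exists2 c : R, 0 <= c & forall t, `|p.[t]| <= c * expR `|t|.
Proof.
exists (\sum_(i < size p) `|p`_i| * i`!%:R) => [|t]; first by apply: sumr_ge0 => i _; rewrite mulr_ge0.
rewrite horner_coef (le_trans (ler_norm_sum _ _ _))// mulr_suml; apply: ler_sum => i _.
by rewrite normrM normrX -mulrA ler_wpM2l// pow_le_exp.
Qed.

Lemma gw_continuous : continuous gw.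
Proof.
move=> t; apply: (@continuous_comp _ _ _ (fun x : R => - (x ^+ 2 / 2)) expR); last exact: continuous_expR.
by apply: cvgN; apply: cvgM; [exact: exprn_continuous|exact: cvg_cst].
Qed.

Lemma gdom_poly p b : continuous b -> (forall t, `|b t| <= 1) -> gdom (fun t => p.[t] * gw t * b t).
Proof.
move=> cb b1; split.
  move=> t; apply: cvgM; last exact: cb.
  by apply: cvgM; [exact: continuous_horner|exact: gw_continuous].
have [c c0 pc] := poly_le_exp p; exists (c * expR (1 ^+ 2)) => t.
rewrite !normrM (le_trans (ler_piMr _ (b1 t)))// ?mulr_ge0//.
rewrite [`|gw t|]ger0_norm ?expR_ge0// -mulrA.
apply: le_trans (_ : c * (expR (1 * `|t|) * gw t) <= _); last by rewrite ler_wpM2l// exp_abs_gw.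
by rewrite mul1r mulrA ler_wpM2r ?expR_ge0.
Qed.

Lemma gw_is_derive t : is_derive t 1 gw (- t * gw t).
Proof.
have h : is_derive t 1 (fun x : R => - (x ^+ 2 / 2)) (- t).
  have [d1 d2] := @is_derive_poly _ (- (2^-1) *: 'X^2 : {poly R}) t.
  have E : horner (- (2^-1) *: 'X^2 : {poly R}) = fun x : R => - (x ^+ 2 / 2).
    by apply/funext => x; rewrite hornerZ hornerXn mulNr mulrC.
  rewrite E in d1 d2; apply: DeriveDef => //; rewrite d2 derivZ derivXn hornerZ hornerMn hornerXn expr1.
  by rewrite -mulr_natl; field.
rewrite mulrC; exact: (@is_derive1_comp _ expR _ t _ _ (is_derive_expR _) h).
Qed.

(** Integration by parts with gw' = - t gw. The factor b will be 1, a cosine or a sine. *)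
Lemma parts p b b' : (forall t, is_derive t 1 b (b' t)) -> (forall t, `|b t| <= 1) ->
  continuous b' -> (exists c : R, forall t, `|b' t| <= c) ->
  JR (fun t => ('X * p).[t] * gw t * b t) =
  JR (fun t => p^`().[t] * gw t * b t) + JR (fun t => p.[t] * gw t * b' t).
Proof.
move=> db b1 cb' [c bc].
have cb : continuous b.
  by move=> t; apply: differentiable_continuous; apply/derivable1_diffP; have [] := db t.
have c1 : 0 < `|c| + 1 by rewrite ltr_wpDl.
have d1 := gdom_poly ('X * p) cb b1.
have d2 := gdom_poly p^`() cb b1.
have d3 : gdom (fun t => p.[t] * gw t * b' t).
  (* [gdom_poly] takes a factor bounded by 1, so b' is first rescaled by its bound. *)
  have h : gdom (fun t => p.[t] * gw t * ((`|c| + 1)^-1 * b' t)).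
    apply: gdom_poly => [t|t]; first by apply: cvgM; [exact: cvg_cst|exact: cb'].
    rewrite normrM ger0_norm ?invr_ge0 ?(ltW c1)// ler_pdivrMl// mulr1.
    by rewrite (le_trans (bc t))// (le_trans (ler_norm _))// lerDl.
  have := gdomZD (`|c| + 1) h (gdom0 R); congr gdom; apply/funext => t.
  by rewrite addr0 mulrCA mulVKf// gt_eqF.
have s1 : gdom (fun t => (-1) * (('X * p).[t] * gw t * b t) + p.[t] * gw t * b' t).
  exact: gdomZD.
have s2 : gdom (fun t => 1 * (p^`().[t] * gw t * b t) +
    ((-1) * (('X * p).[t] * gw t * b t) + p.[t] * gw t * b' t)) by exact: gdomZD.
have z := @JR_derive0 _ (fun t => p.[t] * gw t * b t) _ _ (gdom_poly p cb b1) s2.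
have : JR (fun t => 1 * (p^`().[t] * gw t * b t) +
    ((-1) * (('X * p).[t] * gw t * b t) + p.[t] * gw t * b' t)) = 0.
  apply: z => t.
  have e := is_deriveM (is_deriveM (is_derive_poly p t) (gw_is_derive t)) (db t).
  apply: (@is_derive_eq _ _ _ _ _ _ _ _ e).
  have Z (a x : R) : a *: (x : R^o) = a * x by [].
  by rewrite (_ : (horner p * gw) t = p.[t] * gw t)// !Z hornerM hornerX; ring.
rewrite JR_lin// JR_lin// mul1r mulN1r addrCA => /eqP.
by rewrite addrC subr_eq0 => /eqP <-.
Qed.

(** The factor 1 presents this as the case b = 1 of [parts]. *)
Definition Jp p : R := JR (fun t => p.[t] * gw t * 1).

Lemma Jp_lin c p q : Jp (c *: p + q) = c * Jp p + Jp q.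
Proof.
have c1 : continuous (fun _ : R => 1 : R) by exact: cst_continuous.
have b1 (t : R) : `|1 : R| <= 1 by rewrite normr1.
rewrite -JR_lin; [|exact: gdom_poly|exact: gdom_poly].
congr JR; apply/funext => t; by rewrite hornerD hornerZ; ring.
Qed.

Lemma Jp_X p : Jp ('X * p) = Jp p^`().
Proof.
have d0 t : is_derive t (1 : R) (fun _ : R => 1 : R) 0 by exact: is_derive_cst.
rewrite /Jp (parts (b' := fun=> 0) p d0).
- rewrite -[RHS]addr0; congr (_ + _).
  have := JR_lin 1 (gdom0 R) (gdom0 R).
  rewrite (_ : (fun t => 1 * 0 + 0) = fun=> 0); last by apply/funext => t; rewrite mulr0 add0r.
  rewrite mul1r => /eqP; rewrite addrC -subr_eq subrr eq_sym => /eqP z.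
  by rewrite -[RHS]z; congr JR; apply/funext => t; rewrite mulr0.
- by move=> t; rewrite normr1.
- exact: cst_continuous.
- by exists 0 => t; rewrite normr0.
Qed.

Lemma Jp1 : Jp 1 = Num.sqrt (2 * pi).
Proof. by rewrite -JR_gw; congr JR; apply/funext => t; rewrite hornerC mul1r mulr1. Qed.

Local Notation He := (appell (1 : R)).

(** At n = 0 the default value of the predecessor is multiplied by 0. *)
Lemma hermiteS n : He n.+1 = 'X * He n - n%:R *: He n.-1.
Proof. by case: n => [|n]; [rewrite scale0r subr0 mulr1|rewrite appellSS mul1r]. Qed.

Lemma hermite_deriv n : (He n)^`() = n%:R *: He n.-1.
Proof.
have [] : (He n)^`() = n%:R *: He n.-1 /\ (He n.+1)^`() = n.+1%:R *: He n; last by [].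
elim: n => [|n [IH1 IH2]]; first by rewrite derivC scale0r derivX scale1r.
split=> //; rewrite hermiteS derivB derivM derivX mul1r IH2 derivZ [n.+1.-1]/= IH1 -scalerAr.
by rewrite -addrA -scalerBr -hermiteS -[X in X + _]scale1r -scalerDl addrC natr1.
Qed.

(** He_(n+1) = X He_n - He_n', and multiplication by X minus differentiation is the adjoint of
    differentiation for the Gaussian weight. *)
Lemma Jp_hermiteS n q : Jp (He n.+1 * q) = Jp (He n * q^`()).
Proof.
rewrite hermiteS mulrBl -mulrA.
have -> : 'X * (He n * q) - n%:R *: He n.-1 * q = (-1) *: (n%:R *: He n.-1 * q) + 'X * (He n * q).
  by rewrite scaleN1r addrC.
by rewrite Jp_lin Jp_X derivM hermite_deriv -[X in Jp (X + _)]scale1r Jp_lin mul1r mulN1r addKr.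
Qed.

Lemma Jp0 : Jp 0 = 0.
Proof.
have := Jp_lin 1 0 0; rewrite scaler0 addr0 mul1r => /eqP.
by rewrite addrC -subr_eq subrr eq_sym => /eqP.
Qed.

Lemma hermite_orthogonal a c :
  Jp (He a * He c) = if a == c then Num.sqrt (2 * pi) * a`!%:R else 0.
Proof.
elim: a c => [|a IH] [|c].
- by rewrite mulr1 Jp1 eqxx fact0 mulr1.
- by rewrite mulrC Jp_hermiteS derivC mulr0 Jp0.
- by rewrite Jp_hermiteS derivC mulr0 Jp0.
rewrite Jp_hermiteS hermite_deriv -scalerAr -[X in Jp X]addr0 Jp_lin Jp0 addr0 IH eqSS.
by case: eqVneq => [->|_]; rewrite ?mulr0// factS natrM; ring.
Qed.

End HermiteIntegrals.

(** * One-variable Fourier transforms of Gaussian monomials *)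

Section GaussianFourier.
Variable R : realType.
Implicit Types (p q : {poly R}) (t y : R).
Local Notation gw := (@gw R).
Local Notation gh := (@gh R).
Local Notation s2pi := (Num.sqrt (2 * pi) : R).
Local Notation C := R[i].

Lemma Jp_sum n (F : nat -> {poly R}) : Jp (\sum_(i < n) F i) = \sum_(i < n) Jp (F i).
Proof.
elim: n => [|n IH]; first by rewrite !big_ord0 Jp0.
by rewrite !big_ord_recr /= addrC -[F n]scale1r Jp_lin mul1r scale1r IH addrC.
Qed.

Lemma JpZ (c : R) p : Jp (c *: p) = c * Jp p.
Proof. by rewrite -[X in Jp X]addr0 Jp_lin Jp0 addr0. Qed.

(** Termwise integration of a cosine or sine series: the partial sums are at most exp (|y| |t|),
    which the Gaussian turns into a multiple of [gh]. *)
Lemma JR_series (c : nat -> R) (phi : R -> R) y : (forall n, `|c n| <= 1) ->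
  (forall s, series (fun n => c n * s ^+ n / n`!%:R) n @[n --> \oo] --> phi s)%classic ->
  (\sum_(n < N) (c n * y ^+ n / n`!%:R * Jp 'X^n) @[N --> \oo]
     --> JR (fun t => gw t * phi (t * y)))%classic.
Proof.
move=> c1 cphi.
pose P N : {poly R} := \sum_(n < N) (c n * y ^+ n / n`!%:R) *: 'X^n.
have -> : (fun N => \sum_(n < N) (c n * y ^+ n / n`!%:R * Jp 'X^n)) =
    fun N => JR (fun t => (P N).[t] * gw t * 1).
  apply/funext => N; transitivity (Jp (P N)); last by [].
  have -> : Jp (P N) = \sum_(n < N) Jp ((c n * y ^+ n / n`!%:R) *: 'X^n).
    exact: (@Jp_sum N (fun n => (c n * y ^+ n / n`!%:R) *: 'X^n)).
  by apply: eq_bigr => n _; rewrite JpZ.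
have PE N t : (P N).[t] = series (fun n => c n * (t * y) ^+ n / n`!%:R) N.
  rewrite /series /= big_mkord horner_sum; apply: eq_bigr => n _.
  by rewrite hornerZ hornerXn exprMn; ring.
have b1 (t : R) : `|1 : R| <= 1 by rewrite normr1.
have [] // := @JR_dct R (fun N t => (P N).[t] * gw t * 1) (fun t => gw t * phi (t * y))
  (expR (`|y| ^+ 2)).
- move=> N; apply: gdom_measurable; apply: gdom_poly => //; exact: cst_continuous.
- move=> N t; rewrite mulr1 normrM [`|gw t|]ger0_norm ?expR_ge0//.
  apply: le_trans (exp_abs_gw _ _); rewrite ler_wpM2r ?expR_ge0// PE.
  have := @exp_series_partial_le R (fun n => c n * (t * y) ^+ n / n`!%:R) 1 (`|y| * `|t|) N.
  rewrite mul1r; apply; first by rewrite mulr_ge0.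
  move=> n; rewrite mul1r normrM [`|_^-1|]ger0_norm ?invr_ge0// ler_wpM2r ?invr_ge0//.
  by rewrite normrM normrX normrM mulrC [`|t| * _]mulrC ler_piMr ?exprn_ge0// mulr_ge0.
- move=> t; under eq_fun do rewrite mulr1 PE mulrC.
  by apply: cvgM; [exact: cvg_cst|exact: cphi].
Qed.

Lemma Jp_Xodd k : Jp ('X^(k.*2.+1) : {poly R}) = 0.
Proof.
elim: k => [|k IH]; first by rewrite exprS expr0 Jp_X derivC Jp0.
by rewrite doubleS exprS Jp_X derivXn -scaler_nat JpZ IH mulr0.
Qed.

Lemma Jp_Xeven k : Jp ('X^(k.*2) : {poly R}) = s2pi * (k.*2`!%:R / (2 ^+ k * k`!%:R)).
Proof.
elim: k => [|k IH]; first by rewrite double0 !expr0 Jp1 fact0 mulr1 divr1 mulr1.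
rewrite doubleS exprS Jp_X derivXn -scaler_nat JpZ IH !factS !natrM exprS.
have -> : (k.*2.+2%:R : R) = 2 * k.+1%:R by rewrite -doubleS -mul2n natrM.
have k0 : k.+1%:R != 0 :> R by [].
have F (a f p o s b : R) : a != 0 -> o * (s * (f / (p * b))) = s * (2 * a * (o * f) / (2 * p * (a * b))).
  move=> a0; have -> : (2 * p * (a * b))^-1 = (2 * a)^-1 * (p * b)^-1.
    by rewrite -invfM; congr (_^-1); ring.
  by generalize (p * b)^-1 => v; field; rewrite a0.
exact: F.
Qed.

Definition Cn a y : R := JR (fun t => ('X^a).[t] * gw t * cos (t * y)).
Definition Sn a y : R := JR (fun t => ('X^a).[t] * gw t * sin (t * y)).

Lemma Sn0 y : Sn 0 y = 0.
Proof.
pose c n : R := (odd n)%:R * (-1) ^+ n.-1./2.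
have c1 n : `|c n| <= 1 by rewrite normrM normrX normrN1 expr1n mulr1; case: odd; rewrite ?normr1 ?normr0.
have cs s : (series (fun n => c n * s ^+ n / n`!%:R) n @[n --> \oo] --> sin s)%classic.
  by rewrite unlock; exact: is_cvg_series_sin_coeff.
have lim := @JR_series c sin y c1 cs.
have -> : Sn 0 y = JR (fun t => gw t * sin (t * y)).
  by congr JR; apply/funext => t; rewrite expr0 hornerC mul1r.
rewrite -(cvg_lim _ lim)//; apply: cvg_lim => //.
rewrite (_ : (fun _ => _) = fun=> 0); first exact: cvg_cst.
apply/funext => N; apply: big1 => n _; rewrite /c; case E : (odd n); last by rewrite !mul0r.
by rewrite -[n in Jp 'X^n]odd_double_half E add1n Jp_Xodd mulr0.
Qed.

(** Only even moments survive, and they turn the cosine series into the exponential series of - y^2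
    / 2; the two are matched along partial sums of even length. *)
Lemma Cn0 y : Cn 0 y = s2pi * gw y.
Proof.
pose c n : R := (~~ odd n)%:R * (-1) ^+ n./2.
have c1 n : `|c n| <= 1 by rewrite normrM normrX normrN1 expr1n mulr1; case: odd; rewrite ?normr1 ?normr0.
have cs s : (series (fun n => c n * s ^+ n / n`!%:R) n @[n --> \oo] --> cos s)%classic.
  by rewrite unlock; exact: is_cvg_series_cos_coeff.
have lim := @JR_series c cos y c1 cs.
have -> : Cn 0 y = JR (fun t => gw t * cos (t * y)).
  by congr JR; apply/funext => t; rewrite expr0 hornerC mul1r.
have dbl : (k.*2 @[k --> \oo] --> \oo)%classic.
  by apply/cvgnyPge => K; near=> k; rewrite -addnn (@leq_trans k) ?leq_addl//; near: k; exact: nbhs_infty_ge.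
have lim2 := cvg_comp _ _ dbl lim.
have E k : \sum_(n < k.*2) (c n * y ^+ n / n`!%:R * Jp 'X^n) =
    s2pi * series (exp_coeff (- (y ^+ 2 / 2))) k.
  rewrite /series /= mulr_sumr; elim: k => [|k IH]; first by rewrite big_ord0 big_nil.
  rewrite doubleS !big_ord_recr /= IH big_nat_recr //= -addrA; congr (_ + _).
  rewrite Jp_Xodd mulr0 addr0 Jp_Xeven /c odd_double mul1r doubleK exp_coeffE /=.
  rewrite -mul2n exprM [(- (y ^+ 2 / 2)) ^+ k]exprNn [(_ / 2) ^+ k]expr_div_n.
  have f0 : (2 * k)`!%:R != 0 :> R by rewrite pnatr_eq0 -lt0n fact_gt0.
  have k0 : k`!%:R != 0 :> R by rewrite pnatr_eq0 -lt0n fact_gt0.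
  have p0 : 2 ^+ k != 0 :> R by rewrite expf_neq0.
  have F (f a b s g o : R) : f != 0 -> a != 0 -> b != 0 -> s * g / f * (o * (f / (a * b))) = o * (b^-1 * (s * (g / a))).
    by move=> f0' a0 b0; field; rewrite f0' a0 b0.
  exact: F.
have lim3 : (s2pi * series (exp_coeff (- (y ^+ 2 / 2))) k @[k --> \oo] --> s2pi * gw y)%classic.
  by apply: cvgM; [exact: cvg_cst|exact: is_cvg_series_exp_coeff].
have lim4 : (s2pi * series (exp_coeff (- (y ^+ 2 / 2))) k @[k --> \oo]
    --> JR (fun t => gw t * cos (t * y)))%classic.
  rewrite (_ : (fun k => _) = (fun N => \sum_(n < N) c n * y ^+ n / n`!%:R * Jp 'X^n) \o double)//.
  by apply/funext => k /=; rewrite E.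
exact: (cvg_unique (@norm_hausdorff _ _) lim4 lim3).
Unshelve. all: by end_near. Qed.

Let cos_le t : `|cos t| <= 1 :> R.
Proof. by rewrite ler_norml cos_geN1 cos_le1. Qed.
Let sin_le t : `|sin t| <= 1 :> R.
Proof. by rewrite ler_norml sin_geN1 sin_le1. Qed.

Let cont_cos y : continuous (fun t : R => cos (t * y)).
Proof.
move=> t; apply: (@continuous_comp _ _ _ (fun t : R => t * y) cos); last exact: continuous_cos.
by apply: cvgM; [exact: cvg_id|exact: cvg_cst].
Qed.
Let cont_sin y : continuous (fun t : R => sin (t * y)).
Proof.
move=> t; apply: (@continuous_comp _ _ _ (fun t : R => t * y) sin); last exact: continuous_sin.
by apply: cvgM; [exact: cvg_id|exact: cvg_cst].
Qed.

Lemma JRZ (c : R) f : gdom f -> JR (fun t => c * f t) = c * JR f.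
Proof.
move=> fd; have := JR_lin c fd (gdom0 R).
have -> : (fun t => c * f t + 0) = fun t => c * f t by apply/funext => t; rewrite addr0.
move=> ->; have := JR_lin 0 (gdom0 R) (gdom0 R).
have -> : (fun t : R => 0 * 0 + 0 : R) = fun=> 0 by apply/funext => t; rewrite mul0r addr0.
by rewrite mul0r add0r => _; rewrite /JR /Rintegral integral0 /= addr0.
Qed.

Let mul_is_derive t y : is_derive t (1 : R) (fun t : R => t * y) y.
Proof.
have [d1 d2] := @is_derive_poly _ (y *: 'X : {poly R}) t.
have E : horner (y *: 'X : {poly R}) = fun x : R => x * y.
  by apply/funext => x; rewrite hornerZ hornerX mulrC.
by rewrite E in d1 d2; apply: DeriveDef => //; rewrite d2 derivZ derivX hornerZ hornerC mulr1.
Qed.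

Lemma CnS a y : Cn a.+1 y = a%:R * Cn a.-1 y - y * Sn a y.
Proof.
rewrite /Cn /Sn exprS.
have db t : is_derive t (1 : R) (fun t : R => cos (t * y)) (- y * sin (t * y)).
  have := @is_derive1_comp R cos _ t _ _ (is_derive_cos _) (mul_is_derive t y).
  by congr (is_derive _ _ _ _); ring.
rewrite (parts 'X^a db).
- rewrite derivXn -JRZ; last by apply: gdom_poly => // t; exact: cos_le.
  rewrite -mulNr -JRZ; last by apply: gdom_poly => // t; exact: sin_le.
  congr (_ + _); congr JR; apply/funext => t; first by rewrite hornerMn -mulr_natl -!mulrA.
  by ring.
- by move=> t; exact: cos_le.
- by move=> t; apply: cvgM; [exact: cvg_cst|exact: cont_sin].
- exists `|y| => t; by rewrite normrM normrN ler_piMr// sin_le.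
Qed.

Lemma SnS a y : Sn a.+1 y = a%:R * Sn a.-1 y + y * Cn a y.
Proof.
rewrite /Cn /Sn exprS.
have db t : is_derive t (1 : R) (fun t : R => sin (t * y)) (y * cos (t * y)).
  have := @is_derive1_comp R sin _ t _ _ (is_derive_sin _) (mul_is_derive t y).
  by congr (is_derive _ _ _ _); ring.
rewrite (parts 'X^a db).
- rewrite derivXn -JRZ; last by apply: gdom_poly => // t; exact: sin_le.
  rewrite -JRZ; last by apply: gdom_poly => // t; exact: cos_le.
  congr (_ + _); congr JR; apply/funext => t; first by rewrite hornerMn -mulr_natl -!mulrA.
  by ring.
- by move=> t; exact: sin_le.
- by move=> t; apply: cvgM; [exact: cvg_cst|exact: cont_cos].
- exists `|y| => t; by rewrite normrM ler_piMr// cos_le.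
Qed.

(** Both sides satisfy I_(n+1) = n I_(n-1) - i y I_n, the left one by parts and the right one by the
    Hermite recursion, and they agree at 0. *)
Lemma fourier_monomial a y :
  Cn a y +i* (- Sn a y) = (s2pi * gw y * (appell 1 a).[y])%:C * (- (0 +i* 1)) ^+ a :> C.
Proof.
pose I a : C := Cn a y +i* (- Sn a y).
pose H a : C := (s2pi * gw y * (appell 1 a).[y])%:C * (- (0 +i* 1)) ^+ a.
have IS n : I n.+1 = n%:R * I n.-1 - (0 +i* 1) * y%:C * I n.
  by rewrite /I CnS SnS -(rmorph_nat (real_complex R)); apply: complex_eqP;
    rewrite ?ReD ?ImD ?ReN ?ImN ?ReM ?ImM /=; ring.
have HS n : H n.+1 = n%:R * H n.-1 - (0 +i* 1) * y%:C * H n.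
  rewrite /H hermiteS hornerD hornerN hornerM hornerX hornerZ.
  have j2 : (0 +i* 1) * (0 +i* 1) = -1 :> C.
    by apply: complex_eqP; rewrite /= ?mul0r ?mulr0 ?mulr1 ?sub0r ?addr0 ?oppr0.
  case: n => [|n]; first by rewrite mul0r subr0 mul0r add0r expr1 expr0 !rmorphM /=; ring.
  rewrite /= !rmorphM rmorphB !rmorphM rmorph_nat !exprS.
  have F (j k s g u v e b : C) : j * j = -1 ->
     s * g * (k * u - b * v) * (- j * (- j * e)) = b * (s * g * v * e) - j * k * (s * g * u * (- j * e)).
    move=> jj; transitivity ((j * j) * (s * g * (k * u - b * v) * e)); first by ring.
    transitivity (b * (s * g * v * e) + (j * j) * (k * (s * g * u * e))); last by ring.
    by rewrite jj; ring.
  exact: F.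
have [] : I a = H a /\ I a.+1 = H a.+1; last by [].
have H0 : I 0 = H 0.
  rewrite /I /H Cn0 Sn0 expr0 hornerC !mulr1; apply: complex_eqP => //=; exact: oppr0.
elim: a => [|a [IH1 IH2]]; last by split=> //; rewrite IS HS IH1 IH2.
by split=> //; rewrite IS HS H0.
Qed.

End GaussianFourier.

(** * Iterated integrals of product sums and dominated convergence *)

Section IteratedIntegrals.
Variables (R : realType) (m : nat).
Notation vecR := ('rV[R]_m).
Local Notation C := R[i].
Local Notation mu := (@lebesgue_measure R).
Local Notation gh := (@gh R).
Implicit Types (x : vecR) (f g : R -> C).

Definition ci f : C := JR (fun t => complex.Re (f t)) +i* JR (fun t => complex.Im (f t)).
Definition cdom f := gdom (fun t => complex.Re (f t)) /\ gdom (fun t => complex.Im (f t)).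

Lemma cdom0 : cdom (fun=> 0).
Proof. by split; exact: gdom0. Qed.

Lemma cdomZD (c : C) f g : cdom f -> cdom g -> cdom (fun t => c * f t + g t).
Proof.
move=> [f1 f2] [g1 g2]; split.
  have := gdomZD (complex.Re c) f1 (gdomZD (- complex.Im c) f2 g1); congr gdom.
  by apply/funext => t; rewrite ReD ReM; ring.
have := gdomZD (complex.Re c) f2 (gdomZD (complex.Im c) f1 g2); congr gdom.
by apply/funext => t; rewrite ImD ImM; ring.
Qed.

Lemma ci_lin (c : C) f g : cdom f -> cdom g -> ci (fun t => c * f t + g t) = c * ci f + ci g.
Proof.
move=> [f1 f2] [g1 g2]; apply: complex_eqP; rewrite ?ReD ?ImD ?ReM ?ImM /=.
  have h := gdomZD (- complex.Im c) f2 g1.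
  rewrite -addrA -mulNr -(JR_lin _ f2 g1) -(JR_lin _ f1 h); congr JR.
  by apply/funext => t; rewrite ReD ReM; ring.
have h := gdomZD (complex.Im c) f1 g2.
rewrite -addrA -(JR_lin _ f1 g2) -(JR_lin _ f2 h); congr JR.
by apply/funext => t; rewrite ImD ImM; ring.
Qed.

Lemma ci0 : ci (fun=> 0) = 0.
Proof.
have := ci_lin 1 cdom0 cdom0.
have -> : (fun t : R => 1 * 0 + 0 : C) = fun=> 0 by apply/funext => t; rewrite mulr0 addr0.
by rewrite mul1r => /eqP; rewrite addrC -subr_eq subrr eq_sym => /eqP.
Qed.

Lemma ci_sum (I : Type) (s : seq I) (c : I -> C) (f : I -> R -> C) : (forall i, cdom (f i)) ->
  cdom (fun t => \sum_(i <- s) c i * f i t) /\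
  ci (fun t => \sum_(i <- s) c i * f i t) = \sum_(i <- s) c i * ci (f i).
Proof.
move=> fd; elim: s => [|i s [IHd IHc]].
  have -> : (fun t : R => \sum_(i <- [::]) c i * f i t) = fun=> 0 by apply/funext => t; rewrite big_nil.
  by rewrite big_nil ci0; split=> //; exact: cdom0.
have -> : (fun t : R => \sum_(i <- i :: s) c i * f i t) =
   fun t => c i * f i t + \sum_(i <- s) c i * f i t by apply/funext => t; rewrite big_cons.
by split; [exact: cdomZD|rewrite ci_lin// IHc big_cons].
Qed.

Fixpoint iintC k (f : vecR -> C) x : C :=
  if k is k'.+1 then ci (fun t => iintC k' f (set_coord x k' t)) else f x.

Lemma iint_r_Re k (f : vecR -> C) x : iint_r k (fun x => complex.Re (f x)) x = complex.Re (iintC k f x).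
Proof. by elim: k x => //= k IH x; congr Rintegral; apply/funext => t; exact: IH. Qed.

Lemma iint_r_Im k (f : vecR -> C) x : iint_r k (fun x => complex.Im (f x)) x = complex.Im (iintC k f x).
Proof. by elim: k x => //= k IH x; congr Rintegral; apply/funext => t; exact: IH. Qed.

Lemma integralRm_iintC (f : vecR -> C) : integralRm f = iintC m f 0.
Proof. by rewrite /integralRm iint_r_Re iint_r_Im; case: (iintC m f 0). Qed.

Lemma set_coord_same x (k : 'I_m) t : set_coord x k t 0 k = t.
Proof. by rewrite mxE eqxx. Qed.

Lemma set_coord_gt x (k j : 'I_m) t : (k < j)%N -> set_coord x k t 0 j = x 0 j.
Proof. by move=> kj; rewrite mxE gtn_eqF. Qed.

Lemma prod_split_ge (S : comPzRingType) (F : 'I_m -> S) (k : 'I_m) :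
  \prod_(j : 'I_m | (k <= j)%N) F j = F k * \prod_(j : 'I_m | (k < j)%N) F j.
Proof.
rewrite (bigD1 k)//=; congr (_ * _); apply: eq_bigl => j.
by rewrite ltn_neqAle andbC eq_sym.
Qed.

Lemma prod_split_lt (S : comPzRingType) (F : 'I_m -> S) (k : 'I_m) :
  \prod_(j : 'I_m | (j < k.+1)%N) F j = \prod_(j : 'I_m | (j < k)%N) F j * F k.
Proof.
rewrite (bigD1 k)//= mulrC; congr (_ * _); apply: eq_bigl => j.
by rewrite ltnS [in RHS]ltn_neqAle andbC.
Qed.

Lemma prod_slice (S : comPzRingType) (G : 'I_m -> R -> S) x (k : 'I_m) t :
  \prod_(j : 'I_m | (k <= j)%N) G j (set_coord x k t 0 j) =
  G k t * \prod_(j : 'I_m | (k < j)%N) G j (x 0 j).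
Proof.
rewrite prod_split_ge set_coord_same; congr (_ * _).
by apply: eq_bigr => j kj; rewrite set_coord_gt.
Qed.

Section ProductSums.
Variables (I : Type) (s : seq I) (c : I -> C) (F : I -> 'I_m -> R -> C).
Hypothesis Fd : forall i j, cdom (F i j).

(** This shape is kept by partial integration, which replaces a factor by its integral; all
    approximants below have it. *)
Definition psum x : C := \sum_(i <- s) c i * \prod_j F i j (x 0 j).

Let slice x (k : 'I_m) i : C :=
  c i * \prod_(j : 'I_m | (j < k)%N) ci (F i j) * \prod_(j : 'I_m | (k < j)%N) F i j (x 0 j).

Lemma iintC_psum_slice k x : (k <= m)%N ->
  iintC k psum x = \sum_(i <- s) c i * \prod_(j : 'I_m | (j < k)%N) ci (F i j)
    * \prod_(j : 'I_m | (k <= j)%N) F i j (x 0 j).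
Proof.
elim: k x => [|k IH] x km.
  by apply: eq_bigr => i _; rewrite [X in _ = _ * X * _]big_pred0// mulr1.
pose k0 := Ordinal km.
have E : (fun t => iintC k psum (set_coord x k t)) = fun t => \sum_(i <- s) slice x k0 i * F i k0 t.
  apply/funext => t; rewrite IH 1?ltnW//; apply: eq_bigr => i _; rewrite /slice.
  rewrite (prod_slice (F i) x k0 t : \prod_(j : 'I_m | (k <= j)%N) F i j (set_coord x k t 0 j) = _).
  by rewrite -!mulrA [F i k0 t * _]mulrC.
rewrite /= E; have [_ ->] := ci_sum s (slice x k0) (fun i => Fd i k0).
apply: eq_bigr => i _; rewrite /slice (prod_split_lt _ k0) /=; ring.
Qed.

Lemma iintC_psum x : iintC m psum x = \sum_(i <- s) c i * \prod_j ci (F i j).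
Proof.
rewrite iintC_psum_slice//; apply: eq_bigr => i _; rewrite [X in _ * X]big_pred0 => [|j].
  by rewrite mulr1; congr (_ * _); apply: eq_bigl => j; rewrite ltn_ord.
by rewrite leqNgt ltn_ord.
Qed.

Lemma psum_slice_cdom k x : (k < m)%N -> cdom (fun t => iintC k psum (set_coord x k t)).
Proof.
move=> km; pose k0 := Ordinal km.
have -> : (fun t => iintC k psum (set_coord x k t)) = fun t => \sum_(i <- s) slice x k0 i * F i k0 t.
  apply/funext => t; rewrite iintC_psum_slice 1?ltnW//; apply: eq_bigr => i _; rewrite /slice.
  rewrite (prod_slice (F i) x k0 t : \prod_(j : 'I_m | (k <= j)%N) F i j (set_coord x k t 0 j) = _).
  by rewrite -!mulrA [F i k0 t * _]mulrC.
by have [] := ci_sum s (slice x k0) (fun i => Fd i k0).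
Qed.

End ProductSums.

(** The induction carries a bound along with the convergence: integrating out a variable replaces
    its factor [gh] by the constant [JR gh], so that the next integration is dominated again. *)
Lemma iint_dct (f_ : nat -> vecR -> R) (f : vecR -> R) (A : R) :
  (forall n x, `|f_ n x| <= A * \prod_j gh (x 0 j)) ->
  (forall x, f_ n x @[n --> \oo] --> f x)%classic ->
  (forall n k x, (k < m)%N -> measurable_fun setT (fun t => iint_r k (f_ n) (set_coord x k t))) ->
  forall k x, (k <= m)%N ->
  (forall n, `|iint_r k (f_ n) x| <= A * JR gh ^+ k * \prod_(j : 'I_m | (k <= j)%N) gh (x 0 j)) /\
  (iint_r k (f_ n) x @[n --> \oo] --> iint_r k f x)%classic.
Proof.
move=> fA ff fm; elim=> [|k IH] x km.
  by split=> [n|]; [rewrite expr0 mulr1; exact: fA|exact: ff].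
pose k0 := Ordinal km; pose B : R := A * JR gh ^+ k * \prod_(j : 'I_m | (k0 < j)%N) gh (x 0 j).
have gB n t : `|iint_r k (f_ n) (set_coord x k t)| <= B * gh t.
  have [h _] := IH (set_coord x k t) (ltnW km); apply: le_trans (h n) _.
  rewrite (prod_slice (fun=> gh) x k0 t : \prod_(j : 'I_m | (k <= j)%N) gh (set_coord x k t 0 j) = _).
  by rewrite /B -!mulrA [gh t * _]mulrC.
have gm n := fm n k x km.
split=> [n|].
  apply: le_trans (JR_le (gm n) (gB n)) _; rewrite /B exprSr.
  by rewrite mulrAC mulrA.
have [] // := @JR_dct R (fun n t => iint_r k (f_ n) (set_coord x k t))
   (fun t => iint_r k f (set_coord x k t)) B.
by move=> t; have [_] := IH (set_coord x k t) (ltnW km).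
Qed.

(** Immediate from the integral as a supremum over simple functions below. It lets partial integrals
    of a modulus be compared without examining their measurability. *)
Lemma ge0_le_integral_nonmeasurable (f g : R -> \bar R) : (forall t, 0 <= f t)%E ->
  (forall t, f t <= g t)%E -> (\int[mu]_t f t <= \int[mu]_t g t)%E.
Proof.
move=> f0 fg; have g0 t : (0 <= g t)%E by exact: le_trans (f0 t) (fg t).
rewrite !ge0_integralTE//; apply: le_ereal_sup => _ [h hf <-]; exists h => //.
by move=> t; apply: le_trans (hf t) (fg t).
Qed.

Lemma iint_e_le (g : vecR -> \bar R) (A : R) : (forall x, 0 <= g x)%E ->
  (forall x, g x <= (A * \prod_j gh (x 0 j))%:E)%E ->
  forall k x, (k <= m)%N -> (0 <= iint_e k g x)%E /\
  (iint_e k g x <= (A * JR gh ^+ k * \prod_(j : 'I_m | (k <= j)%N) gh (x 0 j))%:E)%E.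
Proof.
move=> g0 gA; elim=> [|k IH] x km; first by rewrite expr0 mulr1.
split; first by apply: integral_ge0 => t _; have [] := IH (set_coord x k t) (ltnW km).
pose k0 := Ordinal km; pose B : R := A * JR gh ^+ k * \prod_(j : 'I_m | (k0 < j)%N) gh (x 0 j).
have gB t : (iint_e k g (set_coord x k t) <= (B * gh t)%:E)%E.
  have [_ h] := IH (set_coord x k t) (ltnW km); apply: le_trans h _.
  rewrite lee_fin (prod_slice (fun=> gh) x k0 t : \prod_(j : 'I_m | (k <= j)%N) gh (set_coord x k t 0 j) = _).
  by rewrite /B -!mulrA [gh t * _]mulrC.
have g0' t : (0 <= iint_e k g (set_coord x k t))%E by have [] := IH (set_coord x k t) (ltnW km).
apply: le_trans (ge0_le_integral_nonmeasurable g0' gB) _.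
have -> : (\int[mu]_t (B * gh t)%:E)%E = (JR (fun t => B * gh t))%:E.
  by rewrite /JR /Rintegral fineK//; apply: integrable_fin_num => //; exact: cgh_integrable.
rewrite lee_fin /JR RintegralZl//; last exact: gh_integrable.
by rewrite /B -/(JR gh) exprSr le_eqVlt; apply/orP; left; apply/eqP; rewrite /k0 /=; ring.
Qed.

End IteratedIntegrals.

(** * Fourier transforms of Gaussian polynomials on R^m *)

Section GaussianFourierTransform.
Variables (R : realType) (m : nat).
Notation vecR := ('rV[R]_m).
Local Notation C := R[i].
Local Notation iC := (0 +i* 1 : C).
Local Notation gw := (@gw R).
Local Notation gh := (@gh R).
Local Notation s2pi := (Num.sqrt (2 * pi) : R).
Implicit Types (x y : vecR).

Lemma expiD (a b : R) : expi (a + b) = expi a * expi b.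
Proof. by apply: complex_eqP; rewrite /= ?cosD ?sinD; ring. Qed.

Lemma expi0 : expi 0 = 1 :> C.
Proof. by rewrite /expi cos0 sin0. Qed.

Lemma cabs_expi (a : R) : cabs (expi a) = 1.
Proof. by rewrite /cabs /= cos2Dsin2 sqrtr1. Qed.

Lemma expi_sum (F : 'I_m -> R) : expi (\sum_j F j) = \prod_j expi (F j).
Proof. by rewrite (big_morph _ expiD expi0). Qed.

Lemma gauss_prod x : expR (- normsq x / 2) = \prod_j gw (x 0 j).
Proof.
have -> : - normsq x / 2 = \sum_j - (x 0 j ^+ 2 / 2).
  by rewrite /normsq /dotR mulNr mulr_suml sumrN; congr (- _); apply: eq_bigr => j _; rewrite expr2.
by rewrite expR_sum.
Qed.

(** The Fourier integrand t^a [gw] t e^(-i t y), written in components so that [gdom] applies to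
    each. *)
Definition ffac (y : R) a t : C := (('X^a).[t] * gw t * cos (t * y)) +i* (- (('X^a).[t] * gw t * sin (t * y))).

Lemma ffac_cdom (y : R) a : cdom (ffac y a).
Proof.
have c1 : continuous (fun t : R => cos (t * y)).
  move=> t; apply: (@continuous_comp _ _ _ (fun t : R => t * y) cos); last exact: continuous_cos.
  by apply: cvgM; [exact: cvg_id|exact: cvg_cst].
have c2 : continuous (fun t : R => sin (t * y)).
  move=> t; apply: (@continuous_comp _ _ _ (fun t : R => t * y) sin); last exact: continuous_sin.
  by apply: cvgM; [exact: cvg_id|exact: cvg_cst].
split; first by apply: gdom_poly => // t; rewrite ler_norml cos_geN1 cos_le1.
have h : gdom (fun t => ('X^a).[t] * gw t * sin (t * y)).
  by apply: gdom_poly => // t; rewrite ler_norml sin_geN1 sin_le1.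
by have := gdomZD (-1) h (gdom0 R); congr gdom; apply/funext => t; rewrite addr0 mulN1r.
Qed.

Lemma ci_ffac (y : R) a : ci (ffac y a) = (s2pi * gw y * (appell 1 a).[y])%:C * (- iC) ^+ a.
Proof.
rewrite -fourier_monomial /ci /=; congr (_ +i* _).
have h : gdom (fun t => ('X^a).[t] * gw t * sin (t * y)).
  have [_ h] := ffac_cdom y a.
  by have := gdomZD (-1) h (gdom0 R); congr gdom; apply/funext => t; rewrite addr0 mulN1r opprK.
by rewrite /Sn -mulN1r -JRZ//; congr JR; apply/funext => t; rewrite mulN1r.
Qed.

Lemma ffacE (y : R) a t : ffac y a t = (t ^+ a)%:C * (gw t)%:C * expi (- (t * y)).
Proof.
by rewrite /ffac hornerXn; apply: complex_eqP; rewrite ?ReM ?ImM /= ?cosN ?sinN; ring.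
Qed.

Lemma fourier_integrand_psum (I : Type) (s : seq I) (a : I -> R) (k : I -> 'X_{1..m}) y :
  (fun x => expi (- dotR x y) *
     ((\sum_(i <- s) a i * \prod_j x 0 j ^+ k i j) * expR (- normsq x / 2))%:C) =
  psum s (fun i => (a i)%:C) (fun i j => ffac (y 0 j) (k i j)).
Proof.
apply/funext => x; rewrite /psum mulr_suml rmorph_sum mulr_sumr; apply: eq_bigr => i _.
under [in RHS]eq_bigr do rewrite ffacE.
rewrite !big_split /= -expi_sum sumrN -/(dotR x y) gauss_prod.
by rewrite !rmorphM /= !rmorph_prod /=; ring.
Qed.

Lemma s2pi_neq0 : s2pi != 0.
Proof. by rewrite gt_eqF// sqrtr_gt0 mulr_gt0// pi_gt0. Qed.

Lemma cst2pi_prod : cst2pi R m * s2pi ^+ m = 1.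
Proof. by rewrite /cst2pi mulVf// expf_neq0// s2pi_neq0. Qed.

Definition hmon (k : 'X_{1..m}) y : R := \prod_j (appell 1 (k j)).[y 0 j].

Lemma prod_ci_ffac (k : 'X_{1..m}) y :
  \prod_j ci (ffac (y 0 j) (k j)) =
  (s2pi ^+ m * expR (- normsq y / 2) * hmon k y)%:C * (- iC) ^+ mdeg k.
Proof.
under eq_bigr do rewrite ci_ffac.
rewrite big_split /= -rmorph_prod prodrXr -mdegE; congr (_%:C * _).
by rewrite !big_split /= prodr_const card_ord gauss_prod.
Qed.

Lemma fourier_gauss_sum (I : Type) (s : seq I) (a : I -> R) (k : I -> 'X_{1..m}) y :
  fourier (fun x => ((\sum_(i <- s) a i * \prod_j x 0 j ^+ k i j) * expR (- normsq x / 2))%:C) y =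
  (\sum_(i <- s) (a i * hmon (k i) y)%:C * (- iC) ^+ mdeg (k i)) * (expR (- normsq y / 2))%:C.
Proof.
rewrite /fourier integralRm_iintC fourier_integrand_psum iintC_psum; last by move=> i j; exact: ffac_cdom.
rewrite mulr_sumr mulr_suml; apply: eq_bigr => i _; rewrite prod_ci_ffac.
have c1 : (cst2pi R m)%:C * (s2pi ^+ m)%:C = 1 :> C by rewrite -rmorphM cst2pi_prod.
rewrite !rmorphM /= in c1 *.
have F (a1 c w e h j : C) : c * w = 1 -> c * (a1 * (w * e * h * j)) = a1 * h * j * e.
  by move=> cw; transitivity ((c * w) * (a1 * h * j * e)); [ring|rewrite cw mul1r].
exact: F.
Qed.

Lemma exp_gauss_le (c : R) x :
  expR (c * norm1 x) * expR (- normsq x / 2) <= expR (c ^+ 2) ^+ m * \prod_j gh (x 0 j).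
Proof.
rewrite gauss_prod /norm1 mulr_sumr expR_sum -big_split /=.
have -> : expR (c ^+ 2) ^+ m = \prod_(j < m) expR (c ^+ 2) by rewrite prodr_const card_ord.
rewrite -big_split /=; apply: ler_prod => j _.
by rewrite mulr_ge0 ?expR_ge0// exp_abs_gw.
Qed.

Lemma hmon_le (k : 'X_{1..m}) : exists2 c : R, 0 <= c & forall y, `|hmon k y| <= c * expR (norm1 y).
Proof.
have H j : exists c : R, 0 <= c /\ forall t, `|(appell 1 (k j)).[t]| <= c * expR `|t|.
  by have [c c0 hc] := @poly_le_exp R (appell 1 (k j)); exists c.
have [c hc] := boolp.choice H.
exists (\prod_j c j) => [|y]; first by apply: prodr_ge0 => j _; have [] := hc j.
rewrite /norm1 expR_sum -big_split normr_prod; apply: ler_prod => j _.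
by rewrite normr_ge0; have [_ ->] := hc j.
Qed.

Section Measurability.
Let cmeas (g : m.-tuple R -> C) :=
  measurable_fun setT (fun t => complex.Re (g t)) /\ measurable_fun setT (fun t => complex.Im (g t)).

Let cmeasM f g : cmeas f -> cmeas g -> cmeas (fun t => f t * g t).
Proof.
move=> [f1 f2] [g1 g2]; split.
  have : measurable_fun setT (fun t => complex.Re (f t) * complex.Re (g t) - complex.Im (f t) * complex.Im (g t)).
    by apply: measurable_funB; apply: measurable_funM.
  by congr measurable_fun; apply/funext => t; rewrite ReM.
have : measurable_fun setT (fun t => complex.Re (f t) * complex.Im (g t) + complex.Im (f t) * complex.Re (g t)).
  by apply: measurable_funD; apply: measurable_funM.
by congr measurable_fun; apply/funext => t; rewrite ImM; ring.
Qed.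

Let cmeasD f g : cmeas f -> cmeas g -> cmeas (fun t => f t + g t).
Proof.
move=> [f1 f2] [g1 g2]; split.
  have : measurable_fun setT (fun t => complex.Re (f t) + complex.Re (g t)) by exact: measurable_funD.
  by congr measurable_fun; apply/funext => t; rewrite ReD.
have : measurable_fun setT (fun t => complex.Im (f t) + complex.Im (g t)) by exact: measurable_funD.
by congr measurable_fun; apply/funext => t; rewrite ImD.
Qed.

Let cmeas_cst (c : C) : cmeas (fun=> c).
Proof. by split; exact: measurable_cst. Qed.

Lemma psum_measurable (I : Type) (s : seq I) (c : I -> C) (F : I -> 'I_m -> R -> C) :
  (forall i j, cdom (F i j)) ->
  measurable_fun setT (fun t : m.-tuple R => complex.Re (psum s c F (rowT t))) /\
  measurable_fun setT (fun t : m.-tuple R => complex.Im (psum s c F (rowT t))).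
Proof.
move=> Fd; rewrite -/(cmeas (fun t => psum s c F (rowT t))) /psum.
elim: s => [|i s IH].
  by rewrite (_ : (fun t => _) = fun=> 0)//; apply/funext => t; rewrite big_nil.
rewrite (_ : (fun t => _) = fun t : m.-tuple R => c i * \prod_j F i j (rowT t 0 j) +
  \sum_(i <- s) c i * \prod_j F i j (rowT t 0 j)); last by apply/funext => t; rewrite big_cons.
apply: cmeasD => //; apply: cmeasM; first exact: cmeas_cst.
elim: (index_enum 'I_m) => [|j r IHr].
  by rewrite (_ : (fun t => _) = fun=> 1)//; apply/funext => t; rewrite big_nil.
rewrite (_ : (fun t => _) = fun t : m.-tuple R => F i j (rowT t 0 j) * \prod_(j <- r) F i j (rowT t 0 j)).
  apply: cmeasM => //; have [f1 f2] := Fd i j.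
  split.
    rewrite (_ : (fun t => _) = (fun u : R => complex.Re (F i j u)) \o (@tnth m R ^~ j)).
      by apply: measurableT_comp; [exact: gdom_measurable|exact: measurable_tnth].
    by apply/funext => t /=; rewrite mxE.
  rewrite (_ : (fun t => _) = (fun u : R => complex.Im (F i j u)) \o (@tnth m R ^~ j)).
    by apply: measurableT_comp; [exact: gdom_measurable|exact: measurable_tnth].
  by apply/funext => t /=; rewrite mxE.
by apply/funext => t; rewrite big_cons.
Qed.
End Measurability.

End GaussianFourierTransform.

(** * The inversion formula *)

Section InversionFormula.
Variables (R : realType) (m : nat).
Notation vecR := ('rV[R]_m).
Notation vecC := ('rV[(R[i])^o]_m).
Local Notation C := R[i].
Local Notation iC := (0 +i* 1 : C).
Local Notation s2pi := (Num.sqrt (2 * pi) : R).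
Variables (Rs Rp : seq vecR) (kappa : vecR -> R).
Hypotheses (HRs : root_system Rs) (HRp : positive_subsystem Rs Rp)
  (Hk : multiplicity Rs kappa).
Variable V : {mpoly R[m]} -> {mpoly R[m]}.
Hypothesis HV : intertwiner Rp kappa V.
Variable E : vecC -> vecC -> C.
Hypothesis HE : dunkl_kernel Rp kappa E.
Variable z : vecR.
Implicit Types (x y : vecR).

Let L (p : {mpoly R[m]}) : R := peval (V p) z.
Let rho : R := dotR z z + 1.
Let rho0 : 0 <= rho.
Proof. by rewrite addr_ge0// dotR_ge0. Qed.
Let zr : dotR z z <= rho ^+ 2.
Proof. exact: le_sqr_add1 (dotR_ge0 z). Qed.
Let Ll c u v : L (c *: u + v) = c * L u + L v.
Proof. by rewrite /L (VlinP HV) pevalD pevalZ. Qed.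
Let Lk k : `|L 'X_[k]| <= rho ^+ mdeg k.
Proof. exact: (intertwiner_monom_le HRs HRp Hk HV). Qed.
Let c1 : cabs (1 : C) <= 1. Proof. by rewrite (cabs_real 1) normr1. Qed.
Let ci1 : cabs (- iC) <= 1. Proof. by rewrite cabsN cabs_iC. Qed.

(** The symmetry enters here: the kernel series evaluates at x the image under [V] of a power of <.,
    z>, while [L] evaluates at z. *)
Lemma dunklH_functional n x : dunklH V n x z = L (lin x ^+ n).
Proof. exact: (dunklH_sym HRs HRp Hk HV). Qed.

Lemma dunklH_oppr n x : dunklH V n x (- z) = (-1) ^+ n * dunklH V n x z.
Proof.
rewrite /dunklH -pevalZ -(VZ HV) -exprZn scaleN1r.
have -> : lin (- z) = - lin z.
  by rewrite /lin -sumrN; apply: eq_bigr => j _; rewrite mxE scaleNr.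
by [].
Qed.

Lemma kernel_imag y : E (itoC y) (toC z) = pseriesC L 1 1 y.
Proof.
have -> : itoC y = (iC : C) *: toC y.
  apply/rowP => j; rewrite !mxE; apply: complex_eqP => /=.
    by rewrite mul0r mulr0 subr0.
  by rewrite mul0r mul1r ?addr0 ?add0r.
apply/eqP; rewrite -subr_eq0; apply/eqP/cabs_le_all => e e0.
have e2 : 0 < e / 2 by rewrite divr_gt0.
have [N0 HN] := kernel_series HRs HRp Hk HE z HV y iC e2.
have lim : ((series (pterm L 1 1 y) N +i* series (pterm L (1 * - iC) 1 y) N : C^o) @[N --> \oo]
   --> (pseriesC L 1 1 y : C^o))%classic.
  apply: cvgC_ReIm => /=; first exact: (pseries_cvg rho0 Ll Lk).
  by rewrite mul1r; exact: (pseries_cvg rho0 Ll Lk).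
have e2C : 0 < (e / 2)%:C :> C by rewrite ltcR.
move/cvgrPdist_le: lim => /(_ _ e2C) [N1 _ HN1].
pose N := maxn N0 N1.
have h1 := HN N (leq_maxl _ _).
have := HN1 N (leq_maxr _ _); rewrite /= normCabs lecR => h2.
(* After the exchange of y and z, the Taylor series at s = i and the phase series have the same
   partial sums. *)
have PE : \sum_(n < N) (dunklH V n y z / n`!%:R)%:C * iC ^+ n =
    series (pterm L 1 1 y) N +i* series (pterm L (1 * - iC) 1 y) N.
  rewrite /series /= !big_mkord; elim/big_ind3 : _ => //.
    by move=> x1 x2 x3 y1 y2 y3 -> ->; apply: complex_eqP.
  move=> n _; rewrite dunklH_functional /pterm /phase !mul1r.
  apply: complex_eqP; rewrite ?ReM ?ImM /=; first by ring.
  by ring.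
rewrite PE in h1.
set S := (X in cabs (_ - X) <= _) in h1.
have -> : E (iC *: toC y) (toC z) - pseriesC L 1 1 y =
   (E (iC *: toC y) (toC z) - S) - (pseriesC L 1 1 y - S) by ring.
by rewrite (le_trans (ler_cabsB _ _))// [leRHS](splitr e) lerD.
Qed.

Definition heatK y : C := hseries L 1 y +i* hseries L (- iC) y.

Lemma Kker_heatK y : Kker E y z = heatK y.
Proof.
rewrite /Kker (_ : (fun y' => _) = pseriesC L 1 1); first exact: (heat_half_pseriesC rho0 Ll Lk).
by apply/funext => y'; exact: kernel_imag.
Qed.

Definition triC N y : C := tri L 1 y N +i* tri L (- iC) y N.

Lemma tri_hseries_cvg w y : cabs w <= 1 -> (tri L w y N @[N --> \oo] --> hseries L w y)%classic.
Proof.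
move=> w1; apply/cvgrPdist_le => e e0.
pose B : R := expR (4 * heatA m rho) * expR (2 * (norm1 y * rho)).
have h2 : `|2^-1 : R| < 1 by rewrite ger0_norm// invf_lt1// ltr1n.
have lim : ((2^-1 : R) ^+ N * B @[N --> \oo] --> 0 * B)%classic.
  by apply: cvgM; [exact: cvg_expr|exact: cvg_cst].
rewrite mul0r in lim; move/cvgrPdist_le: lim => /(_ e e0); apply: filterS => N.
rewrite sub0r normrN => h; apply: le_trans (hseries_tri rho0 Ll Lk y N w1) _.
by apply: le_trans h; rewrite -exprVn ler_norm.
Qed.

Lemma triC_sum N y : triC N y =
  \sum_(k : 'X_{1..m < N}) (L 'X_[k] / (\prod_j (k j)`!%:R) * hmon k y)%:C * iC ^+ mdeg k.
Proof.
have P (k : 'X_{1..m}) : \prod_j ((appell 1 (k j)).[y 0 j] / (k j)`!%:R) = hmon k y / \prod_j (k j)`!%:R.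
  by rewrite big_split /= prodfV.
rewrite /triC !(tri_expansion _ _ _ Ll); elim/big_ind3 : _ => //.
  by move=> x1 x2 x3 y1 y2 y3 <- <-; apply: complex_eqP.
move=> k _; rewrite P /phase; apply: complex_eqP; rewrite ?ReM ?ImM /=; first by rewrite mul1r; ring.
by ring.
Qed.

(** Taylor polynomials of E(x, -z); the sign accounts for the argument -z. *)
Definition kpart N x : R := \sum_(d < N) (-1) ^+ d * L (d`!%:R^-1 *: lin x ^+ d).

Lemma kpartE N x : kpart N x =
  \sum_(k : 'X_{1..m < N}) ((-1) ^+ mdeg k * (L 'X_[k] / \prod_j (k j)`!%:R)) * \prod_j x 0 j ^+ k j.
Proof.
rewrite /kpart (lin_expansion x (fun d => (-1) ^+ d) N Ll); apply: eq_bigr => k _.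
by rewrite big_split /= prodfV; ring.
Qed.

Lemma kpart_le N x : `|kpart N x| <= expR (norm1 x * rho).
Proof.
have n0 : 0 <= norm1 x * rho by rewrite mulr_ge0// norm1_ge0.
rewrite (le_trans (ler_norm_sum _ _ _))//; apply: le_trans (exp_partial_le N n0).
apply: ler_sum => d _; rewrite normrM normrX normrN1 expr1n mul1r.
rewrite /L (VZ HV) pevalZ normrM ger0_norm ?invr_ge0// mulrC ler_wpM2r ?invr_ge0//.
by rewrite -/(L _) -dunklH_functional (dunklH_sym HRs HRp Hk HV); exact: (dunklH_le HRs HRp Hk HV).
Qed.

Lemma kpart_cvg x :
  (kpart N x @[N --> \oo] --> complex.Re (E (toC x) (toC (- z))))%classic /\
  complex.Im (E (toC x) (toC (- z))) = 0.
Proof.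
have H e : 0 < e -> exists N0, forall N, (N0 <= N)%N ->
    cabs (E (toC x) (toC (- z)) - (kpart N x)%:C) <= e.
  move=> e0; have [N0 HN] := kernel_series HRs HRp Hk HE (- z) HV x 1 e0.
  exists N0 => N /HN; rewrite scale1r; congr (cabs (_ - _) <= _).
  rewrite /kpart rmorph_sum; apply: eq_bigr => d _; rewrite expr1n mulr1; congr (_%:C).
  by rewrite dunklH_oppr dunklH_functional /L (VZ HV) pevalZ; ring.
split.
  apply/cvgrPdist_le => e /H[N0 HN]; exists N0 => // N /= /HN; apply: le_trans.
  by apply: le_trans (ler_Re_cabs _); rewrite ReD ReN.
apply/eqP; rewrite -normr_le0; apply/ler_addgt0Pr => e /H[N0 /(_ N0 (leqnn _))] h.
rewrite add0r; apply: le_trans h; apply: le_trans (ler_Im_cabs _).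
by rewrite ImD ImN /= subr0.
Qed.

(** Convergence by components, to match the componentwise definition of the integral. *)
Definition ccvg (u : nat -> C) (l : C) : Prop :=
  (complex.Re (u n) @[n --> \oo] --> complex.Re l)%classic /\
  (complex.Im (u n) @[n --> \oo] --> complex.Im l)%classic.

Lemma ccvg_unique u l l' : ccvg u l -> ccvg u l' -> l = l'.
Proof.
move=> [h1 h2] [h3 h4]; apply: complex_eqP.
  exact: (cvg_unique (@norm_hausdorff _ _) h1 h3).
exact: (cvg_unique (@norm_hausdorff _ _) h2 h4).
Qed.

Lemma ccvgZ (c : C) u l : ccvg u l -> ccvg (fun n => c * u n) (c * l).
Proof.
move=> [h1 h2]; split.
  under eq_fun do rewrite ReM; rewrite ReM.
  by apply: cvgB; apply: cvgM => //; exact: cvg_cst.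
under eq_fun do rewrite ImM; rewrite ImM.
by apply: cvgD; apply: cvgM => //; exact: cvg_cst.
Qed.

Lemma iintC_dct (f_ : nat -> vecR -> C) (f : vecR -> C) (A : R) :
  (forall n x, cabs (f_ n x) <= A * \prod_j @gh R (x 0 j)) ->
  (forall x, ccvg (f_ ^~ x) (f x)) ->
  (forall n k x, (k < m)%N -> cdom (fun t => iintC k (f_ n) (set_coord x k t))) ->
  ccvg (fun n => iintC m (f_ n) 0) (iintC m f 0).
Proof.
move=> fA ff fd; split.
  have [] := @iint_dct R m (fun n x => complex.Re (f_ n x)) (fun x => complex.Re (f x)) A _ _ _ m 0 (leqnn m).
  - by move=> n x; apply: le_trans (ler_Re_cabs _) (fA n x).
  - by move=> x; have [] := ff x.
  - move=> n k x km; under eq_fun do rewrite iint_r_Re.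
    by apply: gdom_measurable; have [] := fd n k x km.
  by move=> _; under eq_fun do rewrite iint_r_Re; rewrite iint_r_Re.
have [] := @iint_dct R m (fun n x => complex.Im (f_ n x)) (fun x => complex.Im (f x)) A _ _ _ m 0 (leqnn m).
- by move=> n x; apply: le_trans (ler_Im_cabs _) (fA n x).
- by move=> x; have [] := ff x.
- move=> n k x km; under eq_fun do rewrite iint_r_Im.
  by apply: gdom_measurable; have [] := fd n k x km.
by move=> _; under eq_fun do rewrite iint_r_Im; rewrite iint_r_Im.
Qed.

(** By (-1)^d (-i)^d = i^d the transform of a truncated kernel is the truncated heat series times a
    Gaussian, exactly for every N. *)
Lemma fourier_kpart N y :
  fourier (fun x => (kpart N x * expR (- normsq x / 2))%:C) y =
  triC N y * (expR (- normsq y / 2))%:C.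
Proof.
have -> : (fun x => (kpart N x * expR (- normsq x / 2))%:C : C) = fun x =>
   ((\sum_(k : 'X_{1..m < N}) ((-1) ^+ mdeg k * (L 'X_[k] / \prod_j (k j)`!%:R)) *
      \prod_j x 0 j ^+ k j) * expR (- normsq x / 2))%:C.
  by apply/funext => x; rewrite kpartE.
rewrite (fourier_gauss_sum (index_enum 'X_{1..m < N})
  (fun k => (-1) ^+ mdeg k * (L 'X_[k] / \prod_j (k j)`!%:R)) (fun k => k : 'X_{1..m})).
rewrite triC_sum; congr (_ * _); apply: eq_bigr => k _.
have e : (((-1) ^+ mdeg k : R)%:C : C) * (- iC) ^+ mdeg k = iC ^+ mdeg k.
  by rewrite (rmorphXn (real_complex R)) (rmorphN1 (real_complex R)) -exprMn mulN1r opprK.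
by rewrite -[in LHS]mulrA [in LHS](rmorphM (real_complex R)) mulrAC e mulrC.
Qed.

Lemma fourier_kernel y :
  fourier (fun x => (expR (- normsq x / 2))%:C * E (toC x) (toC (- z))) y =
  heatK y * (expR (- normsq y / 2))%:C.
Proof.
pose fN N x : C := expi (- dotR x y) * (kpart N x * expR (- normsq x / 2))%:C.
pose f x : C := expi (- dotR x y) * ((expR (- normsq x / 2))%:C * E (toC x) (toC (- z))).
have fNE N : fN N = psum (index_enum 'X_{1..m < N})
    (fun k => ((-1) ^+ mdeg k * (L 'X_[k] / \prod_j (k j)`!%:R))%:C)
    (fun (k : 'X_{1..m < N}) j => ffac (y 0 j) (k j)).
  rewrite -(fourier_integrand_psum (index_enum 'X_{1..m < N})
    (fun k => (-1) ^+ mdeg k * (L 'X_[k] / \prod_j (k j)`!%:R)) (fun k => k : 'X_{1..m})).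
  by apply/funext => x; rewrite /fN kpartE.
have lim : ccvg (fun N => iintC m (fN N) 0) (iintC m f 0).
  apply: (iintC_dct (A := expR (rho ^+ 2) ^+ m)).
  - move=> N x; rewrite cabsM cabs_expi mul1r cabs_real normrM [`|expR _|]ger0_norm ?expR_ge0//.
    apply: le_trans (exp_gauss_le rho x); rewrite ler_wpM2r ?expR_ge0//.
    by rewrite mulrC; exact: kpart_le.
  - move=> x; apply: ccvgZ; have [h1 h2] := kpart_cvg x; split.
      rewrite ReM /= mul0r subr0; under eq_fun do rewrite mulrC.
      by apply: cvgM => //; exact: cvg_cst.
    by rewrite ImM /= h2 mulr0 mul0r addr0; exact: cvg_cst.
  - move=> N k x km; rewrite fNE; apply: psum_slice_cdom => // i j; exact: ffac_cdom.
have lim2 : ccvg (fun N => fourier (fun x => (kpart N x * expR (- normsq x / 2))%:C) y)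
    (fourier (fun x => (expR (- normsq x / 2))%:C * E (toC x) (toC (- z))) y).
  rewrite /fourier; under eq_fun do rewrite integralRm_iintC.
  by rewrite integralRm_iintC; exact: ccvgZ lim.
apply: (ccvg_unique lim2); under eq_fun do rewrite fourier_kpart mulrC.
by rewrite [heatK y * _]mulrC; apply: (@ccvgZ _ (triC ^~ y)); split; exact: tri_hseries_cvg.
Qed.

Variable p : {mpoly R[m]}.

Definition fourierP y : C :=
  (\sum_(k <- msupp p) (p@_k * hmon k y)%:C * (- iC) ^+ mdeg k) * (expR (- normsq y / 2))%:C.

Lemma fourier_poly y : fourier (fun x => (peval p x * expR (- normsq x / 2))%:C) y = fourierP y.
Proof.
by rewrite /fourierP -(fourier_gauss_sum (msupp p) (fun k => p@_k) id).
Qed.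

Lemma fourierP_le : exists2 B : R, 0 <= B & forall y,
  cabs (fourierP y) <= B * (expR (norm1 y) * expR (- normsq y / 2)).
Proof.
have H (s : seq 'X_{1..m}) : exists2 B : R, 0 <= B & forall y,
    cabs (\sum_(k <- s) (p@_k * hmon k y)%:C * (- iC) ^+ mdeg k) <= B * expR (norm1 y).
  elim: s => [|k s [B B0 HB]]; first by exists 0 => // y; rewrite big_nil cabs0 mul0r.
  have [c c0 hc] := hmon_le R k.
  exists (`|p@_k| * c + B) => [|y]; first by rewrite addr_ge0// mulr_ge0.
  rewrite big_cons (le_trans (ler_cabsD _ _))// mulrDl lerD//.
  rewrite cabsM cabsX cabsN cabs_iC expr1n mulr1 cabs_real normrM -mulrA ler_wpM2l//.
have [B B0 HB] := H (msupp p); exists B => // y.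
by rewrite /fourierP cabsM cabs_real [`|expR _|]ger0_norm ?expR_ge0// mulrA ler_wpM2r ?expR_ge0.
Qed.

Definition prodN N y : C := triC N y * fourierP y.

Let pairs N := [seq (k, k') | k <- index_enum 'X_{1..m < N}, k' <- msupp p].
Let pcoef N (i : 'X_{1..m < N} * 'X_{1..m}) : C :=
  (L 'X_[i.1] / (\prod_j (i.1 j)`!%:R))%:C * iC ^+ mdeg i.1 * ((p@_(i.2))%:C * (- iC) ^+ mdeg i.2).
Let pfac N (i : 'X_{1..m < N} * 'X_{1..m}) (j : 'I_m) t : C :=
  ((appell 1 (i.1 j) * appell 1 (i.2 j)).[t] * gw t * 1)%:C.

Lemma pfac_cdom N i j : cdom (@pfac N i j).
Proof.
split; last exact: gdom0.
by apply: gdom_poly => [|t]; [exact: cst_continuous|rewrite normr1].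
Qed.

Lemma prodN_psum N : prodN N = psum (pairs N) (@pcoef N) (@pfac N).
Proof.
apply/funext => y; rewrite /psum /pairs big_allpairs_dep /prodN triC_sum /fourierP.
rewrite [LHS]mulr_suml; apply: eq_bigr => k _ /=.
rewrite [X in _ * X]mulr_suml [LHS]mulr_sumr; apply: eq_bigr => k' _.
have -> : \prod_j pfac (k, k') j (y 0 j) = (hmon k y * hmon k' y * expR (- normsq y / 2))%:C.
  rewrite /pfac -rmorph_prod; congr (_%:C); rewrite gauss_prod /hmon -!big_split.
  by apply: eq_bigr => j _ /=; rewrite hornerM mulr1.
by rewrite /pcoef /= !rmorphM /=; ring.
Qed.

Lemma prod_ci_pfac N (k : 'X_{1..m < N}) (k' : 'X_{1..m}) :
  \prod_j ci (pfac (k, k') j) =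
  (if (k : 'X_{1..m}) == k' then s2pi ^+ m * \prod_j (k j)`!%:R else 0)%:C.
Proof.
have J0 : JR (fun=> 0 : R) = 0 by rewrite /JR /Rintegral integral0.
have cE j : ci (pfac (k, k') j) = (Jp (appell 1 (k j) * appell 1 (k' j)))%:C.
  by rewrite /ci /pfac /= J0.
under eq_bigr do rewrite cE hermite_orthogonal.
rewrite -rmorph_prod; congr (_%:C); case: eqVneq => [<-|kk'].
  under eq_bigr do rewrite eqxx.
  by rewrite big_split /= prodr_const card_ord.
have [j /negPf kj] : exists j, k j != k' j.
  apply/existsP; apply: contraNT kk' => /existsPn h; apply/eqP/mnmP => j.
  by apply/eqP; have := h j; rewrite negbK.
by rewrite (bigD1 j)//= kj mul0r.
Qed.

Lemma functional_expand : L p = \sum_(k <- msupp p) p@_k * L 'X_[k].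
Proof.
rewrite {1}[p]mpolyE /L (Vsum HV) peval_sum; apply: eq_bigr => k _.
by rewrite (VZ HV) pevalZ.
Qed.

(** Once N exceeds the degree of p, orthogonality keeps one term for each monomial of p, with i^|nu|
    (-i)^|nu| = 1. The integrals are thus constant from there on, and their limit is known. *)
Lemma integral_prodN N : (msize p <= N)%N ->
  (cst2pi R m)%:C * iintC m (prodN N) 0 = (L p)%:C.
Proof.
move=> pN; rewrite prodN_psum iintC_psum; last exact: pfac_cdom.
rewrite /pairs big_allpairs_dep exchange_big /= functional_expand rmorph_sum mulr_sumr.
apply: eq_big_seq => k' kp.
have kN : (mdeg k' < N)%N by apply: leq_trans pN; exact: msize_mdeg_lt.
rewrite (bigD1 (BMultinom kN))//= [X in _ + X]big1 => [|k kk']; last first.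
  rewrite prod_ci_pfac ifF ?mulr0//; apply: contraNF kk' => /eqP kk'.
  by apply/eqP/val_inj.
rewrite addr0 prod_ci_pfac eqxx /pcoef /=.
have f0 : \prod_j (k' j)`!%:R != 0 :> R.
  by apply/prodf_neq0 => j _; rewrite pnatr_eq0 -lt0n fact_gt0.
have c1' : (cst2pi R m)%:C * (s2pi ^+ m)%:C = 1 :> C by rewrite -rmorphM cst2pi_prod.
have ii : iC ^+ mdeg k' * (- iC) ^+ mdeg k' = 1.
  by rewrite -exprMn mulrN iC_sqr opprK expr1n.
have ff : ((\prod_j (k' j)`!%:R)^-1)%:C * (\prod_j (k' j)`!%:R)%:C = 1 :> C.
  by rewrite -rmorphM mulVf.
rewrite !rmorphM /=.
have F (c w i j a l f g : C) : c * w = 1 -> i * j = 1 -> f * g = 1 ->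
    c * (l * f * i * (a * j) * (w * g)) = a * l.
  move=> cw ij fg; transitivity ((c * w) * (i * j) * (f * g) * (a * l)); first by ring.
  by rewrite cw ij fg !mul1r.
exact: F.
Qed.

Lemma triC_le N y : cabs (triC N y) <= 2 * expR (heatA m rho) * expR (norm1 y * rho).
Proof.
apply: le_trans (cabs_le_ReIm _) _; rewrite /triC /= -mulrA mulr_natl mulr2n lerD//;
  exact: (tri_le rho0 Ll Lk).
Qed.

Lemma heatK_le y : cabs (heatK y) <= 2 * expR (heatA m rho) * expR (norm1 y * rho).
Proof.
apply: le_trans (cabs_le_ReIm _) _; rewrite /heatK /= -mulrA [_ * expR (_ * _)]mulrC.
rewrite mulr_natl mulr2n lerD//; apply: exp_series_lim_le => [|k]; rewrite ?heatA_ge0//;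
  exact: (hterm_le rho0 Ll Lk).
Qed.

(** The constant is chosen before F, so that one bound serves every [triC N] and their limit
    [heatK]. *)
Lemma product_le : exists A : R, forall (F : vecR -> C),
  (forall y, cabs (F y) <= 2 * expR (heatA m rho) * expR (norm1 y * rho)) ->
  forall y, cabs (F y * fourierP y) <= A * \prod_j @gh R (y 0 j).
Proof.
have [B B0 HB] := fourierP_le.
exists (2 * expR (heatA m rho) * B * expR ((rho + 1) ^+ 2) ^+ m) => F HF y.
rewrite cabsM (le_trans (ler_pM (cabs_ge0 _) (cabs_ge0 _) (HF y) (HB y)))//.
have := exp_gauss_le (rho + 1) y; rewrite mulrDl mul1r expRD [rho * _]mulrC => h.
have -> : 2 * expR (heatA m rho) * expR (norm1 y * rho) *
   (B * (expR (norm1 y) * expR (- normsq y / 2))) =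
   2 * expR (heatA m rho) * B * (expR (norm1 y * rho) * expR (norm1 y) * expR (- normsq y / 2)) by ring.
by rewrite -[leRHS]mulrA ler_wpM2l// !mulr_ge0 ?expR_ge0.
Qed.

Lemma prodN_cvg y : ccvg (fun N => prodN N y) (heatK y * fourierP y).
Proof.
rewrite [heatK y * _]mulrC; under [X in ccvg X]eq_fun do rewrite /prodN mulrC.
by apply: (@ccvgZ _ (triC ^~ y)); split; exact: tri_hseries_cvg.
Qed.

Lemma integral_heatK :
  (L p)%:C = (cst2pi R m)%:C * integralRm (fun y => heatK y * fourierP y).
Proof.
have [A HA] := product_le.
have lim : ccvg (fun N => iintC m (prodN N) 0) (iintC m (fun y => heatK y * fourierP y) 0).
  apply: (iintC_dct (A := A)) => [N y|y|N k x km].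
  - by apply: HA; exact: triC_le.
  - exact: prodN_cvg.
  - by rewrite prodN_psum; apply: psum_slice_cdom => //; exact: pfac_cdom.
rewrite integralRm_iintC; apply: (ccvg_unique _ (ccvgZ _ lim)).
split; apply: cvg_near_cst; exists (msize p) => // N /= pN; by rewrite integral_prodN.
Qed.

(** Measurability passes from the product sums [prodN N] to their pointwise limit; finiteness comes
    from the product of Gaussians that dominates the modulus. *)
Lemma abs_integrable_heatK : abs_integrable (fun y => heatK y * fourierP y).
Proof.
have [A HA] := product_le.
have mN N := psum_measurable (pairs N) (@pcoef N) (@pfac_cdom N).
split.
- apply: (@measurable_fun_cvg _ _ _ setT (fun N (t : m.-tuple R) => complex.Re (prodN N (rowT t)))).
    by move=> N; rewrite prodN_psum; have [] := mN N.
  by move=> t _; have [] := prodN_cvg (rowT t).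
- apply: (@measurable_fun_cvg _ _ _ setT (fun N (t : m.-tuple R) => complex.Im (prodN N (rowT t)))).
    by move=> N; rewrite prodN_psum; have [] := mN N.
  by move=> t _; have [] := prodN_cvg (rowT t).
- have [] := @iint_e_le R m (fun y => (cabs (heatK y * fourierP y))%:E) A _ _ m 0 (leqnn m).
  + by move=> y; rewrite lee_fin cabs_ge0.
  + by move=> y; rewrite lee_fin; apply: HA; exact: heatK_le.
  by move=> _ h; apply: le_lt_trans h _; rewrite ltry.
Qed.

End InversionFormula.

Theorem mainTheorem2 (R : realType) (m : nat)
    (Rs Rp : seq 'rV[R]_m) (kappa : 'rV[R]_m -> R)
    (V : {mpoly R[m]} -> {mpoly R[m]})
    (E : 'rV[(R[i])^o]_m -> 'rV[(R[i])^o]_m -> R[i]) :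
  root_system Rs ->
  positive_subsystem Rs Rp ->
  multiplicity Rs kappa ->
  intertwiner Rp kappa V ->
  dunkl_kernel Rp kappa E ->
  forall (p : {mpoly R[m]}) (z : 'rV[R]_m),
  let gp : 'rV[R]_m -> R[i] :=
    fun x => (peval p x * expR (- normsq x / 2))%:C in
  let gE : 'rV[R]_m -> R[i] :=
    fun x => (expR (- normsq x / 2))%:C * E (toC x) (toC (- z)) in
  let I1 : 'rV[R]_m -> R[i] := fun y => Kker E y z * fourier gp y in
  let I2 : 'rV[R]_m -> R[i] :=
    fun y => fourier gE y * fourier gp y * (expR (normsq y / 2))%:C in
  [/\ abs_integrable I1, abs_integrable I2,
      (peval (V p) z)%:C = (cst2pi R m)%:C * integralRm I1 &
      (peval (V p) z)%:C = (cst2pi R m)%:C * integralRm I2].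

Proof.
move=> HRs HRp Hk HV HE p z gp gE I1 I2.
have gpE y : fourier gp y = fourierP p y by exact: fourier_poly.
have I1E : I1 = fun y => heatK V z y * fourierP p y.
  by apply/funext => y; rewrite /I1 gpE (Kker_heatK HRs HRp Hk HV HE).
(* The transform of [gE] brings a factor exp(-|y|^2/2), which the last factor of [I2] removes. *)
have I2E : I2 = I1.
  rewrite I1E; apply/funext => y; rewrite /I2 gpE.
  rewrite (fourier_kernel HRs HRp Hk HV HE) mulrAC -(mulrA (heatK V z y)) -rmorphM/= -expRD.
  by rewrite mulNr addNr expR0 mulr1.
rewrite I2E I1E; split; try exact: (abs_integrable_heatK HRs HRp Hk HV);
  exact: (integral_heatK HRs HRp Hk HV).
Qed.
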